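(* Let $\mathbb{K}$ be an arbitrary field, and let $n$ and $r$ be non-negative integers with $r<n$. Let $\mathcal{S}$ be an affine subspace of $\mathrm{S}_n(\mathbb{K})$ such that every matrix of $\mathcal{S}$ has rank at most $r$. Then $$\dim\mathcal{S}\leq \max\bigl(s^{(1)}_{n,r},s^{(2)}_{n,r}\bigr).$$ If equality holds, then at least one of the following situations holds: (i) $\mathcal{S}$ is congruent to $\widetilde{\mathrm{S}_r(\mathbb{K})}^{(n)}$; (ii) $\mathcal{S}$ is congruent to $\mathrm{WS}_{n,r}(\mathbb{K})$; (iii) $\mathbb{K}$ has characteristic $2$, $r$ is even and $\mathcal{S}$ is congruent to $\widetilde{\mathrm{A}_{r+1}(\mathbb{K})}^{(n)}$; (iv) $\mathbb{K}$ has cardinality $2$ and $\mathcal{S}$ is congruent to $\widetilde{Z_{r+1}(\mathbb{K})}^{(n)}$; (v) $\mathbb{K}$ has cardinality $2$, $r$ is odd and $\mathcal{S}$ is congruent to $Z'_{n,r}(\mathbb{K})$; (vi) $\mathbb{K}$ has cardinality $2$, $r=2$, $n=3$ and $\mathcal{S}$ is congruent to one of the affine spaces $\mathcal{Y}_1(\mathbb{K})$, $\mathcal{Y}_2(\mathbb{K})$ and $\mathcal{Y}_3(\mathbb{K})$.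
   Context: $\mathrm{M}_{n,p}(\mathbb{K})$ is the space of $n\times p$ matrices over $\mathbb{K}$, $\mathrm{M}_n(\mathbb{K})=\mathrm{M}_{n,n}(\mathbb{K})$; $\mathrm{S}_n(\mathbb{K})$ is the space of symmetric $n\times n$ matrices; $\mathrm{A}_n(\mathbb{K})$ is the space of alternating $n\times n$ matrices (skew-symmetric with zero diagonal). Affine subspaces are non-empty, and the dimension of an affine subspace is that of its translation vector space. For $M=(m_{i,j})\in \mathrm{M}_n(\mathbb{K})$, $\Delta(M):=\begin{bmatrix} m_{1,1}&\cdots&m_{n,n}\end{bmatrix}^T\in\mathbb{K}^n$. Two subsets $\mathcal{V},\mathcal{W}$ of $\mathrm{M}_n(\mathbb{K})$ are congruent if there is $P\in \mathrm{GL}_n(\mathbb{K})$ with $\mathcal{V}=P\,\mathcal{W}\,P^T$. For non-negative integers $r<n$: $s^{(1)}_{n,r}:=\binom{r+1}{2}$; $s^{(2)}_{n,r}:=\binom{s+1}{2}+s(n-s)$ if $r=2s$ is even, and $s^{(2)}_{n,r}:=\binom{s+1}{2}+s(n-s)+1$ if $r=2s+1$ is odd. For $k\le n$ and $\mathcal{V}\subset \mathrm{M}_k(\mathbb{K})$, $$\widetilde{\mathcal{V}}^{(n)}:=\Bigl\{\begin{bmatrix} S & 0_{k\times(n-k)}\\ 0_{(n-k)\times k} & 0_{(n-k)\times(n-k)}\end{bmatrix} \mid S\in\mathcal{V}\Bigr\}\subset \mathrm{M}_n(\mathbb{K}).$$ In the following block forms, the symbol $?$ denotes an arbitrary entry and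 $[?]_{a\times b}$ an arbitrary $a\times b$ block, and $[0]_{a\times b}$ is the zero block. If $r=2s$ is even, $\mathrm{WS}_{n,r}(\mathbb{K}):=\Bigl\{\begin{bmatrix} A & B\\ B^T & [0]_{(n-s)\times(n-s)}\end{bmatrix}\mid A\in \mathrm{S}_s(\mathbb{K}),\ B\in \mathrm{M}_{s,n-s}(\mathbb{K})\Bigr\}$. If $r=2s+1$ is odd, $\mathrm{WS}_{n,r}(\mathbb{K})$ is the space of all symmetric matrices of the form $$\begin{bmatrix} [?]_{s\times s}&[?]_{s\times 1}&[?]_{s\times(n-s-1)}\\ [?]_{1\times s}&?&[0]_{1\times(n-s-1)}\\ [?]_{(n-s-1)\times s}&[0]_{(n-s-1)\times 1}&[0]_{(n-s-1)\times(n-s-1)}\end{bmatrix}.$$ If $\#\mathbb{K}=2$, define for $n\ge 1$ $$Z_n(\mathbb{K}):=\Bigl\{\begin{bmatrix} S&\Delta(S)\\ \Delta(S)^T&(n-1).1_{\mathbb{K}}\end{bmatrix}\mid S\in \mathrm{S}_{n-1}(\mathbb{K})\Bigr\},$$ and, for odd $r=2s+1<n$, let $Z'_{n,r}(\mathbb{K})$ be the set of all symmetric matrices of the form $$\begin{bmatrix} [?]_{s\times s}&[?]_{s\times 2}&[?]_{s\times(n-s-2)}\\ [?]_{2\times s}&A&[0]_{2\times(n-s-2)}\\ [?]_{(n-s-2)\times s}&[0]_{(n-s-2)\times 2}&[0]_{(n-s-2)\times(n-s-2)}\end{bmatrix}\quad\text{with } A\in Z_2(\mathbb{K}).$$ If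 $\#\mathbb{K}=2$, define the following subsets of $\mathrm{S}_3(\mathbb{K})$: $$\mathcal{Y}_1(\mathbb{K}):=\Bigl\{\begin{bmatrix} a&b&c+1\\ b&c&0\\ c+1&0&0\end{bmatrix}\mid (a,b,c)\in\mathbb{K}^3\Bigr\},$$ $$\mathcal{Y}_2(\mathbb{K}):=\Bigl\{\begin{bmatrix} a&b&a+b+c+1\\ b&c&0\\ a+b+c+1&0&c\end{bmatrix}\mid (a,b,c)\in\mathbb{K}^3\Bigr\},$$ $$\mathcal{Y}_3(\mathbb{K}):=\Bigl\{\begin{bmatrix} a&b&c\\ b&0&a+1\\ c&a+1&0\end{bmatrix}\mid (a,b,c)\in\mathbb{K}^3\Bigr\}.$$ *)

(* Defs.v *)
From mathcomp Require Import all_boot all_order all_algebra.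
From mathcomp Require Import classical_sets functions cardinality.

Set Implicit Arguments.
Unset Strict Implicit.
Unset Printing Implicit Defensive.

Import GRing.Theory.
Local Open Scope classical_set_scope.
Local Open Scope ring_scope.

Definition symmetric_mxs (K : fieldType) (n : nat) : set 'M[K]_n :=
  [set M | M^T = M].
Arguments symmetric_mxs : clear implicits.

Definition alternating_mxs (K : fieldType) (n : nat) : set 'M[K]_n :=
  [set M | M^T = - M /\ forall i, M i i = 0].
Arguments alternating_mxs : clear implicits.

(* [S] is an affine subspace with translation vector space [V]; its dimension
   is then [\dim V]. Such an [S] is nonempty, as it contains [P]. *)
Definition affine_subspace (K : fieldType) (E : vectType K)
    (S : set E) (V : {vspace E}) : Prop :=
  exists P : E, S = [set P + v | v in [set v | v \in V]].

Definition congruent (K : fieldType) (n : nat) (V W : set 'M[K]_n) : Prop :=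
  exists2 P : 'M[K]_n, P \in unitmx & V = [set P *m M *m P^T | M in W].

Definition diag_col (K : fieldType) (n : nat) (M : 'M[K]_n) : 'cV[K]_n :=
  \col_i M i i.

Definition s1 (n r : nat) : nat := 'C(r.+1, 2).

Definition s2 (n r : nat) : nat :=
  let s := r./2 in
  if odd r then ('C(s.+1, 2) + s * (n - s) + 1)%N
  else ('C(s.+1, 2) + s * (n - s))%N.

(* Transport along k + (n - k) = n, so that block matrices live in 'M_n. *)
Definition block_cast (K : fieldType) (k n : nat) (le_kn : (k <= n)%N)
    (M : 'M[K]_(k + (n - k))) : 'M[K]_n :=
  castmx (subnKC le_kn, subnKC le_kn) M.

Definition zero_extension (K : fieldType) (k n : nat) (le_kn : (k <= n)%N)
    (V : set 'M[K]_k) : set 'M[K]_n :=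
  [set block_cast le_kn (block_mx S 0 0 0) | S in V].

(* Symmetric matrices whose lower-right block, of size n - s, lies in [D],
   the first s rows and columns being otherwise free. *)
Definition bordered (K : fieldType) (s n : nat) (le_sn : (s <= n)%N)
    (D : set 'M[K]_(n - s)) : set 'M[K]_n :=
  [set M | M^T = M /\
    exists (A : 'M[K]_s) (B : 'M[K]_(s, n - s)) (C : 'M[K]_(n - s, s)),
      exists2 N : 'M[K]_(n - s), D N & M = block_cast le_sn (block_mx A B C N)].

Fact half_lt (n r : nat) : (r < n)%N -> (r./2 < n)%N.
Proof.
by apply: leq_ltn_trans;
  rewrite -[leqRHS]odd_double_half -addnn addnCA leq_addr. Qed.

Fact half_le (n r : nat) : (r < n)%N -> (r./2 <= n)%N.
Proof. by move=> lt_rn; exact: ltnW (half_lt lt_rn). Qed.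

Fact half_lt_sub (n r : nat) : (r < n)%N -> (0 < n - r./2)%N.
Proof. by move=> lt_rn; rewrite subn_gt0 half_lt. Qed.

Fact odd_half_lt_sub (n r : nat) : (r < n)%N -> odd r -> (1 < n - r./2)%N.
Proof.
move=> lt_rn odd_r; rewrite ltn_subRL addn1; apply: leq_ltn_trans lt_rn.
by rewrite -[leqRHS]odd_double_half odd_r add1n ltnS -addnn leq_addr.
Qed.

Definition WS (K : fieldType) (n r : nat) (lt_rn : (r < n)%N) : set 'M[K]_n :=
  if odd r then
    bordered (half_le lt_rn)
      (zero_extension (half_lt_sub lt_rn) [set: 'M[K]_1])
  else
    [set block_cast (half_le lt_rn) (block_mx A B B^T 0)
      | A in symmetric_mxs K r./2 & B in [set: 'M[K]_(r./2, n - r./2)]].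
Arguments WS K {n r} lt_rn : rename.

(* The index is shifted: [Z K m] consists of matrices of size m + 1. *)
Definition Z (K : fieldType) (m : nat) : set 'M[K]_m.+1 :=
  [set castmx (addn1 m, addn1 m)
         (block_mx S (diag_col S) (diag_col S)^T (m%:R)%:M)
    | S in symmetric_mxs K m].
Arguments Z : clear implicits.

Definition Zprime (K : fieldType) (n r : nat) (lt_rn : (r < n)%N)
    (odd_r : odd r) : set 'M[K]_n :=
  bordered (half_le lt_rn)
    (zero_extension (odd_half_lt_sub lt_rn odd_r) (Z K 1)).
Arguments Zprime K {n r} lt_rn odd_r : rename.

Definition mx3 (K : fieldType) (rows : seq (seq K)) : 'M[K]_3 :=
  \matrix_(i, j) nth 0 (nth [::] rows i) j.

Definition Y1 (K : fieldType) : set 'M[K]_3 :=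
  [set M | exists a b c : K, M = mx3 [:: [:: a; b; c + 1];
                                         [:: b; c; 0];
                                         [:: c + 1; 0; 0]]].
Arguments Y1 : clear implicits.

Definition Y2 (K : fieldType) : set 'M[K]_3 :=
  [set M | exists a b c : K, M = mx3 [:: [:: a; b; a + b + c + 1];
                                         [:: b; c; 0];
                                         [:: a + b + c + 1; 0; c]]].
Arguments Y2 : clear implicits.

Definition Y3 (K : fieldType) : set 'M[K]_3 :=
  [set M | exists a b c : K, M = mx3 [:: [:: a; b; c];
                                         [:: b; 0; a + 1];
                                         [:: c; a + 1; 0]]].
Arguments Y3 : clear implicits.

Definition cast_mxs (K : fieldType) (m n : nat) (eq_mn : m = n)
    (W : set 'M[K]_m) : set 'M[K]_n :=
  [set castmx (eq_mn, eq_mn) M | M in W].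

(* Main.v *)
From Stdlib Require Import BinPos Pnat.
Require Import Defs.
From mathcomp Require Import all_boot all_order all_algebra.
From mathcomp Require Import classical_sets functions cardinality boolp.
From mathcomp Require Import zify ring.
From HB Require Import structures.

Set Implicit Arguments.
Unset Strict Implicit.
Unset Printing Implicit Defensive.

Import GRing.Theory.

(** Deleting a coordinate x from the quadratic forms of S loses only the border
    space at x, the directions that vanish outside the row and column of x. All
    rests on one fact about ranks: a border outside the row space of a symmetric
    matrix raises its rank by two (rank_border). If x is in the radical of a matrix
    A of S of the maximal rank r, border rows thus lie in the row space of A, with
    a corner determined by A (corner_value).

    For n > r + 1 there are two cases. If some border space at a radical vector
    vanishes, nothing is lost, and induction on n applies. Otherwise, apart from a
    configuration over two elements that is too small (char2_count), every border
    space contains a hyperbolic direction; deleting it as well lowers the rank by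
    two (rank_drop2). Counting gives border spaces of dimension at least r./2,
    while border spaces at independent radical vectors are orthogonal for A
    (zfam_orth). So their dimension is r./2, the bound s2 is reached exactly, and
    orthogonality produces a border row common to all radical vectors
    (common_direction). In suitable coordinates a basis vector is then completely
    free and can be deleted, the rank dropping by two (full_border): by induction
    S has the shape of WS. The case n = r + 1 is similar but also gives the
    alternating forms (corank1). This proves dim_bound_classified: an extremal
    space restricts to forms of rank at most one on a subspace of codimension
    r./2 (type_R), or restricts faithfully onto all symmetric forms in r variables
    (type_S) or all alternating forms in r + 1 variables (type_A).

    It remains to recover S from its restriction. For type_R, dimensions leave
    only the classification of affine spaces of forms of rank at most one
    (rank1_asp), whose sporadic member over two elements gives Zprime. For type_S
    and type_A, S consists of matrices with blocks A, G(A) and D(A), and a vector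
    in the radical of A must be in the radical of the whole matrix (radical_border, by the
    hyperplane principle affine_const_cg). Such a local map G is A L, up to a
    multiple of the diagonal of A over two elements (hollow_local, sym_local);
    L is removed by a congruence, and D is forced by the rank. The diagonal
    term yields Z, because the diagonal c of an invertible symmetric matrix A over
    two elements satisfies c A^-1 c^T = r (diag_form).

    For n = 3 and r = 2 over two elements these arguments have no room; an
    enumeration of the affine spaces of singular forms gives the normal forms,
    among them Y1, Y2 and Y3. *)

(** * Numerical bounds *)

Local Open Scope nat_scope.
Definition dmax (n r : nat) : nat := maxn (s1 n r) (s2 n r).

Lemma s1_double n r : s1 n r * 2 = r.+1 * r.
Proof. by rewrite /s1 bin2 /= muln2 -[in RHS](odd_double_half (r.+1 * r)) oddM /= andNb. Qed.

Lemma s2_double n s (o : bool) :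
  s2 n (o + s.*2) * 2 = s.+1 * s + 2 * (s * (n - s)) + 2 * o.
Proof.
rewrite /s2 oddD odd_double addbF oddb half_bit_double.
have := s1_double 0 s; rewrite /s1; case: o => /=; nia.
Qed.

Lemma max_lt a b c d : a * 2 < c * 2 -> b * 2 < d * 2 -> maxn a b < maxn c d.
Proof. lia. Qed.

Lemma dmax_lt_rank n r : 0 < r -> r < n -> dmax n r.-1 < dmax n r.
Proof.
move=> r0 rn; have {rn} -> : n = r.+1 + (n - r.+1) by lia.
move: (n - _) => e; rewrite /dmax.
rewrite -(odd_double_half r); move: (odd r) (r./2) (odd_double_half r) => o s; case: o => /= Er.
  have := s2_double (s.*2.+2 + e) s false; have := s1_double (s.*2.+2 + e) s.*2.
  have := s2_double (s.*2.+2 + e) s true; have := s1_double (s.*2.+2 + e) (1 + s.*2).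
  rewrite /= !add0n ?add1n /= => Ha Hb Hc Hd.
  have E1 : s.*2.+2 + e - s = s.+2 + e by lia.
  by apply: max_lt; rewrite ?Ha ?Hb ?Hc ?Hd ?E1 -?addnn; clear; nia.
case: s Er => [|s] Er; first by [move: Er r0; lia].
have := s2_double (s.*2.+3 + e) s true; have := s1_double (s.*2.+3 + e) s.*2.+1.
have := s2_double (s.*2.+3 + e) s.+1 false; have := s1_double (s.*2.+3 + e) (s.+1.*2).
rewrite /= !add0n ?add1n /= !doubleS /= => Ha Hb Hc Hd.
have E1 : s.*2.+3 + e - s = s.+3 + e by lia.
have E2 : s.*2.+3 + e - s.+1 = s.+2 + e by lia.
by apply: max_lt; rewrite ?Ha ?Hb ?Hc ?Hd ?E1 ?E2 -?addnn; clear; nia.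
Qed.

Lemma max_le a b c d w : w + a <= maxn c d -> w + b <= maxn c d -> w + maxn a b <= maxn c d.
Proof. lia. Qed.

(** The dimension count of the main induction, with n = p.+2 and p = r + e: a border space of
    dimension r./2 and a hyperbolic vector cost r./2 + p.+1 dimensions and two units of rank. *)
Lemma dmax_step2 e r : 1 < r -> r./2 + (r + e).+1 + dmax (r + e) (r - 2) <= dmax (r + e).+2 r.
Proof.
rewrite /dmax; rewrite -(odd_double_half r); move: (odd r) (r./2) (odd_double_half r) => o s Er r1.
rewrite half_bit_double.
case: s Er r1 => [|s] Er r1; first by case: o Er r1.
have E0 : o + s.+1.*2 - 2 = o + s.*2 by lia.
rewrite E0.
have := s2_double (o + s.+1.*2 + e) s o; have := s1_double (o + s.+1.*2 + e) (o + s.*2).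
have := s2_double (o + s.+1.*2 + e).+2 s.+1 o; have := s1_double (o + s.+1.*2 + e).+2 (o + s.+1.*2).
have -> : o + s.+1.*2 + e - s = (o + s + e).+2 by lia.
have -> : (o + s.+1.*2 + e).+2 - s.+1 = (o + s + e).+3 by lia.
move: (s1 _ _) (s2 _ _) (s1 _ _) (s2 _ _) => a b c d Ha Hb Hc Hd.
have dbl x y : x * 2 <= y * 2 -> x <= y by lia.
apply: max_le; rewrite leq_max; last first.
  apply/orP; right; apply: dbl; rewrite mulnDl Hd Hb doubleS -addnn; clear.
  by case: o => /=; nia.
have [le|gt] := leqP e.+1 (o + s).
  apply/orP; left; apply: dbl; rewrite mulnDl Hc Ha doubleS -addnn.
  clear -le; case: o le => /= le; nia.
apply/orP; right; apply: dbl; rewrite mulnDl Hc Hb doubleS -addnn.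
clear -gt; case: o gt => /= gt; nia.
Qed.

(** When the count of dmax_step2 is tight, s2 is the larger of the two bounds, so
    that it also dominates in size n.-1 and rank r - 2. *)
Lemma dmax_step2_eq e r : 1 < r -> r./2 + (r + e).+1 + dmax (r + e) (r - 2) = dmax (r + e).+2 r ->
  dmax (r + e).+1 (r - 2) + (r + e).+2 = dmax (r + e).+2 r
  /\ (3 < r -> s1 (r + e).+1 (r - 2) < dmax (r + e).+1 (r - 2)).
Proof.
rewrite /dmax; rewrite -(odd_double_half r); move: (odd r) (r./2) (odd_double_half r) => o s Er r1.
rewrite half_bit_double.
case: s Er r1 => [|s] Er r1; first by case: o Er r1.
have E0 : o + s.+1.*2 - 2 = o + s.*2 by lia.
rewrite E0.
rewrite (_ : s1 (o + s.+1.*2 + e).+1 (o + s.*2) = s1 (o + s.+1.*2 + e) (o + s.*2)) //.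
have Ha := s1_double (o + s.+1.*2 + e).+2 (o + s.+1.*2).
have Hb := s2_double (o + s.+1.*2 + e).+2 s.+1 o.
have Hc := s1_double (o + s.+1.*2 + e) (o + s.*2).
have Hd := s2_double (o + s.+1.*2 + e).+1 s o.
have Hd' := s2_double (o + s.+1.*2 + e) s o.
rewrite (_ : o + s.+1.*2 + e - s = (o + s + e).+2) in Hd'; last by lia.
rewrite (_ : (o + s.+1.*2 + e).+1 - s = (o + s + e).+3) in Hd; last by lia.
rewrite (_ : (o + s.+1.*2 + e).+2 - s.+1 = (o + s + e).+3) in Hb; last by lia.
move: (s1 (o + s.+1.*2 + e).+2 (o + s.+1.*2)) Ha => a Ha.
move: (s2 (o + s.+1.*2 + e).+2 (o + s.+1.*2)) Hb => b Hb.
move: (s1 (o + s.+1.*2 + e) (o + s.*2)) Hc => c Hc.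
move: (s2 (o + s.+1.*2 + e).+1 (o + s.*2)) Hd => d Hd.
move: (s2 (o + s.+1.*2 + e) (o + s.*2)) Hd' => d' Hd'.
have dbl x y : x * 2 <= y * 2 -> x <= y by lia.
have Eb : b = d + (o + s.+1.*2 + e).+2.
  suff : b * 2 = (d + (o + s.+1.*2 + e).+2) * 2 by lia.
  rewrite mulnDl Hd Hb doubleS -addnn; clear; case: o => /=; nia.
have Ed : d = d' + s.
  suff : d * 2 = (d' + s) * 2 by lia.
  rewrite mulnDl Hd Hd'; clear; case: o => /=; nia.
have Ea : a = c + (o + s.+1.*2) + (o + s.+1.*2).-1.
  suff : a * 2 = (c + (o + s.+1.*2) + (o + s.+1.*2).-1) * 2 by lia.
  rewrite !mulnDl Hc Ha doubleS -addnn; clear; case: o => /=; nia.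
case: s Er r1 E0 Ha Hb Hc Hd Hd' Eb Ed Ea => [|s] Er r1 E0 Ha Hb Hc Hd Hd' Eb Ed Ea H.
  have Ecd : c = d by move: Hc Hd; rewrite double0 addn0 !mul0n !muln0; clear; case: o; lia.
  split; last by case: o {E0 Ha Hb Hc Hd Hd' Eb Ed Ea H Er r1}.
  move: Eb Ea; rewrite Ecd doubleS double0 => -> ->; case: o {E0 Ha Hb Hc Hd Hd' Ed H Er r1} => /=; lia.
suff lcd : c < d by split; [lia | move=> _; lia].
have [le|gt] := leqP e.+1 (o + s); first by move: le H; clear -Eb Ed Ea; lia.
suff : c * 2 < d * 2 by lia.
by rewrite Hc Hd -addnn; clear -gt; case: o gt => /= gt; nia.
Qed.

Lemma dmax_pred e r : 1 < r -> s2 (r + e).+1 r < dmax (r + e).+2 r.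
Proof.
move=> r1; rewrite /dmax leq_max; apply/orP; right.
rewrite -(odd_double_half r); move: (odd r) (r./2) (odd_double_half r) => o s Er.
have := s2_double (o + s.*2 + e).+1 s o; have := s2_double (o + s.*2 + e).+2 s o.
have -> : (o + s.*2 + e).+1 - s = (o + s + e).+1 by lia.
have -> : (o + s.*2 + e).+2 - s = (o + s + e).+2 by lia.
move=> Ha Hb; suff H : s2 (o + s.*2 + e).+2 (o + s.*2) * 2 = s2 (o + s.*2 + e).+1 (o + s.*2) * 2 + s * 2.
  by move: H; case: s Er {Ha Hb} => [|s] Er; [case: o Er r1 => /= <- | lia].
by rewrite Ha Hb; clear; nia.
Qed.

Lemma dmax_step1 e r : 1 < r -> r.-1 + dmax (r + e) r.-1 < dmax (r + e).+2 r.
Proof.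
rewrite /dmax; rewrite -(odd_double_half r); move: (odd r) (r./2) (odd_double_half r) => o s Er r1.
have dbl x y : x * 2 < y * 2 -> x < y by lia.
have H w a b c d : (w + a) * 2 < c * 2 -> (w + b) * 2 < d * 2 -> w + maxn a b < maxn c d by lia.
have := s2_double (o + s.*2 + e).+2 s o; have := s1_double (o + s.*2 + e).+2 (o + s.*2).
have -> : (o + s.*2 + e).+2 - s = (o + s + e).+2 by lia.
case: o Er r1 => Er r1 Ha Hb.
  have := s2_double (1 + s.*2 + e) s false; have := s1_double (1 + s.*2 + e) s.*2.
  rewrite /= !add0n => Hc Hd.
  have E1 : 1 + s.*2 + e - s = 1 + s + e by lia.
  by apply: H; rewrite mulnDl ?Ha ?Hb ?Hc ?Hd ?E1 -?addnn; clear; nia.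
case: s Er r1 Ha Hb => [|s] Er r1 Ha Hb //.
have := s2_double (s.+1.*2 + e) s true; have := s1_double (s.+1.*2 + e) s.*2.+1.
rewrite !add0n in Ha Hb *.
rewrite add1n doubleS /= => Hc Hd.
have E1 : s.*2.+2 + e - s = 2 + s + e by lia.
rewrite doubleS /= in Ha Hb Hc Hd.
by apply: H; rewrite mulnDl ?Ha ?Hb ?Hc ?Hd ?E1 -?addnn; clear; nia.
Qed.

Lemma dmax_corank1 r : dmax r.+1 r = s1 r.+1 r.
Proof.
rewrite /dmax; rewrite -(odd_double_half r); move: (odd r) (r./2) => o s.
apply/maxn_idPl; have dbl x y : x * 2 <= y * 2 -> x <= y by lia.
apply: dbl; rewrite s1_double s2_double.
have -> : (o + s.*2).+1 - s = o + s.+1 by lia.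
by rewrite -addnn; case: o; case: s => [|s] /=; nia.
Qed.

Lemma s1S n m r : s1 n r.+1 = s1 m r + r.+1.
Proof. by have := s1_double n r.+1; have := s1_double m r; nia. Qed.

Lemma dmax_rank2 n : 2 < n -> dmax n 2 = n.
Proof. by move=> n2; rewrite /dmax /s1 /s2 /= !bin2 /=; lia. Qed.
Lemma dmax_rank1 n : 1 < n -> dmax n 1 = 1.
Proof. by move=> n2; rewrite /dmax /s1 /s2 /= !bin2 /=; lia. Qed.
Lemma dmax_rank0 n : dmax n 0 = 0.
Proof. by rewrite /dmax /s1 /s2 /= !bin2 /=; lia. Qed.

(** Gaps of at least two between consecutive bounds: they are what the hyperplane
    principle affine_const requires. *)
Lemma dmax_gap_corank2 r : 2 < r -> (dmax r (r - 2)).+1 < s1 r r.-1.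
Proof.
move=> r2; rewrite /dmax.
have dbl x y : x * 2 < y * 2 -> x < y by lia.
case: r r2 => [|[|[|r]]] // _.
rewrite subSS subn1 /= -ltn_predRL gtn_max; apply/andP; split.
  by apply: dbl; have := s1_double r.+3 r.+1; have := s1_double r.+3 r.+2; nia.
have : 0 < r.+1 by [].
move: r.+1 => q; rewrite -(odd_double_half q); move: (odd q) (q./2) => o s r0.
have := s1_double (o + s.*2).+2 (o + s.*2).+1; have := s2_double (o + s.*2).+2 s o.
rewrite (_ : (o + s.*2).+2 - s = o + s + 2); last by lia.
by case: o r0; case: s => [|s] //=; rewrite -?addnn; nia.
Qed.

Lemma dmax_gap_corank3 r : 3 < r -> (dmax r.-1 (r - 4)).+1 < s1 r (r - 2).
Proof.
move=> r3; have H : r.-1 - 2 < r.-1 by lia.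
case: r r3 H => [|[|[|[|r]]]] //= _ _.
have H1 := @dmax_lt_rank r.+3 r.+1 isT (ltnW (ltnSn _)).
have H2 := @dmax_lt_rank r.+3 r.+2 isT (ltnSn _).
have := dmax_corank1 r.+2.
rewrite (_ : r.+4 - 4 = r); last by lia.
rewrite (_ : r.+4 - 2 = r.+2); last by lia.
rewrite /s1 in H1 H2 *; move: H1 H2 => /=; lia.
Qed.

Lemma dmax_gap_alt r : 3 < r -> (dmax r.+1 (r - 2)).+1 < s1 r r.
Proof.
move=> r3; have H1 := @dmax_lt_rank r.+1 r (ltn_trans (isT : 0 < 3) r3) (ltnSn _).
have := @dmax_lt_rank r.+1 r.-1; rewrite (_ : r.-1.-1 = r - 2); last by lia.
have := dmax_corank1 r; rewrite /s1; lia.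
Qed.

Lemma dmax_leS n r : r < n -> dmax n r <= dmax n.+1 r.
Proof.
move=> rn; have H a b c d : a <= c -> b <= d -> maxn a b <= maxn c d by lia.
apply: H => //; have h : r./2 <= n by lia.
by rewrite /s2 subSn //; case: odd; rewrite ?leq_add2r leq_add2l leq_mul.
Qed.

Local Open Scope ring_scope.

(** * Affine spaces of matrices *)

Local Open Scope ring_scope.

Section Affine.
Variable K : fieldType.

(** An affine space of matrices: a base point and its direction space. A pair is
    used so that images under congruences compute. *)
Definition asp n := ('M[K]_n * {vspace 'M[K]_n})%type.
Definition ain n (S : asp n) (M : 'M[K]_n) : bool := M - S.1 \in S.2.
Definition bounded r n (S : asp n) : Prop :=
  forall M, ain S M -> M^T = M /\ (\rank M <= r)%N.

Lemma ain_base n (S : asp n) : ain S S.1.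
Proof. by rewrite /ain subrr mem0v. Qed.

Lemma ainD n (S : asp n) M v : ain S M -> v \in S.2 -> ain S (M + v).
Proof. by rewrite /ain addrAC => *; apply: rpredD. Qed.

Lemma ainB n (S : asp n) M N : ain S M -> ain S N -> M - N \in S.2.
Proof.
move=> HM HN; have -> : M - N = (M - S.1) - (N - S.1) by rewrite opprB addrA subrK.
exact: rpredB.
Qed.

Lemma bounded_dirT r n (S : asp n) v : bounded r S -> v \in S.2 -> v^T = v.
Proof.
move=> bS vS; have [/eqP + _] := bS _ (ainD (ain_base S) vS).
by rewrite linearD /= (bS _ (ain_base S)).1 (inj_eq (addrI _)) => /eqP.
Qed.

(** Congruence by an arbitrary rectangular matrix. Restricting the quadratic forms
    of S to a subspace is the case where the rows of Q span that subspace. *)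
Definition cg k n (Q : 'M[K]_(k, n)) (M : 'M[K]_n) : 'M[K]_k := Q *m M *m Q^T.

Lemma cg_is_linear k n (Q : 'M[K]_(k, n)) : linear (cg Q).
Proof. by move=> a u v; rewrite /cg mulmxDr mulmxDl -scalemxAr -scalemxAl. Qed.
HB.instance Definition _ k n (Q : 'M[K]_(k, n)) :=
  GRing.isLinear.Build K _ _ _ (cg Q) (cg_is_linear Q).

Lemma cg_cg l k n (P : 'M_(l, k)) (Q : 'M_(k, n)) M : cg P (cg Q M) = cg (P *m Q) M.
Proof. by rewrite /cg trmx_mul !mulmxA. Qed.

Lemma cg1 n (M : 'M_n) : cg 1%:M M = M.
Proof. by rewrite /cg mul1mx trmx1 mulmx1. Qed.

Lemma cgT k n (Q : 'M_(k, n)) M : (cg Q M)^T = cg Q M^T.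
Proof. by rewrite /cg !trmx_mul trmxK mulmxA. Qed.

Lemma cg_rank k n (Q : 'M_(k, n)) M : (\rank (cg Q M) <= \rank M)%N.
Proof. by rewrite (leq_trans (mxrankM_maxl _ _)) ?mxrankM_maxr. Qed.

Lemma cgK k n (Q' : 'M_(n, k)) (Q : 'M_(k, n)) : Q' *m Q = 1%:M -> cancel (cg Q) (cg Q').
Proof. by move=> E M; rewrite cg_cg E cg1. Qed.

Lemma cg_rank_eq k n (Q' : 'M_(n, k)) (Q : 'M_(k, n)) M :
  Q' *m Q = 1%:M -> \rank (cg Q M) = \rank M.
Proof.
move=> E; apply/eqP; rewrite eqn_leq cg_rank /=.
by rewrite -{1}(cgK E M) cg_rank.
Qed.

Definition compr k n (Q : 'M[K]_(k, n)) (S : asp n) : asp k :=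
  (cg Q S.1, (linfun (cg Q) @: S.2)%VS).

Lemma comp_dir k n (Q : 'M_(k, n)) (S : asp n) v : v \in S.2 -> cg Q v \in (compr Q S).2.
Proof. by move=> vS; apply/memv_imgP; exists v => //; rewrite lfunE. Qed.

Lemma dir_comp k n (Q : 'M_(k, n)) (S : asp n) w : w \in (compr Q S).2 ->
  exists2 v, v \in S.2 & w = cg Q v.
Proof. by case/memv_imgP => v vS ->; exists v => //; rewrite lfunE. Qed.

Lemma comp_ain k n (Q : 'M_(k, n)) (S : asp n) M : ain S M -> ain (compr Q S) (cg Q M).
Proof. by move=> HM; rewrite /ain /= -linearB comp_dir. Qed.

Lemma ain_comp k n (Q : 'M_(k, n)) (S : asp n) B : ain (compr Q S) B ->
  exists2 M, ain S M & B = cg Q M.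
Proof.
case/dir_comp => v vS E; exists (S.1 + v); first by rewrite ainD ?ain_base.
by rewrite linearD /= -E addrC subrK.
Qed.

Lemma bounded_comp r k n (Q : 'M_(k, n)) (S : asp n) : bounded r S -> bounded r (compr Q S).
Proof.
move=> bS B /ain_comp [M HM ->]; have [E le] := bS _ HM.
by rewrite cgT E; split=> //; apply: leq_trans le; apply: cg_rank.
Qed.

Lemma dim_comp k n (Q : 'M_(k, n)) (S : asp n) :
  \dim S.2 = (\dim (S.2 :&: lker (linfun (cg Q))) + \dim (compr Q S).2)%N.
Proof. by rewrite limg_ker_dim. Qed.

Lemma dim_comp_inj k n (Q : 'M_(k, n)) (S : asp n) :
  (forall v, v \in S.2 -> cg Q v = 0 -> v = 0) -> \dim (compr Q S).2 = \dim S.2.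
Proof.
move=> inj; rewrite (dim_comp Q) (_ : (_ :&: _)%VS = 0%VS) ?dimv0 //.
apply/eqP; rewrite -subv0; apply/subvP => v; rewrite memv_cap memv_ker lfunE /=.
by case/andP => vS /eqP /(inj _ vS) ->; rewrite mem0v.
Qed.

Lemma dim_comp_unit k n (Q' : 'M_(n, k)) (Q : 'M_(k, n)) (S : asp n) :
  Q' *m Q = 1%:M -> \dim (compr Q S).2 = \dim S.2.
Proof. by move=> E; apply: dim_comp_inj => v _ /(congr1 (cg Q')); rewrite cgK // linear0. Qed.

Lemma comp_comp l k n (P : 'M_(l, k)) (Q : 'M_(k, n)) (S : asp n) :
  compr P (compr Q S) = compr (P *m Q) S.
Proof.
rewrite /compr /= cg_cg -limg_comp; congr (_, (_ @: _)%VS).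
by apply/lfunP => v; rewrite comp_lfunE !lfunE /= cg_cg.
Qed.

Lemma comp1 n (S : asp n) : compr 1%:M S = S.
Proof.
case: S => M V; rewrite /compr /= cg1; congr (_, _).
rewrite -[RHS]lim1g; congr (_ @: _)%VS.
by apply/lfunP => v; rewrite !lfunE /= cg1.
Qed.

Lemma vspace_rows m (U : {vspace 'rV[K]_m}) :
  exists2 X : 'M[K]_(\dim U, m), row_free X & forall u, (u \in U) = (u <= X)%MS.
Proof.
pose X : 'M[K]_(\dim U, m) := \matrix_i (vbasis U)`_i; exists X.
  have fU := basis_free (vbasisP U).
  rewrite -kermx_eq0; apply/eqP/row_matrixP => i; rewrite row0.
  set c := row i _; have E : c *m X = 0 by rewrite -row_mul mulmx_ker row0.
  have /freeP F := fU; apply/rowP => j; rewrite [RHS]mxE.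
  apply: (F (fun j => c 0 j)).
  rewrite -[RHS]E mulmx_sum_row; apply: eq_bigr => k _; congr (_ *: _).
  by rewrite rowK.
move=> u; apply/idP/submxP => [uU|[D ->]].
  exists (\row_i coord (vbasis U) i u); rewrite {1}(coord_vbasis uU) mulmx_sum_row.
  by apply: eq_bigr => k _; rewrite rowK mxE.
rewrite mulmx_sum_row; apply: memv_suml => k _; rewrite rowK memvZ //.
by apply: vbasis_mem; rewrite mem_nth ?size_tuple.
Qed.

Lemma dim_rows_le m k (U : {vspace 'rV[K]_m}) (A : 'M[K]_(k, m)) :
  (forall u, u \in U -> (u <= A)%MS) -> (\dim U <= \rank A)%N.
Proof.
have [X fX UX] := vspace_rows U; move=> H.
rewrite -(eqnP fX); apply: mxrankS; apply/row_subP => i; apply: H.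
by rewrite UX row_sub.
Qed.

Lemma dim_rows_eq m k (U : {vspace 'rV[K]_m}) (A : 'M[K]_(k, m)) :
  (forall u, u \in U -> (u <= A)%MS) -> (\rank A <= \dim U)%N ->
  forall u, (u <= A)%MS -> u \in U.
Proof.
have [X fX UX] := vspace_rows U; move=> H le u uA.
have XA : (X <= A)%MS by apply/row_subP => i; apply: H; rewrite UX row_sub.
rewrite UX; apply: submx_trans uA _; have := mxrank_leqif_sup XA.
by rewrite (eqnP fX) => -[_ <-]; rewrite eqn_leq le andbT -(eqnP fX) mxrankS.
Qed.

(** The Schur complement. The block Z is divided by A on the left only, so A may be singular. *)
Lemma rank_block_Schur a b (g : 'M[K]_a) (Y : 'M_(a, b)) (A : 'M_b) : A^T = A ->
  \rank (block_mx g (Y *m A) (Y *m A)^T A) = (\rank (g - Y *m A *m Y^T)%R + \rank A)%N.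
Proof.
move=> AT; rewrite -rank_diag_block_mx.
pose P : 'M_(a + b) := block_mx 1%:M Y 0 1%:M.
pose P' : 'M_(a + b) := block_mx 1%:M (- Y) 0 1%:M.
have E : P' *m P = 1%:M.
  by rewrite mulmx_block !mul1mx !mul0mx !mulmx1 !mulmx0 !add0r !addr0 subrr -scalar_mx_block.
rewrite -[RHS](cg_rank_eq _ E); congr (\rank _).
rewrite /cg tr_block_mx !trmx1 trmx0 !mulmx_block !mulmx1 !mul1mx !mul0mx !mulmx0.
by rewrite !add0r !addr0 trmx_mul AT subrK.
Qed.

Lemma rank_block_leP a b (g : 'M[K]_a) (Z : 'M_(a, b)) (A : 'M_b) : A^T = A ->
  (\rank (block_mx g Z Z^T A) <= \rank A)%N ->
  forall Y, Z = Y *m A -> g = Y *m A *m Y^T.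
Proof.
move=> AT le Y E; move: le; rewrite E rank_block_Schur // -{2}[\rank A]add0n leq_add2r.
by rewrite leqn0 mxrank_eq0 subr_eq0 => /eqP.
Qed.

(** A border outside the row space of A raises the rank once as a row and once as a column. *)
Lemma rank_border m (d : 'M[K]_1) (c : 'rV_m) (A : 'M_m) : A^T = A ->
  ~~ (c <= A)%MS -> (\rank A + 2 <= \rank (block_mx d c c^T A))%N.
Proof.
move=> AT cA.
have step k (x : 'rV[K]_k) p (B : 'M[K]_(p, k)) : ~~ (x <= B)%MS -> (\rank B < \rank (col_mx x B))%N.
  move=> xB; have BB : (B <= col_mx x B)%MS by rewrite -addsmxE addsmxSr.
  rewrite ltn_neqAle mxrankS // andbT; apply: contra xB => /eqP e.
  have := mxrank_leqif_sup BB; case=> _; rewrite e eqxx => /esym.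
  by apply: submx_trans; rewrite -addsmxE addsmxSl.
have H1 := step _ _ _ _ cA.
rewrite addn2; apply: leq_ltn_trans H1 _.
rewrite -mxrank_tr tr_col_mx AT.
apply: step; apply: contra cA => /submxP [D].
rewrite mul_mx_row => /eq_row_mx [_ ->]; exact: submxMl.
Qed.

End Affine.

(** * Splitting off a coordinate *)

Section Mod.
Variable K : fieldType.
Local Notation asp := (asp K).
(** Deletes the first coordinate: cg (Dr m) M is the lower right block of M. *)
Definition Dr m : 'M[K]_(m, 1 + m) := row_mx 0 1%:M.
(** Symmetric matrices split along their first coordinate. *)
Definition bl m (a : K) (u : 'rV[K]_m) (A : 'M[K]_m) : 'M[K]_(1 + m) :=
  block_mx a%:M u u^T A.

Lemma cg_Dr m (M : 'M_(1 + m)) : cg (Dr m) M = drsubmx M.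
Proof.
rewrite -{1}[M]submxK /cg /Dr mul_row_block tr_row_mx mul_row_col.
by rewrite !mul0mx !mul1mx !add0r trmx0 trmx1 mulmx0 mulmx1 add0r.
Qed.

Lemma cg_Dr_bl m a (u : 'rV_m) A : cg (Dr m) (bl a u A) = A.
Proof. by rewrite cg_Dr block_mxKdr. Qed.

Lemma blE m (M : 'M_(1 + m)) : M^T = M -> M = bl (M 0 0) (ursubmx M) (cg (Dr m) M).
Proof.
move=> E; rewrite /bl cg_Dr trmx_ursub E.
rewrite -{1}[M]submxK; congr block_mx.
by rewrite [ulsubmx M]mx11_scalar !mxE; congr (_%:M); congr (M _ _); apply: val_inj.
Qed.

Lemma blD m a a' (u u' : 'rV_m) A A' : bl a u A + bl a' u' A' = bl (a + a') (u + u') (A + A').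
Proof. by rewrite /bl add_block_mx -raddfD /= linearD. Qed.

Lemma blZ m k a (u : 'rV_m) A : k *: bl a u A = bl (k * a) (k *: u) (k *: A).
Proof. by rewrite /bl scale_block_mx scale_scalar_mx linearZ. Qed.

Lemma bl0 m : bl 0 (0 : 'rV_m) 0 = 0.
Proof. by rewrite /bl trmx0 raddf0 block_mx0. Qed.

Lemma bl_sym m a (u : 'rV_m) A : (bl a u A)^T = bl a u A -> A^T = A.
Proof. by rewrite /bl tr_block_mx => /eq_block_mx []. Qed.

Lemma symP_bl m a (u : 'rV_m) A : A^T = A -> (bl a u A)^T = bl a u A.
Proof. by move=> E; rewrite /bl tr_block_mx trmxK tr_scalar_mx E. Qed.

(** The value of the bilinear form A. *)
Definition ql m (v : 'rV[K]_m) (A : 'M[K]_m) (w : 'rV[K]_m) : K := (v *m A *m w^T) 0 0.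

Lemma qlE m (v : 'rV[K]_m) A w : v *m A *m w^T = (ql v A w)%:M.
Proof. exact: mx11_scalar. Qed.

Lemma qlDl m (v v' : 'rV[K]_m) A w : ql (v + v') A w = ql v A w + ql v' A w.
Proof. by rewrite /ql !mulmxDl mxE. Qed.
Lemma qlDr m (v : 'rV[K]_m) A w w' : ql v A (w + w') = ql v A w + ql v A w'.
Proof. by rewrite /ql linearD /= mulmxDr mxE. Qed.
Lemma qlZl m k (v : 'rV[K]_m) A w : ql (k *: v) A w = k * ql v A w.
Proof. by rewrite /ql -!scalemxAl mxE. Qed.
Lemma qlZr m k (v : 'rV[K]_m) A w : ql v A (k *: w) = k * ql v A w.
Proof. by rewrite /ql linearZ /= -scalemxAr mxE. Qed.
Lemma qlC m (v : 'rV[K]_m) A w : A^T = A -> ql v A w = ql w A v.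
Proof.
by move=> E; rewrite /ql -[v *m A *m w^T]trmxK mxE !trmx_mul trmxK E mulmxA.
Qed.
Lemma ql_mul m (v : 'rV[K]_m) A w x : v *m A = x -> ql v A w = (x *m w^T) 0 0.
Proof. by move=> E; rewrite /ql E. Qed.
Lemma ql0l m (v : 'rV[K]_m) A w : v *m A = 0 -> ql v A w = 0.
Proof. by move=> E; rewrite /ql E mul0mx mxE. Qed.

Lemma mx11_eq0 (x : K) : (x%:M == 0 :> 'M_1) = (x == 0).
Proof.
apply/eqP/eqP => [/matrixP /(_ 0 0)|->]; last exact: raddf0.
by rewrite !mxE eqxx mulr1n.
Qed.

Lemma rank_bl m d (v : 'rV[K]_m) A : A^T = A ->
  \rank (bl d (v *m A) A) = ((d != ql v A v) + \rank A)%N.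
Proof.
by move=> E; rewrite rank_block_Schur // qlE -raddfB /= rank_rV mx11_eq0 subr_eq0.
Qed.

Lemma rank_bl_out m d (c : 'rV[K]_m) A : A^T = A -> ~~ (c <= A)%MS ->
  (\rank A + 2 <= \rank (bl d c A))%N.
Proof. exact: rank_border. Qed.

Lemma rank_bl_dr m d (c : 'rV[K]_m) A : (\rank A <= \rank (bl d c A))%N.
Proof. by rewrite -{1}(cg_Dr_bl d c A) cg_rank. Qed.

Lemma ain_blP m r (S : asp (1 + m)) A : bounded r S -> ain (compr (Dr m) S) A ->
  exists d c, ain S (bl d c A).
Proof.
move=> bS /ain_comp [M MS ->]; exists (M 0 0), (ursubmx M).
by rewrite -blE //; case: (bS _ MS).
Qed.

Lemma bl_ain m (S : asp (1 + m)) d c A : ain S (bl d c A) -> ain (compr (Dr m) S) A.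
Proof. by move/(comp_ain (Dr m)); rewrite cg_Dr_bl. Qed.

Lemma dir_blP m r (S : asp (1 + m)) A : bounded r S -> A \in (compr (Dr m) S).2 ->
  exists d c, bl d c A \in S.2.
Proof.
move=> bS /dir_comp [M MS ->]; exists (M 0 0), (ursubmx M).
by rewrite -blE //; apply: (bounded_dirT bS).
Qed.

Lemma border_in m r (S : asp (1 + m)) d c A : bounded r S -> ain S (bl d c A) ->
  (r <= \rank A + 1)%N -> (c <= A)%MS.
Proof.
move=> bS MS le; have [sM rM] := bS _ MS.
have [//|out] := boolP (c <= A)%MS; have H := rank_bl_out d (bl_sym sM) out; lia.
Qed.

(** Adding the direction to a matrix with border c gives a matrix with border c + u;
    if u were outside the row space of A, one of the two borders would be too. *)
Lemma border_dir_in m r (S : asp (1 + m)) a u A : bounded r S -> bl a u 0 \in S.2 ->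
  ain (compr (Dr m) S) A -> (r <= \rank A + 1)%N -> (u <= A)%MS.
Proof.
move=> bS uS AS le; have [d [c MS]] := ain_blP bS AS.
have MS' := ainD MS uS; rewrite blD addr0 in MS'.
have cA := border_in bS MS le; have := border_in bS MS' le.
by move=> H; rewrite -(addKr c u) addmx_sub // eqmx_opp.
Qed.

(** A matrix of S over A of rank r has the rank of A, so its corner is forced. *)
Lemma border_corner m r (S : asp (1 + m)) d v A : bounded r S -> ain S (bl d (v *m A) A) ->
  (r <= \rank A)%N -> d = ql v A v.
Proof.
move=> bS MS le; have [sM rM] := bS _ MS; move: rM; rewrite rank_bl ?(bl_sym sM) //.
by case: eqP => //= _; lia.
Qed.

Lemma border_noE m r (S : asp (1 + m)) A : bounded r S -> ain (compr (Dr m) S) A ->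
  (r <= \rank A)%N -> bl 1 0 0 \notin S.2.
Proof.
move=> bS AS le; apply/negP => ES; have [d [c MS]] := ain_blP bS AS.
have /submxP [v Ev] : (c <= A)%MS by apply: border_in bS MS _; lia.
have MS' := ainD MS ES; rewrite blD !addr0 in MS'.
rewrite Ev in MS MS'; have := border_corner bS MS' le.
rewrite -(border_corner bS MS le) => /eqP; rewrite -subr_eq0 addrAC subrr add0r oner_eq0.
by [].
Qed.

(** The dimension of the space of those directions of S that vanish outside the
    first row and column; it measures what is lost by deleting the first coordinate. *)
Definition Wdim m (S : asp (1 + m)) : nat := \dim (S.2 :&: lker (linfun (cg (Dr m)))).
Definition urm m (M : 'M[K]_(1 + m)) : 'rV[K]_m := ursubmx M.
Lemma urm_is_linear m : linear (@urm m).
Proof. by move=> a u v; apply/matrixP => i j; rewrite !mxE. Qed.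
HB.instance Definition _ m := GRing.isLinear.Build K _ _ _ (@urm m) (@urm_is_linear m).
(** The rows u of the directions bl a u 0 of S. *)
Definition Usp m (S : asp (1 + m)) : {vspace 'rV[K]_m} :=
  (linfun (@urm m) @: (S.2 :&: lker (linfun (cg (Dr m)))))%VS.

Lemma UspP m r (S : asp (1 + m)) u : bounded r S ->
  reflect (exists a, bl a u 0 \in S.2) (u \in Usp S).
Proof.
move=> bS; apply: (iffP memv_imgP) => [[v] | [a H]].
  rewrite memv_cap memv_ker !lfunE /= => /andP [vS /eqP v0] ->.
  move: (vS); rewrite [v in v \in _](blE (bounded_dirT bS vS)) v0 => H.
  by eexists; rewrite /urm; exact: H.
exists (bl a u 0); last by rewrite lfunE /= /urm block_mxKur.
by rewrite memv_cap H memv_ker lfunE /= cg_Dr_bl eqxx.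
Qed.

Lemma Wdim_split m r (S : asp (1 + m)) : bounded r S ->
  (\dim (Usp S) <= Wdim S <= \dim (Usp S) + (bl 1 0 0 \in S.2))%N.
Proof.
move=> bS; rewrite /Wdim /Usp -(limg_ker_dim (linfun (@urm m))).
rewrite leq_addl addnC leq_add2l /=.
set W := (_ :&: _)%VS; have WE v : v \in W -> exists a, v = bl a 0 0 /\ bl a 0 0 \in S.2.
  rewrite !memv_cap !memv_ker !lfunE /= -andbA => /and3P [vS /eqP v0 /eqP v1].
  have E := blE (bounded_dirT bS vS); rewrite /urm in v1; rewrite v0 v1 in E.
  by eexists; split; [exact: E | rewrite -E].
case E: (bl 1 0 0 \in S.2).
  suff : (W <= <[bl 1 0 0]>)%VS by move/dimvS => H; apply: leq_trans H _; rewrite dim_vline; case: (_ != 0).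
  apply/subvP => v /WE [a [-> _]]; apply/vlineP; exists a.
  by rewrite blZ mulr1 !scaler0.
rewrite leqn0 dimv_eq0 -subv0; apply/subvP => v /WE [a [-> aS]].
have [->|a0] := eqVneq a 0; first by rewrite bl0 mem0v.
move: E; rewrite (_ : bl 1 0 0 = a^-1 *: bl a 0 0) ?memvZ //.
by rewrite blZ mulVf // !scaler0.
Qed.

Lemma dim_asp m (S : asp (1 + m)) : \dim S.2 = (Wdim S + \dim (compr (Dr m) S).2)%N.
Proof. exact: dim_comp. Qed.

Lemma Wdim_le m r (S : asp (1 + m)) : bounded r S -> (Wdim S <= m.+1)%N.
Proof.
move=> bS; have /andP [_ H] := Wdim_split bS; apply: leq_trans H _.
have := dimvS (subvf (Usp S)); rewrite dimvf /dim /= mul1n; case: (_ \in _) => /=; lia.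
Qed.

Lemma Wdim_noE m r (S : asp (1 + m)) : bounded r S -> bl 1 0 0 \notin S.2 ->
  Wdim S = \dim (Usp S).
Proof.
by move=> bS /negbTE E; have := Wdim_split bS; rewrite E addn0 => /anti_leq ->.
Qed.

Definition e0 m : 'rV[K]_(1 + m) := row_mx 1%:M 0.

Lemma e0_ql m (v : 'rV_m) (B : 'M_m) al z : z *m bl al (v *m B) B = e0 m -> B^T = B ->
  lsubmx z 0 0 * (al - ql v B v) = 1 /\ ql z (bl al (v *m B) B) z = lsubmx z 0 0.
Proof.
move=> E sB; split; last first.
  rewrite (ql_mul _ E) /e0 -{1}[z]hsubmxK tr_row_mx mul_row_col mul1mx mul0mx addr0.
  by rewrite mxE.
move: E; rewrite -{1}[z]hsubmxK mul_row_block => /eq_row_mx [E1 E2].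
rewrite trmx_mul sB mulmxA in E1.
have E3 : rsubmx z *m B = - (lsubmx z *m (v *m B)) by apply/eqP; rewrite -addr_eq0 addrC E2.
move: E1; rewrite E3 mulNmx -mulmxA qlE -mulmxBr -raddfB /= [lsubmx z]mx11_scalar -scalar_mxM.
by move/matrixP/(_ 0 0); rewrite !mxE eqxx !mulr1n.
Qed.

(** A hyperbolic direction bl 0 (e0 p) 0 adds an arbitrary multiple of a rank two form
    in the first two coordinates, which survives whatever the rest of the matrix is:
    deleting both coordinates lowers the bound on the rank by two. *)
Lemma rank_drop2 p r (S : asp (1 + (1 + p))) B : bounded r S -> bl 0 (e0 p) 0 \in S.2 ->
  ain (compr (Dr p) (compr (Dr (1 + p)) S)) B -> (\rank B + 2 <= r)%N.
Proof.
move=> bS eS BS; have bT : bounded r (compr (Dr (1 + p)) S) by apply: bounded_comp.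
have [al [be AS]] := ain_blP bT BS; have [d [c MS]] := ain_blP bS AS.
rewrite leqNgt; apply/negP => lt.
have [sA rA] := bT _ AS; have sB := bl_sym sA.
have rAB := rank_bl_dr al be B.
have [/submxP [v Ev]|out] := boolP (be <= B)%MS; last first.
  have := rank_bl_out al sB out; lia.
have lA : (r <= \rank (bl al be B) + 1)%N by lia.
have /submxP [z Ez] := border_dir_in bS eS AS lA.
have /submxP [w Ew] := border_in bS MS lA.
subst be; have [z1 zz] := e0_ql (esym Ez) sB.
have z0 : lsubmx z 0 0 != 0 by apply/eqP => z0; move: z1 => /eqP; rewrite z0 mul0r eq_sym oner_eq0.
have al1 : al != ql v B v by apply/eqP => al1; move: z1 => /eqP; rewrite al1 subrr mulr0 eq_sym oner_eq0.
have rA' : (r <= \rank (bl al (v *m B) B))%N by rewrite rank_bl // al1; lia.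
have key t : t *+ 2 * ql z (bl al (v *m B) B) w + t * t * lsubmx z 0 0 = 0.
  have tS : bl 0 (t *: e0 p) 0 \in S.2.
    by rewrite (_ : bl _ _ _ = t *: bl 0 (e0 p) 0) ?memvZ // blZ mulr0 scaler0.
  have := ainD MS tS; rewrite blD !addr0 Ew Ez scalemxAl -mulmxDl => H.
  have E := border_corner bS H rA'; rewrite Ew in MS.
  rewrite (border_corner bS MS rA') in E.
  move: E; rewrite qlDl !qlDr !qlZl !qlZr zz (qlC w z sA) => /eqP.
  rewrite -subr_eq0 => /eqP E; rewrite -[RHS]oppr0 -E; ring.
have k1 := key 1; have k2 := key (-1).
move: (ql z _ w) (lsubmx z 0 0) z0 k1 k2 => q x x0 k1 k2.
have : x *+ 2 = 0 by transitivity (1 *+ 2 * q + 1 * 1 * x + ((-1) *+ 2 * q + (-1) * (-1) * x)); [ring | rewrite k1 k2 addr0].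
move/eqP; rewrite -mulr_natr mulf_eq0 (negPf x0) /= => /eqP two0.
by move: k1; rewrite two0 mul0r add0r !mul1r => /eqP; rewrite (negPf x0).
Qed.

(** In characteristic two a direction bl a (e0 p) 0 with nonzero corner a is incompatible
    with a full rank matrix that loses two units of rank with its first coordinate. *)
Lemma char2_corner p r (S : asp (1 + (1 + p))) al be B d c a :
  2%:R = 0 :> K -> bounded r S -> bl a (e0 p) 0 \in S.2 ->
  ain S (bl d c (bl al be B)) -> \rank (bl al be B) = r -> (\rank B + 2 <= r)%N -> a = 0.
Proof.
move=> two0 bS eS MS rA rB; have AS := bl_ain MS.
have [sA _] := bounded_comp bS AS; have sB := bl_sym sA.
have lA : (r <= \rank (bl al be B) + 1)%N by rewrite rA leq_addr.
have /submxP [z Ez] := border_dir_in bS eS AS lA.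
have /submxP [w Ew] := border_in bS MS lA.
have rA' : (r <= \rank (bl al be B))%N by rewrite rA.
have MS' := ainD MS eS; rewrite blD addr0 Ez Ew -mulmxDl in MS'.
have E := border_corner bS MS' rA'.
rewrite Ew in MS; rewrite (border_corner bS MS rA') in E.
have zz : ql z (bl al be B) z = lsubmx z 0 0.
  rewrite (ql_mul _ (esym Ez)) /e0 -{1}[z]hsubmxK tr_row_mx mul_row_col mul1mx mul0mx addr0.
  by rewrite mxE.
have zz0 : lsubmx z 0 0 = 0.
  apply/eqP; apply: contraTT rB => z0; rewrite -ltnNge.
  suff /submxP [v Ev] : (be <= B)%MS.
    have := rA; rewrite Ev rank_bl //; case: (_ != _); lia.
  move: Ez; rewrite -{1}[z]hsubmxK mul_row_block => /eq_row_mx [_ /esym /eqP].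
  rewrite addr_eq0 [lsubmx z]mx11_scalar mul_scalar_mx => /eqP E1.
  have -> : be = (- (lsubmx z 0 0)^-1 *: rsubmx z) *m B.
    by rewrite -scalemxAl scaleNr -scalerN -E1 scalerA mulVf // scale1r.
  exact: submxMl.
move: E; rewrite qlDl !qlDr zz zz0 addr0 (qlC z w sA) -[RHS]addrA => /addrI ->.
by rewrite -mulr2n -mulr_natr two0 mulr0.
Qed.

(** Hyperplane principle. The matrices of S with phi M equal to phi M0, different
    from c, form an affine space of codimension at most one in which cg Q takes only
    values of rank at most rho; this is impossible if S is large. Hence affine identities
    that hold at matrices of large rank hold everywhere, over all fields at once. *)
Lemma affine_const_cg n k (Q : 'M[K]_(k, n)) rho D (S : asp n)
    (phi : {linear 'M[K]_n -> K^o}) (c : K) :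
  (forall S' : asp k, bounded rho S' -> (\dim S'.2 <= D)%N) ->
  (forall M, ain S M -> M^T = M) ->
  (forall v, v \in S.2 -> phi v = 0 -> cg Q v = 0 -> v = 0) ->
  (forall M, ain S M -> (rho < \rank (cg Q M))%N -> phi M = c) ->
  (D.+1 < \dim S.2)%N -> forall M, ain S M -> phi M = c.
Proof.
move=> HD sS inj Hphi lt M0 M0S; apply/eqP; apply: contraTT lt => ne; rewrite -leqNgt.
pose S' : asp n := (M0, S.2 :&: lker (linfun phi))%VS.
have := HD (compr Q S'); rewrite dim_comp_inj; last first.
  by move=> v; rewrite memv_cap memv_ker lfunE /= => /andP [vS /eqP v0]; apply: inj.
rewrite -(limg_ker_dim (linfun phi) S.2) => H.
have S'S M : ain S' M -> ain S M /\ phi M = phi M0.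
  rewrite {1}/ain /= memv_cap memv_ker lfunE /= linearB subr_eq0 => /andP [MS /eqP ->].
  by split=> //; rewrite -[M](subrK M0) addrC ainD.
rewrite -addn1 leq_add //.
  apply: H => B /ain_comp [M /S'S [MS E] ->]; split; first by rewrite cgT sS.
  by rewrite leqNgt; apply/negP => /(Hphi _ MS); rewrite E; apply/eqP.
by apply: leq_trans (dimvS (subvf _)) _; rewrite dimvf.
Qed.

Lemma affine_const n rho D (S : asp n) (phi : {linear 'M[K]_n -> K^o}) (c : K) :
  (forall S' : asp n, bounded rho S' -> (\dim S'.2 <= D)%N) ->
  (forall M, ain S M -> M^T = M) ->
  (forall M, ain S M -> (rho < \rank M)%N -> phi M = c) ->
  (D.+1 < \dim S.2)%N -> forall M, ain S M -> phi M = c.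
Proof.
move=> HD sS Hphi; apply: (@affine_const_cg _ _ 1%:M rho D) => // [v _ _|M MS].
  by rewrite cg1.
by rewrite cg1; apply: Hphi.
Qed.

End Mod.

(** * Dimension counts and changes of coordinates *)

Section Coordinates.
Variable K : fieldType.
Local Notation asp := (asp K).
Local Notation Dr := (Dr K).

Lemma bounded_sym n r (S : asp n) M : bounded r S -> ain S M -> M^T = M.
Proof. by move=> bS /bS []. Qed.

Lemma bounded_full n r (S : asp n) : bounded r S -> bounded n S.
Proof. by move=> bS M MS; split; [exact: (bounded_sym bS) | exact: rank_leq_row]. Qed.

Lemma dim_sym n (S : asp n) : bounded n S -> (\dim S.2 <= s1 n n)%N.
Proof.
elim: n S => [|m IH] S bS.
  by apply: leq_trans (dimvS (subvf _)) _; rewrite dimvf.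
apply: leq_trans (eq_leq (@dim_asp K m S)) _; rewrite (s1S m.+1 m m) addnC leq_add //.
  by apply: IH; apply: bounded_full (bounded_comp bS).
exact: Wdim_le bS.
Qed.

(** A space that reaches the maximal dimension allowed by a linear condition P
    contains every vector satisfying P, as otherwise it could be enlarged. *)
Lemma vspace_add_full n (V : {vspace 'M[K]_n}) (P : 'M[K]_n -> Prop) D :
  (forall v, v \in V -> P v) ->
  (forall W : {vspace 'M[K]_n}, (forall w, w \in W -> P w) -> (\dim W <= D)%N) ->
  (forall v w k, P v -> P w -> P (v + k *: w)) ->
  \dim V = D -> forall C, P C -> C \in V.
Proof.
move=> PV PW PL dV C PC.
have PVC v : v \in (V + <[C]>)%VS -> P v.
  by case/memv_addP => a aV [b /vlineP [k ->] ->]; apply: PL => //; apply: PV.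
have := PW _ PVC; rewrite -dV => le.
have sub : (V <= V + <[C]>)%VS := addvSl _ _.
have /eqP E : V == (V + <[C]>)%VS by rewrite eqEdim sub.
by rewrite E; apply: subvP (addvSr _ _) _ (memv_line _).
Qed.

Lemma sym_full n (V : {vspace 'M[K]_n}) : (forall v, v \in V -> v^T = v) ->
  \dim V = s1 n n -> forall C, C^T = C -> C \in V.
Proof.
move=> sV; apply: vspace_add_full => [//|W sW|v w k /= Ev Ew]; last by rewrite linearD linearZ /= Ev Ew.
apply: (@dim_sym n (0, W)) => M; rewrite /ain /= subr0 => /sW; split=> //.
exact: rank_leq_row.
Qed.

Lemma sym_rows n k (X : 'M[K]_(k, n)) R (C : 'M[K]_n) : X *m R = 1%:M -> C^T = C ->
  (C <= X)%MS -> cg X^T (cg R^T C) = C.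
Proof.
move=> XR sC /submxP [Y E].
have E1 : C *m (R *m X) = C by rewrite {1}E -!mulmxA [X *m _]mulmxA XR mul1mx.
rewrite cg_cg /cg -mulmxA trmx_mul !trmxK E1 -trmx_mul -{1}sC -trmx_mul E1.
exact: sC.
Qed.

Lemma sym_rows_dim n k (X : 'M[K]_(k, n)) (V : {vspace 'M[K]_n}) :
  row_free X -> (forall v, v \in V -> v^T = v /\ (v <= X)%MS) ->
  (\dim V <= s1 n k)%N /\ (\dim V = s1 n k -> forall C, C^T = C -> (C <= X)%MS -> C \in V).
Proof.
case/row_freeP => R XR sV.
have H (W : {vspace 'M[K]_n}) : (forall v, v \in W -> v^T = v /\ (v <= X)%MS) -> (\dim W <= s1 n k)%N.
  move=> sW; rewrite -(@dim_comp_inj _ _ _ R^T (0, W)); last first.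
    by move=> v /sW [Ev vX] E; rewrite -(sym_rows XR Ev vX) E linear0.
  apply: (@dim_sym k) => M; rewrite {1}/ain /= linear0 subr0 => /(@dir_comp _ _ _ _ (0, W)) [v /sW [Ev _] ->].
  by rewrite cgT Ev; split=> //; apply: rank_leq_row.
split; first exact: H.
move=> dV C sC CX; apply: (@vspace_add_full _ _ (fun v => v^T = v /\ (v <= X)%MS)) dV _ _ => //.
move=> v w l [Ev vX] [Ew wX]; rewrite linearD linearZ /= Ev Ew; split=> //.
by rewrite addmx_sub ?scalemx_sub.
Qed.

(** In characteristic two these are the alternating matrices. Symmetry is required
    rather than skew-symmetry, so that the notion also makes sense elsewhere. *)
Definition alt n (M : 'M[K]_n) := M^T = M /\ forall i, M i i = 0.

Lemma dim_alt n (V : {vspace 'M[K]_n}) : (forall v, v \in V -> alt v) ->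
  (\dim V <= s1 n n.-1)%N.
Proof.
elim: n V => [|m IH] V aV.
  by apply: leq_trans (dimvS (subvf _)) _; rewrite dimvf.
pose S : asp (1 + m) := (0, V).
have bS : bounded m.+1 S.
  by move=> M; rewrite /ain /= subr0 => /aV [E _]; split=> //; apply: rank_leq_row.
have nE : bl 1 0 0 \notin S.2.
  apply/negP => /aV [_ H].
  have : (block_mx 1%:M 0 0^T 0 : 'M[K]_(1 + m)) (lshift m 0) (lshift m 0) = 0 := H _.
  by rewrite block_mxEul mxE eqxx => /eqP; rewrite oner_eq0.
apply: leq_trans (eq_leq (dim_asp S)) _; rewrite (Wdim_noE bS nE) addnC.
have -> : s1 m.+1 m.+1.-1 = (s1 m m.-1 + m)%N by case: (m) => // k; rewrite (s1S _ k.+1 k).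
apply: leq_add; last first.
  by apply: leq_trans (dimvS (subvf (Usp S))) _; rewrite dimvf /dim /= mul1n.
apply: IH => v /dir_comp [w /aV [E D] ->]; rewrite cg_Dr; split.
  by rewrite trmx_drsub E.
by move=> i; rewrite !mxE D.
Qed.

Lemma alt_full n (V : {vspace 'M[K]_n}) : (forall v, v \in V -> alt v) ->
  \dim V = s1 n n.-1 -> forall C, alt C -> C \in V.
Proof.
move=> aV; apply: vspace_add_full => [//|W|v w k [Ev Dv] [Ew Dw]]; first exact: dim_alt.
by split=> [|i]; rewrite ?linearD ?linearZ /= ?Ev ?Ew // !mxE Dv Dw mulr0 addr0.
Qed.

Lemma row_to_e0 p (u : 'rV[K]_(1 + p)) : u != 0 ->
  exists2 R : 'M[K]_(1 + p), R \in unitmx & u *m R = e0 K p.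
Proof.
move=> u0; have ru : \rank u = 1%N by rewrite rank_rV u0.
have := mulmx_ebase u; rewrite ru => E.
pose c := col_ebase u 0 0.
have Ec : col_ebase u = c%:M := mx11_scalar _.
have c0 : c != 0.
  by have := col_ebase_unit u; rewrite unitmxE Ec det_scalar1 unitfE.
exists (c^-1 *: invmx (row_ebase u)).
  by rewrite unitmxZ ?unitfE ?invr_eq0 // unitmx_inv row_ebase_unit.
rewrite -scalemxAr -{1}E mulmxK ?row_ebase_unit // Ec mul_scalar_mx scalerA mulVf // scale1r.
apply/rowP => j; rewrite /e0 [LHS]mxE [RHS]mxE; case: splitP => k Ek; rewrite mxE Ek //.
by rewrite (ord1 k).
Qed.

(** Changes of coordinates that fix the first one. *)
Definition emb m (P : 'M[K]_m) : 'M[K]_(1 + m) := block_mx 1%:M 0 0 P.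

Lemma emb_bl m (P : 'M[K]_m) a u A : cg (emb P) (bl a u A) = bl a (u *m P^T) (cg P A).
Proof.
rewrite /cg /emb /bl tr_block_mx !mulmx_block !trmx0 trmx1 !mul0mx !mulmx0 !mul1mx !mulmx1.
by rewrite !addr0 !add0r trmx_mul trmxK.
Qed.

Lemma emb_mul m (P Q : 'M[K]_m) : emb P *m emb Q = emb (P *m Q).
Proof. by rewrite /emb mulmx_block !mulmx0 !mul0mx !mulmx1 !addr0 !add0r. Qed.

Lemma emb1 m : emb (1%:M : 'M[K]_m) = 1%:M.
Proof. by rewrite /emb -scalar_mx_block. Qed.

Lemma emb_unit m (P : 'M[K]_m) : P \in unitmx -> emb P \in unitmx.
Proof.
move=> uP; have := emb_mul P (invmx P); rewrite mulmxV // emb1.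
by case/mulmx1_unit.
Qed.

Lemma Dr_emb m (P : 'M[K]_m) : Dr m *m emb P = P *m Dr m.
Proof.
rewrite /Dr /emb mul_row_block mul_mx_row !mul0mx !mulmx0 !mul1mx !mulmx1.
by rewrite !add0r.
Qed.

Lemma dim_unit n (P : 'M[K]_n) (S : asp n) : P \in unitmx -> \dim (compr P S).2 = \dim S.2.
Proof. by move=> uP; apply: (@dim_comp_unit _ _ _ (invmx P)); rewrite mulVmx. Qed.

Lemma rank_unit n (P : 'M[K]_n) M : P \in unitmx -> \rank (cg P M) = \rank M.
Proof. by move=> uP; apply: (@cg_rank_eq _ _ _ (invmx P)); rewrite mulVmx. Qed.

Lemma Wdim_emb m (P : 'M[K]_m) (S : asp (1 + m)) : P \in unitmx ->
  Wdim (compr (emb P) S) = Wdim S.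
Proof.
move=> uP; have := dim_asp S; have := dim_asp (compr (emb P) S).
by rewrite comp_comp Dr_emb -comp_comp !dim_unit ?emb_unit //; lia.
Qed.

Lemma kernel_coord m (M : 'M[K]_(1 + m)) : M^T = M -> (\rank M <= m)%N ->
  exists2 P : 'M[K]_(1 + m), P \in unitmx & exists A, cg P M = bl 0 0 A.
Proof.
move=> sM rM.
have : ~~ row_free M by rewrite /row_free neq_ltn ltnS rM.
rewrite -kermx_eq0 => /rowV0Pn [u /sub_kermxP uM u0].
have [R uR E] := row_to_e0 u0.
exists (invmx R); first by rewrite unitmx_inv.
have sP : (cg (invmx R) M)^T = cg (invmx R) M by rewrite cgT sM.
have E0 : e0 K m *m cg (invmx R) M = 0.
  by rewrite -E /cg !mulmxA mulmxK // uM !mul0mx.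
exists (cg (Dr m) (cg (invmx R) M)).
have := E0; rewrite {1}(blE sP) /e0 /bl mul_row_block !mul1mx !mul0mx !addr0 -row_mx0.
case/eq_row_mx => /matrixP /(_ 0 0); rewrite !mxE eqxx mulr1n => c0 u0'.
by rewrite {1}(blE sP) u0' !mxE c0.
Qed.

Lemma coord_e0 p (S : asp (1 + (1 + p))) a u : u != 0 -> bl a u 0 \in S.2 ->
  exists2 P : 'M[K]_(1 + p), P \in unitmx & bl a (e0 K p) 0 \in (compr (emb P) S).2.
Proof.
move=> /row_to_e0 [R uR E] H; exists R^T; first by rewrite unitmx_tr.
by have := comp_dir (emb R^T) H; rewrite emb_bl trmxK E linear0.
Qed.

(** Delete first the base coordinate, at the cost Wdim S, then the hyperbolic
    direction, at the cost p.+1; the rest has rank at most r - 2. *)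
Lemma count_hyperbolic p r (S : asp (1 + (1 + p))) u D : bounded r S ->
  u != 0 -> bl 0 u 0 \in S.2 -> (1 < r)%N ->
  (forall S' : asp p, bounded (r - 2) S' -> (\dim S'.2 <= D)%N) ->
  (\dim S.2 <= Wdim S + p.+1 + D)%N.
Proof.
move=> bS u0 uS r1 HD; have [P uP eS] := coord_e0 u0 uS.
rewrite -(Wdim_emb S uP) -(dim_unit S (emb_unit uP)).
set S' := compr _ S in eS *; have bS' : bounded r S' by apply: bounded_comp.
rewrite dim_asp -addnA leq_add2l dim_asp leq_add //.
  by apply: (@Wdim_le _ _ r); apply: bounded_comp.
apply: HD => B HB; split; last by have := rank_drop2 bS' eS HB; lia.
exact: bounded_sym (bounded_comp (bounded_comp bS')) HB.
Qed.

Definition two_elements := forall x : K, x = 0 \/ x = 1.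

Lemma card2_two : two_elements -> 2%:R = 0 :> K.
Proof.
move=> c2; case: (c2 2%:R) => // /eqP.
by rewrite -subr_eq0 (_ : 2%:R - 1 = 1 :> K) ?oner_eq0 //; ring.
Qed.

Lemma card2_neq (x y : K) : two_elements -> x != y -> x = y + 1.
Proof.
move=> c2 ne; case: (c2 (x - y)) => [/eqP|/eqP]; first by rewrite subr_eq0 (negPf ne).
by rewrite subr_eq addrC => /eqP.
Qed.

Lemma rows_sub_ker m k l (B : 'M[K]_(k, m)) (X : 'M[K]_(l, m)) :
  (B <= X)%MS = (B *m cokermx X == 0).
Proof. exact: submxE. Qed.

Definition entry_row m (x : 'rV[K]_m) (y : 'cV[K]_m) (B : 'M[K]_m) : K^o := (x *m B *m y) 0 0.
Lemma entry_row_is_linear m (x : 'rV[K]_m) (y : 'cV[K]_m) : linear (entry_row x y).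
Proof.
by move=> a u v; rewrite /entry_row mulmxDr mulmxDl -scalemxAr -scalemxAl mxE [in LHS]mxE.
Qed.
HB.instance Definition _ m (x : 'rV[K]_m) (y : 'cV[K]_m) :=
  GRing.isLinear.Build K _ _ _ (entry_row x y) (entry_row_is_linear x y).

Lemma entry_rowE m k (B : 'M[K]_m) (C : 'M_(m, k)) i j :
  (B *m C) i j = entry_row (delta_mx 0 i) (col j C) B.
Proof.
rewrite /entry_row -mulmxA -rowE [RHS]mxE [LHS]mxE [RHS]mxE.
by apply: eq_bigr => l _; rewrite mxE.
Qed.

(** The hyperplane principle applied to the linear equations of the row space of X. *)
Lemma affine_rows n k rho D (S : asp n) (X : 'M[K]_(k, n)) :
  (forall S' : asp n, bounded rho S' -> (\dim S'.2 <= D)%N) ->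
  (forall M, ain S M -> M^T = M) ->
  (forall M, ain S M -> (rho < \rank M)%N -> (M <= X)%MS) ->
  (D.+1 < \dim S.2)%N -> forall M, ain S M -> (M <= X)%MS.
Proof.
move=> HD sS HX lt M MS; rewrite rows_sub_ker; apply/eqP/matrixP => i j.
rewrite entry_rowE [RHS]mxE.
apply: (affine_const HD sS _ lt MS) => N NS /(HX _ NS).
rewrite rows_sub_ker => /eqP E /=.
by have := entry_rowE N (cokermx X) i j; rewrite E mxE => <-.
Qed.

Lemma dir_of_ain n (S : asp n) (P : 'M[K]_n -> Prop) :
  (forall M, ain S M -> P M) -> (forall M N, P M -> P N -> P (M - N)) ->
  forall v, v \in S.2 -> P v.
Proof.
move=> HP PB v vS; rewrite -(addKr S.1 v) addrC.
by apply: PB; apply: HP; [rewrite ainD ?ain_base | apply: ain_base].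
Qed.

Lemma ql_eq m (v w : 'rV[K]_m) B : B^T = B -> v *m B = w *m B -> ql v B v = ql w B w.
Proof.
move=> sB E; rewrite (ql_mul v E) -(ql_mul v (erefl (w *m B))) qlC //.
by rewrite (ql_mul w E) -(ql_mul w (erefl (w *m B))).
Qed.

(** The direction bl 1 (e0 K p) 0 would otherwise raise the rank of the matrix. *)
Lemma mixed_corner p r (S : asp (1 + (1 + p))) d c al v B :
  bounded r S -> ain S (bl d c (bl al (v *m B) B)) -> bl 1 (e0 K p) 0 \in S.2 ->
  (r <= \rank B + 1)%N -> al != ql v B v.
Proof.
move=> bS MS eS le; apply/eqP => E.
have AS := bl_ain MS; have [sA _] := bounded_comp bS AS; have sB := bl_sym sA.
have lA : (r <= \rank (bl al (v *m B) B) + 1)%N.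
  by apply: leq_trans le _; rewrite leq_add2r rank_bl_dr.
have /submxP [z Ez] := border_dir_in bS eS AS lA.
have [/eqP + _] := e0_ql (esym Ez) sB.
by rewrite E subrr mulr0 eq_sym oner_eq0.
Qed.

(** In characteristic two there is an invertible symmetric matrix with a zero on its
    diagonal that equals its own inverse: the swap of two basis vectors. *)
Lemma invol_corner k (i0 i1 : 'I_k) : i0 != i1 -> 2%:R = 0 :> K ->
  exists C : 'M[K]_k, [/\ C^T = C, C *m C = 1%:M & C i0 i0 = 0].
Proof.
move=> ne two; pose f : 'rV[K]_k := delta_mx 0 i0 + delta_mx 0 i1.
have ff : f *m f^T = 0.
  rewrite /f linearD /= mulmxDl !mulmxDr !trmx_delta !mul_delta_mx_cond !eqxx.
  rewrite (negPf ne) eq_sym (negPf ne) !mulr0n !mulr1n addr0 add0r.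
  by rewrite -mulr2n -scaler_nat two scale0r.
exists (1%:M + f^T *m f); split.
- by rewrite linearD /= trmx_mul trmxK trmx1.
- have FF : f^T *m f *m (f^T *m f) = 0 by rewrite -mulmxA [f *m _]mulmxA ff mul0mx mulmx0.
  rewrite mulmxDl mul1mx mulmxDr mulmx1 FF addr0.
  by rewrite -addrA -mulr2n -scaler_nat two scale0r addr0.
rewrite !mxE big_ord1 !mxE !eqxx /= (negPf ne) addr0 mulr1.
by rewrite -[1 + 1]/(2%:R) two.
Qed.

(** The exceptional configuration over the field with two elements: the only border
    direction is anisotropic. The rows of the matrices with both coordinates deleted are
    confined to a small space unless one of the listed inequalities holds. *)
Lemma char2_count p r n (S : asp (1 + (1 + p))) D1 D2 : two_elements ->
  bounded r S -> (1 < r)%N -> bl 1 (e0 K p) 0 \in S.2 -> Wdim S = 1%N ->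
  (exists2 A, ain (compr (Dr (1 + p)) S) A & \rank A = r) ->
  (forall S' : asp p, bounded (r - 1) S' -> (\dim S'.2 <= D1)%N) ->
  (forall S' : asp p, bounded (r - 2) S' -> (\dim S'.2 <= D2)%N) ->
  [\/ (\dim S.2 <= r + 1 + D2)%N, (\dim S.2 < r + D1)%N,
      (\dim S.2 < s1 n r)%N | r = 2%N /\ (\dim S.2 <= s1 n r)%N].
Proof.
move=> c2 bS r1 eS wS [A0 A0S rA0] HD1 HD2.
have two := card2_two c2.
pose T := compr (Dr (1 + p)) S; pose T2 := compr (Dr p) T.
have bT : bounded r T by apply: bounded_comp.
have liftT B : ain T2 B -> exists al be d c, [/\ ain T (bl al be B), ain S (bl d c (bl al be B)) & B^T = B].
  move=> BS; have [al [be AS]] := ain_blP bT BS; have [d [c MS]] := ain_blP bS AS.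
  by exists al, be, d, c; split=> //; exact: bl_sym (bT _ AS).1.
have below al be B : ain T (bl al be B) -> (r <= \rank B + 1)%N ->
    exists v, [/\ be = v *m B, al != ql v B v & (\rank B + 1 <= r)%N].
  move=> AS le; have [sA rA] := bT _ AS; have sB := bl_sym sA.
  have [/submxP [v Ev]|out] := boolP (be <= B)%MS; last by have := rank_bl_out al sB out; lia.
  subst be; have [d [c MS]] := ain_blP bS AS; have ne := mixed_corner bS MS eS le.
  by exists v; split=> //; move: rA; rewrite rank_bl // ne /=; lia.
have bT2 : bounded (r - 1) T2.
  move=> B /liftT [al [be [d [c [AS MS sB]]]]]; split=> //.
  rewrite leqNgt; apply/negP => lt; have le : (r <= \rank B + 1)%N by lia.
  by have [v [_ _]] := below _ _ _ AS le; lia.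
have [B0 B0S rB0] : exists2 B, ain T2 B & \rank B = r.-1.
  have [d [c MS]] := ain_blP bS A0S; have sA := (bT _ A0S).1.
  have EA := blE (sA : A0^T = A0 :> 'M_(1 + p)).
  have BS : ain T2 (cg (Dr p) A0) by apply: comp_ain.
  exists (cg (Dr p) A0) => //.
  have := (bT2 _ BS).2; case: (leqP (\rank (cg (Dr p) A0) + 2) r) => [le|]; last lia.
  rewrite EA in MS rA0; have := char2_corner two bS eS MS rA0 le.
  by move/eqP; rewrite oner_eq0.
have nE : bl 1 0 0 \notin T.2.
  apply/negP => ES; have [al [be [d [c [AS MS sB]]]]] := liftT _ B0S.
  have le : (r <= \rank B0 + 1)%N by lia.
  have [v [Ev _ _]] := below _ _ _ AS le; subst be.
  have tS : bl (ql v B0 v - al) 0 0 \in T.2.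
    by rewrite (_ : bl _ _ _ = (ql v B0 v - al) *: bl 1 0 0) ?memvZ // blZ mulr1 !scaler0.
  have := ainD AS tS; rewrite blD addrC subrK !addr0 => AS'.
  have [d' [c' MS']] := ain_blP bS AS'.
  by have := mixed_corner bS MS' eS le; rewrite eqxx.
have dimS : \dim S.2 = (1 + (\dim (Usp T) + \dim T2.2))%N.
  by rewrite dim_asp wS dim_asp (Wdim_noE bT nE).
have UB B u : ain T2 B -> \rank B = r.-1 -> u \in Usp T -> (u <= B)%MS.
  move=> BS rB /(UspP _ bT) [a uS]; apply: border_dir_in bT uS BS _; lia.
have dT2 := HD1 _ bT2.
have dU : (\dim (Usp T) <= r.-1)%N.
  by rewrite -rB0; apply: dim_rows_le => u; apply: UB.
have [lt|eU] : (\dim (Usp T) < r.-1)%N \/ \dim (Usp T) = r.-1.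
  by move: dU; rewrite leq_eqVlt => /orP [/eqP|]; [right|left].
  by constructor 2; lia.
have [X fX UX] := vspace_rows (Usp T).
have [small|big] := leqP (\dim T2.2) D2.+1; first by constructor 1; lia.
have rowsX B : ain T2 B -> (B <= X)%MS.
  apply: (affine_rows HD2) big _ => [N /bT2 [] //|N NS rN].
  have {}rN : \rank N = r.-1 by have := (bT2 _ NS).2; lia.
  have XN : (X <= N)%MS by apply/row_subP => i; apply: UB; rewrite ?UX ?row_sub.
  by have [_ <-] := mxrank_leqif_sup XN; rewrite (eqnP fX) rN eU.
have dirX w : w \in T2.2 -> w^T = w /\ (w <= X)%MS.
  apply: (@dir_of_ain _ T2 (fun w => w^T = w /\ (w <= X)%MS)) => [M MS|M N [E1 H1] [E2 H2]].
    by split; [apply: bounded_sym bT2 MS | apply: rowsX].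
  by rewrite linearB /= E1 E2 addmx_sub // eqmx_opp.
have [leX fullX] := sym_rows_dim fX dirX.
have Es : s1 n r = (r + s1 p (\dim (Usp T)))%N by rewrite eU -{1}(prednK (ltnW r1)) (s1S n p) prednK ?(ltnW r1) // addnC.
have {leX} := leX; rewrite leq_eqVlt => /orP [/eqP dX|lt]; last by constructor 3; lia.
have [r2|r2] := eqVneq r 2%N; first by constructor 4; split=> //; lia.
exfalso.
have {fullX} full := fullX dX.
have base0 : ain T2 0.
  rewrite /ain sub0r rpredN; apply: full; first by case: (bT2 _ (ain_base T2)).
  by apply: rowsX; apply: ain_base.
have inT2 C : C^T = C -> (C <= X)%MS -> ain T2 C.
  by move=> sC CX; rewrite -[C]add0r; apply: ainD base0 _; apply: full.
have [R XR] := row_freeP fX.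
have RX : R^T *m X^T = 1%:M by rewrite -trmx_mul XR trmx1.
have d1 : (1 < \dim (Usp T))%N by lia.
pose i0 : 'I_(\dim (Usp T)) := Ordinal (ltnW d1); pose i1 : 'I_(\dim (Usp T)) := Ordinal d1.
have [a aS] : exists a, bl a (row i0 X) 0 \in T.2 by apply/(UspP _ bT); rewrite UX row_sub.
have key C : C^T = C -> C *m C = 1%:M -> a = C i0 i0.
  move=> sC CC; pose B := X^T *m C *m X; pose v : 'rV[K]_p := delta_mx 0 i0 *m C *m R^T.
  have rB : \rank B = \dim (Usp T).
    have uC : C \in unitmx by case/mulmx1_unit: CC.
    rewrite /B mxrankMfree // -mxrank_tr trmx_mul trmxK mxrankMfree // mxrank_unit //.
    by rewrite unitmx_tr.
  have vB : v *m B = row i0 X.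
    by rewrite /v /B !mulmxA -[_ *m R^T *m X^T]mulmxA RX mulmx1 -[_ *m C *m C]mulmxA CC mulmx1 -rowE.
  have BS : ain T2 B.
    by apply: inT2; rewrite ?submxMl // /B !trmx_mul trmxK sC mulmxA.
  have le : (r <= \rank B + 1)%N by rewrite rB eU; lia.
  have [al [be [_ [_ [AS _ sB]]]]] := liftT _ BS.
  have [w [Ew ne1 _]] := below _ _ _ AS le; subst be.
  have AS' := ainD AS aS; rewrite blD addr0 -vB -mulmxDl in AS'.
  have [w' [Ew' ne2 _]] := below _ _ _ AS' le.
  have := card2_neq c2 ne2; rewrite (card2_neq c2 ne1) -(ql_eq sB Ew') qlDl !qlDr (qlC w v sB).
  have -> : ql v B v = C i0 i0.
    rewrite (ql_mul v vB) /v !trmx_mul trmxK sC trmx_delta rowE -!mulmxA [X *m (R *m _)]mulmxA.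
    by rewrite XR mul1mx -colE -rowE !mxE.
  move=> E; apply: (addrI (ql w B w + 1)); rewrite E.
  transitivity (ql w B w + 1 + C i0 i0 + ql v B w * 2%:R); first by ring.
  by rewrite two mulr0 addr0.
have [C [sC CC C0]] := @invol_corner _ i0 i1 isT two.
have := key 1%:M (trmx1 _ _) (mul1mx _).
by rewrite (key C sC CC) C0 mxE eqxx => /esym /eqP; rewrite oner_eq0.
Qed.

End Coordinates.

(** * Affine spaces of matrices of rank at most one *)

Section RankOne.
Variable K : fieldType.
Local Notation asp := (asp K).
Local Notation two_elements := (two_elements K).

Lemma rank_cg_free m n (X : 'M[K]_(m, n)) D : row_free X -> \rank (cg X^T D) = \rank D.
Proof.
move=> fX; rewrite /cg trmxK mxrankMfree // -mxrank_tr trmx_mul trmxK mxrankMfree //.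
exact: mxrank_tr.
Qed.

Lemma sym_rank1 n (M : 'M[K]_n) : M^T = M -> (\rank M <= 1)%N ->
  exists z : 'rV_n, exists t, M = t *: (z^T *m z).
Proof.
move=> sM rM; have [->|M0] := eqVneq M 0; first by exists 0, 0; rewrite scale0r.
have /rowV0Pn [z zM z0] := M0.
have /submxP [y Ey] : (M <= z)%MS.
  have [_ <-] := mxrank_leqif_sup zM; have := mxrankS zM.
  by rewrite rank_rV z0 eqn_leq rM => ->.
have /row_freeP [v zv] : row_free z by rewrite /row_free rank_rV z0.
have Ey' : z^T *m y^T = y *m z by rewrite -trmx_mul -Ey sM.
have : y = z^T *m (y^T *m v) by rewrite mulmxA Ey' -mulmxA zv mulmx1.
rewrite [y^T *m v]mx11_scalar mul_mx_scalar => E.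
by exists z, ((y^T *m v) 0 0); rewrite Ey {1}E -scalemxAl.
Qed.

Lemma cg_diag k n (w : 'rV[K]_n) (X : 'M_(k, n)) t D :
  t *: (w^T *m w) + cg X^T D = cg (col_mx w X)^T (block_mx t%:M 0 0 D).
Proof.
rewrite /cg !trmxK tr_col_mx mul_row_block !mulmx0 addr0 add0r mul_row_col.
by rewrite !mul_mx_scalar -!scalemxAl.
Qed.

Lemma cg_diag2 n (z u : 'rV[K]_n) a b :
  a *: (z^T *m z) + b *: (u^T *m u) = cg (col_mx z u)^T (block_mx a%:M 0 0 b%:M).
Proof. by rewrite -cg_diag /cg trmxK mul_mx_scalar -!scalemxAl. Qed.

Lemma row_free_col1 k n (w : 'rV[K]_n) (X : 'M_(k, n)) : row_free X -> ~~ (w <= X)%MS ->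
  row_free (col_mx w X).
Proof.
move=> fX wX; rewrite /row_free -addsmxE.
have XX : (X <= w + X)%MS := addsmxSr _ _.
have := mxrankS XX; rewrite (eqnP fX) leq_eqVlt => /orP [/eqP E|lt]; last first.
  rewrite eqn_leq lt andbT addsmxE; exact: rank_leq_row.
case/negP: wX; have [_ H] := mxrank_leqif_sup XX.
by apply: submx_trans (addsmxSl _ X) _; rewrite -H -E (eqnP fX).
Qed.

(** A line through two independent rank one forms contains no third one, hence the
    exception over two elements. *)
Lemma rank1_asp n (S : asp n) : bounded 1 S -> (0 < \dim S.2)%N ->
  \dim S.2 = 1%N /\
  ((exists2 z : 'rV_n, z != 0 & forall M, ain S M <-> exists t, M = t *: (z^T *m z)) \/
   (two_elements /\ exists z1 z2 : 'rV_n, row_free (col_mx z1 z2) /\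
       forall M, ain S M <-> M = z1^T *m z1 \/ M = z2^T *m z2)).
Proof.
move=> bS dS.
have [M1 M1S M1n] : exists2 M, ain S M & M != 0.
  have [S0|] := eqVneq S.1 0; last by exists S.1; rewrite ?ain_base.
  exists (vpick S.2); first by rewrite /ain S0 subr0 memv_pick.
  by rewrite vpick0 -dimv_eq0 -lt0n.
have [z [t1 E1]] := sym_rank1 (bS _ M1S).1 (bS _ M1S).2.
have t10 : t1 != 0 by apply: contra M1n => /eqP E; rewrite E1 E scale0r.
have z0 : z != 0 by apply: contra M1n => /eqP E; rewrite E1 E trmx0 mul0mx scaler0.
have [all|] := pselect (forall M, ain S M -> (M <= z)%MS).
  have S_line M : ain S M -> exists t, M = t *: (z^T *m z).
    move=> MS; have [u [t E]] := sym_rank1 (bS _ MS).1 (bS _ MS).2.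
    have [M0|M0] := eqVneq M 0; first by exists 0; rewrite scale0r.
    have t0 : t != 0 by apply: contra M0 => /eqP t0; rewrite E t0 scale0r.
    have u0 : u != 0 by apply: contra M0 => /eqP u0; rewrite E u0 mulmx0 scaler0.
    have /row_freeP [v uv] : row_free u by rewrite /row_free rank_rV u0.
    have : (u <= z)%MS.
      have -> : u = t^-1 *: (v^T *m M).
        by rewrite E -scalemxAr mulmxA -trmx_mul uv trmx1 mul1mx scalerA mulVf // scale1r.
      by rewrite scalemx_sub // (submx_trans (submxMl _ _)) // all.
    case/sub_rVP => k Ek; exists (t * (k * k)).
    by rewrite E Ek [(k *: z)^T]linearZ /= -scalemxAl -scalemxAr !scalerA mulrA.
  have dirL v : v \in S.2 -> exists t, v = t *: (z^T *m z).
    apply: (@dir_of_ain _ _ S (fun v => exists t, v = t *: (z^T *m z))) => //.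
    by move=> M N [a ->] [b ->]; exists (a - b); rewrite scalerBl.
  have sub : (S.2 <= <[z^T *m z]>)%VS.
    by apply/subvP => v /dirL [t ->]; rewrite memvZ ?memv_line.
  have d1 : \dim S.2 = 1%N.
    apply/eqP; rewrite eqn_leq dS andbT; apply: leq_trans (dimvS sub) _.
    by rewrite dim_vline; case: (_ != 0).
  have zzS k : k *: (z^T *m z) \in S.2.
    have /eqP -> : S.2 == <[z^T *m z]>%VS.
      by rewrite eqEdim sub d1 dim_vline; case: (_ != 0).
    by rewrite memvZ ?memv_line.
  split=> //; left; exists z => // M; split; first exact: S_line.
  case=> t ->; have [b Eb] := S_line _ (ain_base S).
  by rewrite /ain Eb -scalerBl.
case/existsNP => M2 /not_implyP [M2S /negP M2z].
have [u [t2 E2]] := sym_rank1 (bS _ M2S).1 (bS _ M2S).2.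
have uz : ~~ (u <= z)%MS.
  by apply: contra M2z => uz; rewrite E2 scalemx_sub // (submx_trans (submxMl _ _)).
have t20 : t2 != 0 by apply: contra M2z => /eqP E; rewrite E2 E scale0r sub0mx.
have fX : row_free (col_mx u z) by apply: row_free_col1 uz; rewrite /row_free rank_rV z0.
have c2 : two_elements.
  move=> k; have kS : k *: (M2 - M1) \in S.2 by rewrite memvZ // (ainB M2S M1S).
  have := (bS _ (ainD M1S kS)).2.
  have -> : M1 + k *: (M2 - M1) = (k * t2) *: (u^T *m u) + ((1 - k) * t1) *: (z^T *m z).
    by rewrite E1 E2 scalerBr !scalerA mulrBl mul1r scalerBl addrCA.
  rewrite cg_diag2 rank_cg_free // rank_diag_block_mx !rank_rV !mx11_eq0 !mulf_eq0.
  rewrite (negPf t10) (negPf t20) !orbF subr_eq0 [1 == k]eq_sym.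
  by have [->|_] := eqVneq k 0; [left | have [->|] := eqVneq k 1; [right|]].
have two := card2_two c2.
have t1E : t1 = 1 by case: (c2 t1) t10 => ->; rewrite ?eqxx.
have t2E : t2 = 1 by case: (c2 t2) t20 => ->; rewrite ?eqxx.
rewrite t1E scale1r in E1; rewrite t2E scale1r in E2.
have only M : ain S M -> M = M1 \/ M = M2.
  move=> MS; have [w [t E]] := sym_rank1 (bS _ MS).1 (bS _ MS).2.
  have NS : ain S (M + (M2 - M1)) by rewrite ainD // (ainB M2S M1S).
  have := (bS _ NS).2.
  have EN : M + (M2 - M1) = t *: (w^T *m w) + cg (col_mx u z)^T 1%:M.
    rewrite E (_ : M2 - M1 = M2 + M1) ?E1 ?E2; last first.
      by apply/eqP; rewrite -subr_eq0 opprD addrACA subrr add0r -opprD -mulr2n -scaler_nat two scale0r oppr0.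
    by rewrite -[u^T *m u]scale1r -[z^T *m z]scale1r cg_diag2 -scalar_mx_block.
  have [w_in|w_out] := boolP (w <= col_mx u z)%MS; last first.
    have [t0|tn] := eqVneq t 0.
      by rewrite EN t0 scale0r add0r rank_cg_free // mxrank1.
    have fX3 := row_free_col1 fX w_out.
    have -> : M + (M2 - M1) = cg (col_mx w (col_mx u z))^T (block_mx t%:M 0 0 1%:M).
      by rewrite EN cg_diag.
    by rewrite rank_cg_free // rank_diag_block_mx mxrank1 addnC.
  case/submxP: w_in => D ED; pose a := D 0 (lshift 1 0); pose b := D 0 (rshift 1 0).
  have Ew : w = a *: u + b *: z.
    rewrite ED -[D]hsubmxK mul_row_col [lsubmx D]mx11_scalar [rsubmx D]mx11_scalar.
    by rewrite !mul_scalar_mx !mxE.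
  have r2 (D' : 'M[K]_(1 + 1)) : D' \in unitmx -> (1 < \rank (cg (col_mx u z)^T D'))%N.
    by move=> uD; rewrite rank_cg_free // mxrank_unit.
  case: (c2 t) => Et; first by rewrite EN Et scale0r add0r => /(leq_trans (r2 _ (unitmx1 _ _))).
  rewrite Et scale1r in E EN; case: (c2 a) Ew => ->; rewrite ?scale0r ?scale1r ?add0r;
    case: (c2 b) => ->; rewrite ?scale0r ?scale1r ?addr0 => Ew.
  - by rewrite EN Ew mulmx0 add0r => /(leq_trans (r2 _ (unitmx1 _ _))).
  - by left; rewrite E Ew E1.
  - by right; rewrite E Ew E2.
  have -> : M + (M2 - M1) = cg (col_mx u z)^T (block_mx 0 1%:M 1%:M 0).
    rewrite EN Ew /cg trmxK mulmx1 tr_col_mx mul_row_col mul_row_block !mulmx0 !mulmx1 add0r addr0.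
    rewrite mul_row_col [(u + z)^T]linearD /= mulmxDl !mulmxDr.
    move: (u^T *m u) (u^T *m z) (z^T *m u) (z^T *m z) => A1 A2 A3 A4.
    apply/matrixP => i j; rewrite !mxE.
    transitivity (A3 i j + A2 i j + 2%:R * (A1 i j + A4 i j)); first by ring.
    by rewrite two mul0r addr0.
  move/(leq_trans (r2 _ _)) => /(_ _) H; apply: False_ind; have : false; last by [].
  apply: H; have /mulmx1_unit [] // : block_mx 0 1%:M 1%:M 0 *m block_mx 0 1%:M 1%:M (0 : 'M[K]_1) = 1%:M.
  by rewrite mulmx_block !mulmx0 !mul0mx !mulmx1 !addr0 !add0r -scalar_mx_block.
split.
  apply/eqP; rewrite eqn_leq dS andbT; have sub : (S.2 <= <[M2 - M1]>)%VS.
    apply/subvP => v vS; case: (only _ (ainD M1S vS)) => E.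
      by rewrite -[v](addKr M1) E addrC subrr mem0v.
    by rewrite -[v](addKr M1) E addrC memv_line.
  by apply: leq_trans (dimvS sub) _; rewrite dim_vline; case: (_ != 0).
right; split=> //; exists u, z; split=> // M; rewrite -E1 -E2; split.
  by case/only; [right | left].
by case=> ->.
Qed.

End RankOne.

(** * The types of extremal spaces *)

Section Types.
Variable K : fieldType.
Local Notation asp := (asp K).
Local Notation Dr := (Dr K).
Local Notation gf2 := (two_elements K).

(** The forms of S become forms of rank at most odd r on a common subspace of
    codimension r./2: this is the shape of WS and of its variant over two elements. *)
Definition type_R n r (S : asp n) := exists k (Q : 'M[K]_(k, n)),
  [/\ (k + r./2 = n)%N, row_free Q & forall M, ain S M -> (\rank (cg Q M) <= odd r)%N].
(** The restriction of S to some subspace of dimension r is faithful and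
    gives all quadratic forms there. *)
Definition type_S n r (S : asp n) := exists Q : 'M[K]_(r, n),
  [/\ row_free Q, (forall v, v \in S.2 -> cg Q v = 0 -> v = 0) & \dim S.2 = s1 n r].
(** The restriction of S to some subspace of dimension r.+1 is faithful and gives all
    alternating forms there. *)
Definition type_A n r (S : asp n) := exists Q : 'M[K]_(r.+1, n),
  [/\ row_free Q, (forall v, v \in S.2 -> cg Q v = 0 -> v = 0) , \dim S.2 = s1 n r
    & [/\ forall M, ain S M -> alt (cg Q M), 2%:R = 0 :> K & ~~ odd r]].
Definition exceptional (n r : nat) := [/\ n = 3%N, r = 2%N & gf2].
Definition classified n r (S : asp n) :=
  [\/ type_R r S, type_S r S, type_A r S | exceptional n r].

Lemma row_free_mulmx k m n (Q : 'M[K]_(k, m)) (P : 'M[K]_(m, n)) :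
  row_free Q -> row_free P -> row_free (Q *m P).
Proof. by move=> fQ fP; rewrite /row_free mxrankMfree. Qed.

Lemma type_S_pull m n r (P : 'M[K]_(m, n)) (S : asp n) : row_free P ->
  (forall v, v \in S.2 -> cg P v = 0 -> v = 0) -> type_S r (compr P S) -> type_S r S.
Proof.
move=> fP inj [Q [fQ injQ d]]; exists (Q *m P); split; first exact: row_free_mulmx.
  move=> v vS; rewrite -cg_cg => E; apply: (inj _ vS); apply: injQ E; exact: comp_dir.
by rewrite -(dim_comp_inj inj) d.
Qed.

Lemma type_A_pull m n r (P : 'M[K]_(m, n)) (S : asp n) : row_free P ->
  (forall v, v \in S.2 -> cg P v = 0 -> v = 0) -> type_A r (compr P S) -> type_A r S.
Proof.
move=> fP inj [Q [fQ injQ d [aQ two ev]]]; exists (Q *m P); split; first exact: row_free_mulmx.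
- move=> v vS; rewrite -cg_cg => E; apply: (inj _ vS); apply: injQ E; exact: comp_dir.
- by rewrite -(dim_comp_inj inj) d.
by split=> // M MS; rewrite -cg_cg; apply: aQ; apply: comp_ain.
Qed.

Lemma type_R_pull n r (P : 'M[K]_n) (S : asp n) : P \in unitmx ->
  type_R r (compr P S) -> type_R r S.
Proof.
move=> uP [k [Q [e fQ rQ]]]; exists k, (Q *m P); split=> //.
  by apply: row_free_mulmx; rewrite // row_free_unit.
by move=> M MS; rewrite -cg_cg; apply: rQ; apply: comp_ain.
Qed.

Lemma cg_unit_inj n (P : 'M[K]_n) v : P \in unitmx -> cg P v = 0 -> v = 0.
Proof. by move=> uP E; rewrite -(cgK (mulVmx uP) v) E linear0. Qed.

Lemma classified_unit n r (P : 'M[K]_n) (S : asp n) : P \in unitmx ->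
  classified r (compr P S) -> classified r S.
Proof.
move=> uP [H|H|H|H].
- by constructor 1; apply: type_R_pull H.
- constructor 2; apply: type_S_pull H; first by rewrite row_free_unit.
  by move=> v _; apply: cg_unit_inj.
- constructor 3; apply: type_A_pull H; first by rewrite row_free_unit.
  by move=> v _; apply: cg_unit_inj.
by constructor 4.
Qed.

Lemma Dr_free m : row_free (Dr m).
Proof.
apply/row_freeP; exists (Dr m)^T.
by rewrite /Dr tr_row_mx mul_row_col trmx0 mulmx0 trmx1 mulmx1 add0r.
Qed.

(** Both bl 0 0 A and its sum with the direction have the rank of A. *)
Lemma corner_value m r (S : asp (1 + m)) A a v : bounded r S -> ain S (bl 0 0 A) ->
  \rank A = r -> bl a (v *m A) 0 \in S.2 -> a = ql v A v.
Proof.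
move=> bS MS rA vS; have := ainD MS vS; rewrite blD !add0r addr0 => H.
by apply: border_corner bS H _; rewrite rA.
Qed.

Lemma corner_zero m r (S : asp (1 + m)) A a u : bounded r S -> ain S (bl 0 0 A) ->
  \rank A = r -> ~ gf2 -> bl a u 0 \in S.2 -> a = 0.
Proof.
move=> bS MS rA /existsNP [t /not_orP [/eqP t0 /eqP t1]] uS.
have /submxP [v Ev] : (u <= A)%MS.
  by apply: border_dir_in bS uS (bl_ain MS) _; rewrite rA leq_addr.
subst u; have E1 := corner_value bS MS rA uS.
have tS : bl (t * a) ((t *: v) *m A) 0 \in S.2.
  by rewrite -scalemxAl -[X in bl _ _ X](scaler0 _ t) -blZ memvZ.
have := corner_value bS MS rA tS; rewrite qlZl qlZr -E1 => /(mulfI t0) /eqP.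
rewrite -subr_eq0 -{1}[a]mul1r -mulrBl mulf_eq0 subr_eq0 eq_sym (negPf t1) /=.
by move/eqP.
Qed.

(** The first basis vector lies in the radical of a matrix of S that has the maximal rank r. *)
Definition based m r (S : asp (1 + m)) := exists2 A, ain S (bl 0 0 A) & \rank A = r.

Lemma based_noE m r (S : asp (1 + m)) : bounded r S -> based r S -> bl 1 0 0 \notin S.2.
Proof.
by move=> bS [A AS rA]; apply: border_noE bS (bl_ain AS) _; rewrite rA.
Qed.

(** The corner of a border direction depends on it linearly, but is also the value of a
    quadratic form (corner_value): it vanishes if some scalar t differs from t^2, and it
    vanishes somewhere if the border space has dimension two. *)
Lemma isotropic_dichotomy m r (S : asp (1 + m)) : bounded r S -> based r S ->
  (0 < Wdim S)%N -> (exists2 u, u != 0 & bl 0 u 0 \in S.2) \/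
  [/\ gf2, Wdim S = 1%N & exists2 u, u != 0 & bl 1 u 0 \in S.2].
Proof.
move=> bS bA W0; have nE := based_noE bS bA; have EW := Wdim_noE bS nE.
rewrite EW in W0 *.
have u1U := memv_pick (Usp S); have : vpick (Usp S) != 0 by rewrite vpick0 -dimv_eq0 -lt0n.
move: (vpick _) u1U => u1 u1U u10; have [a1 a1S] := UspP _ bS u1U.
have [c2|c2] := pselect gf2; last first.
  have [A AS rA] := bA.
  by left; exists u1; rewrite // -(corner_zero bS AS rA c2 a1S).
have two := card2_two c2.
case: (c2 a1) a1S => -> a1S; first by left; exists u1.
have [le1|gt1] := leqP (\dim (Usp S)) 1.
  by right; split=> //; [apply/eqP; rewrite eqn_leq le1 | exists u1].
have /subvPn [u2 u2U u2n] : ~~ (Usp S <= <[u1]>)%VS.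
  by apply/negP => /dimvS; rewrite dim_vline u10 leqNgt gt1.
have [a2 a2S] := UspP _ bS u2U.
case: (c2 a2) a2S => -> a2S.
  left; exists u2 => //; apply: contra u2n => /eqP ->; exact: mem0v.
left; exists (u1 + u2).
  apply: contra u2n; rewrite addrC addr_eq0 => /eqP ->.
  by rewrite memvN memv_line.
have := rpredD a1S a2S; rewrite blD addr0.
by rewrite -[1 + 1]/(2%:R) two.
Qed.

Lemma Wdim_full m r (S : asp (1 + m)) : bounded r S -> Wdim S = m.+1 ->
  forall a b, bl a b 0 \in S.2.
Proof.
move=> bS; have := Wdim_split bS; have := dimvS (subvf (Usp S)).
rewrite dimvf /dim /= mul1n => leU /andP [_ leW] eW a b.
have ES : bl 1 0 0 \in S.2 by apply: contraLR leW => /negPf ->; rewrite eW; lia.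
have fU : Usp S = fullv.
  by apply/eqP; rewrite eqEdim subvf dimvf /dim /= mul1n; move: leW; rewrite eW ES; lia.
have /UspP - /(_ _ bS) [a' bS'] : b \in Usp S by rewrite fU memvf.
have -> : bl a b 0 = bl a' b 0 + (a - a') *: bl 1 0 0.
  by rewrite blZ blD !scaler0 !addr0 mulr1 addrC subrK.
by rewrite rpredD ?memvZ.
Qed.

Lemma rank_bl_le m a (b : 'rV[K]_m) B : (\rank (bl a b B) <= \rank B + 2)%N.
Proof.
have H k (x : 'rV[K]_k) l (Y : 'M[K]_(l, k)) : (\rank (col_mx x Y) <= \rank Y + 1)%N.
  rewrite -addsmxE; apply: leq_trans (mxrank_adds_leqif _ _) _.
  by rewrite addnC leq_add2l rank_leq_row.
rewrite /bl block_mxEv; apply: leq_trans (H _ _ _ _) _.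
rewrite (addnA _ 1 1) leq_add2r -mxrank_tr tr_row_mx trmxK -[\rank B]mxrank_tr.
exact: H.
Qed.

Lemma add_rank_one n k (A : 'M[K]_(k, n)) (x : 'cV_k) (y : 'rV_n) :
  (\rank A <= \rank (A + x *m y)%R + 1)%N.
Proof.
have E : A = (A + x *m y) + (- x) *m y by rewrite mulNmx addrK.
rewrite {1}E; apply: leq_trans (mxrank_add _ _) _; rewrite leq_add2l.
by apply: leq_trans (mxrankM_maxr _ _) _; apply: rank_leq_row.
Qed.

(** In corank one, a border space of dimension r - 1 with a hyperbolic vector would force the
    twice deleted space T2 to reach its maximal dimension, while the border rows confine
    the row spaces of its matrices. *)
Lemma corank1_split p (S : asp (1 + (1 + p))) : (1 < p)%N ->
  (forall n r, (n < p.+2)%N -> (r < n)%N -> forall S' : asp n, bounded r S' -> (\dim S'.2 <= dmax n r)%N) ->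
  bounded p.+1 S -> based p.+1 S -> bl 0 (e0 K p) 0 \in S.2 -> Wdim S = p ->
  (s1 p.+2 p.+1 <= \dim S.2)%N -> False.
Proof.
move=> p1 IH bS bA eS W dS.
pose T := compr (Dr (1 + p)) S; pose T2 := compr (Dr p) T.
have bT : bounded p.+1 T by apply: bounded_comp.
have bT2 : bounded p.-1 T2.
  move=> B BS; split; first exact: bounded_sym (bounded_comp bT) BS.
  by have := rank_drop2 bS eS BS; lia.
have sT2 B : ain T2 B -> B^T = B by apply: bounded_sym bT2.
have dT2 : (\dim T2.2 <= s1 p p.-1)%N.
  have dc : dmax p p.-1 = s1 p p.-1 by case: (p) p1 => // k _; exact: dmax_corank1.
  rewrite -dc; apply: IH bT2; lia.
have dT := dim_asp T; have dS' := dim_asp S; rewrite W in dS'.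
have WT := Wdim_le bT.
have E1 : s1 p.+2 p.+1 = (s1 p p.-1 + p + p.+1)%N.
  rewrite (s1S _ p); congr (_ + _)%N.
  by case: (p) p1 => // k _; rewrite (s1S _ k.+1 k).
have eW : Wdim T = p.+1 by move: dT dS' dT2 WT; rewrite -/T -/T2; lia.
have eT2 : \dim T2.2 = s1 p p.-1 by move: dT dS' dT2 WT; rewrite -/T -/T2; lia.
have fullT := Wdim_full bT eW.
have inT a b B : ain T2 B -> ain T (bl a b B).
  move=> /(ain_blP bT) [a' [b' H]]; have := ainD H (fullT (a - a') (b - b')).
  by rewrite blD addr0 addrC subrK [b' + _]addrC subrK.
have nE := based_noE bS bA.
have dU : \dim (Usp S) = p by rewrite -(Wdim_noE bS nE).
have UA A : ain T A -> (p <= \rank A)%N -> forall u, u \in Usp S -> (u <= A)%MS.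
  by move=> AS le u /(UspP _ bS) [a uS]; apply: border_dir_in bS uS AS _; lia.
have UA' A : ain T A -> \rank A = p -> forall u, (u <= A)%MS -> u \in Usp S.
  move=> AS rA; apply: dim_rows_eq; last by rewrite rA dU.
  by apply: UA => //; rewrite rA.
have eU : e0 K p \in Usp S by apply/(UspP _ bS); exists 0.
have nfull : ~ (forall y : 'rV_p, row_mx 0 y \in Usp S).
  move=> H; have : (fullv <= Usp S)%VS.
    apply/subvP => x _; rewrite -[x]hsubmxK [lsubmx x]mx11_scalar.
    have -> : row_mx (lsubmx x 0 0)%:M (rsubmx x) = lsubmx x 0 0 *: e0 K p + row_mx 0 (rsubmx x).
      by rewrite /e0 scale_row_mx add_row_mx scaler0 add0r addr0 scalemx1.
    by rewrite rpredD ?memvZ.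
  by move/dimvS; rewrite dU dimvf /dim /= mul1n ltnn.
(* Such a B could be bordered by any vector outside its row space, so that
   Usp S would contain every row_mx 0 y. *)
have no2 B : ain T2 B -> \rank B != p.-2.
  move=> BS; apply/eqP => rB; apply: nfull.
  have out b : ~~ (b <= B)%MS -> row_mx 0 b \in Usp S.
    move=> nb; have sB := sT2 _ BS; have := rank_bl_out 0 sB nb.
    have := rank_bl_le 0 b B; rewrite rB => le1 le2.
    apply: (UA' (bl 0 b B)); [exact: inT | lia | ].
    by rewrite /bl block_mxEv -addsmxE (raddf0 (@scalar_mx _ 1)) addsmxSl.
  have /row_subPn [i] : ~~ ((1%:M : 'M[K]_p) <= B)%MS by rewrite sub1mx /row_full rB; lia.
  move: (row i _) => g gB.
  move=> y; have [yB|] := boolP (y <= B)%MS; last exact: out.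
  have -> : row_mx 0 y = row_mx 0 (y + g) - row_mx 0 g :> 'rV[K]_(1 + p).
    by rewrite opp_row_mx add_row_mx subrr addrK.
  rewrite rpredB ?out //; apply: contra gB => H.
  by rewrite -(addKr y g) addmx_sub // eqmx_opp.
have [X fX UX] := vspace_rows (Usp S).
pose Y := X *m (col_mx 0 1%:M : 'M_(1 + p, p)).
have rank_in B : ain T2 B -> \rank B = p.-1 -> (B <= Y)%MS.
  move=> BS rB; have AS := inT 1 0 _ BS.
  have rA : \rank (bl 1 0 B) = p.
    have -> : bl 1 0 B = bl 1 (0 *m B) B by rewrite mul0mx.
    by rewrite rank_bl ?sT2 // rB /ql !mul0mx mxE oner_neq0; lia.
  have AX : (bl 1 0 B <= X)%MS.
    by apply/row_subP => i; rewrite -UX; apply: UA' AS rA _ _; apply: row_sub.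
  have -> : B = Dr p *m bl 1 0 B *m col_mx 0 1%:M.
    by rewrite /Dr /bl mul_row_block !mul0mx !mul1mx !add0r mul_row_col mulmx0 mulmx1 add0r.
  by rewrite submxMr // (submx_trans (submxMl _ _)).
have allY B : ain T2 B -> (B <= Y)%MS.
  have [p2|p2] := eqVneq p 2%N.
    move=> BS; apply: rank_in => //; have := (bT2 _ BS).2; have := no2 _ BS.
    by move: (\rank B); rewrite p2 => -[|[|?]].
  apply: (@affine_rows _ _ _ (p - 3) (dmax p (p - 3))) => //.
  - by apply: IH; lia.
  - move=> N NS lt; apply: rank_in => //.
    by have := (bT2 _ NS).2; have := no2 _ NS; lia.
  by have := @dmax_gap_corank3 p.+1; rewrite eT2 !subSS subn1 /s1 /=; apply; lia.
have dirY w : w \in T2.2 -> w^T = w /\ (w <= row_base Y)%MS.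
  rewrite eq_row_base; apply: (@dir_of_ain _ _ T2 (fun w => w^T = w /\ (w <= Y)%MS)) => [M MS|M N [H1 H2] [H3 H4]].
    by split; [apply: sT2 | apply: allY].
  by rewrite linearB /= H1 H3 addmx_sub // eqmx_opp.
have [leY fullY] := sym_rows_dim (row_base_free Y) dirY.
have rY : \rank Y = p.-1.
  have rYp : (\rank Y < p)%N.
    rewrite ltn_neqAle rank_leq_col andbT; apply/negP => fY; apply: nfull => y.
    have /submxP [D ED] : (y <= Y)%MS by apply: submx_full.
    have -> : row_mx 0 y = D *m X - lsubmx (D *m X) 0 0 *: e0 K p.
      rewrite -[D *m X]hsubmxK row_mxKl {1}[lsubmx (D *m X)]mx11_scalar /e0.
      rewrite scale_row_mx scaler0 scalemx1 opp_row_mx add_row_mx subrr subr0; congr row_mx.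
      rewrite ED mulmxA -[D *m X in LHS]hsubmxK mul_row_col mulmx0 mulmx1 add0r.
      by [].
    by rewrite rpredB ?memvZ // UX submxMl.
  apply/eqP; rewrite eqn_leq -ltnS prednK ?rYp ?(ltnW p1) //= leqNgt; apply/negP => lt.
  move: leY; rewrite eT2 leqNgt => /negP; apply.
  have := s1_double p (\rank Y); have := s1_double p p.-1; nia.
have {}fullY := fullY (etrans eT2 (congr1 (s1 p) (esym rY))).
have base0 : ain T2 0.
  rewrite /ain sub0r rpredN; apply: fullY; first exact: sT2 (ain_base _).
  by rewrite eq_row_base allY ?ain_base.
pose C := cg (row_base Y)^T (pid_mx p.-2).
have CS : ain T2 C.
  rewrite -[C]add0r; apply: ainD base0 _; apply: fullY.
    by rewrite /C cgT tr_pid_mx.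
  by rewrite /C /cg trmxK submxMl.
have := no2 _ CS; rewrite /C rank_cg_free ?row_base_free // rank_pid_mx ?eqxx //; rewrite rY; lia.
Qed.
Lemma alt_bl m (c : 'rV[K]_m) A : alt A -> alt (bl 0 c A).
Proof.
case=> sA dA; split; first exact: symP_bl.
move=> i; rewrite /bl; case: (@split_ordP 1 m i) => j ->.
  by rewrite block_mxEul mxE mul0rn.
by rewrite block_mxEdr dA.
Qed.

Lemma bl00 m a (u : 'rV[K]_m) B : bl a u B 0 0 = a.
Proof.
transitivity (block_mx a%:M u u^T B (lshift m 0) (lshift m 0)).
  by rewrite /bl; congr (block_mx _ _ _ _ _ _); apply: val_inj.
by rewrite block_mxEul mxE eqxx mulr1n.
Qed.

Lemma alt_ql n (B : 'M[K]_n) v : alt B -> 2%:R = 0 :> K -> ql v B v = 0.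
Proof.
move=> [sB dB] two; rewrite [v]row_sum_delta.
apply: (big_ind (fun v => ql v B v = 0)).
- by apply: ql0l; rewrite mul0mx.
- move=> x y Hx Hy; rewrite qlDl !qlDr Hx Hy (qlC y x sB) add0r addr0.
  by rewrite -mulr2n -mulr_natr two mulr0.
move=> i _; rewrite qlZl qlZr (_ : ql _ _ _ = B i i) ?dB ?mulr0 //.
by rewrite /ql trmx_delta -rowE -colE !mxE.
Qed.

Lemma ql_alt n (B : 'M[K]_n) : B^T = B -> (forall v, ql v B v = 0) -> alt B.
Proof.
move=> sB H; split=> // i; have := H (delta_mx 0 i).
by rewrite /ql trmx_delta -rowE -colE !mxE.
Qed.

Lemma ql_alt_char2 n (B : 'M[K]_n) : B^T = B -> (forall v, ql v B v = 0) -> B != 0 -> 2%:R = 0 :> K.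
Proof.
move=> sB H; apply: contra_neq_eq => two.
apply/matrixP => i j; rewrite mxE.
have E : B i j = ql (delta_mx 0 i) B (delta_mx 0 j) by rewrite /ql trmx_delta -rowE -colE !mxE.
have := H (delta_mx 0 i + delta_mx 0 j); rewrite qlDl !qlDr !H add0r addr0 (qlC _ (delta_mx 0 i) sB) -E.
by move/eqP; rewrite -mulr2n -mulr_natr mulf_eq0 (negPf two) orbF => /eqP.
Qed.

(** Induction on the size: a border raises the rank by zero or two, since the corner and
    all the values ql v A v vanish. *)
Lemma alt_rank_even n (B : 'M[K]_n) : alt B -> 2%:R = 0 :> K -> ~~ odd (\rank B).
Proof.
move=> aB two; elim: n B aB => [|m IH] B aB; first by rewrite flatmx0 mxrank0.
have [sB dB] := aB; rewrite (blE (sB : B^T = B :> 'M_(1 + m))) dB.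
set c := ursubmx _; set A := cg _ _.
have sA : A^T = A by rewrite /A cgT sB.
have aA : alt A by split=> // i; rewrite /A cg_Dr !mxE dB.
have [/submxP [v ->]|out] := boolP (c <= A)%MS.
  by rewrite rank_bl // (alt_ql _ aA two) eqxx add0n IH.
have := rank_bl_out 0 sA out; have := rank_bl_le 0 c A => le1 le2.
have -> : \rank (bl 0 c A) = (\rank A + 2)%N by apply/eqP; rewrite eqn_leq le1 le2.
by rewrite addn2 /= negbK IH.
Qed.

(** In corank one, if all border directions have corner zero and form a space of dimension
    r, then ql v A v = 0 for every based matrix: the matrices are alternating. *)
Lemma corank1_alt p (S : asp (1 + (1 + p))) : (0 < p)%N ->
  (forall n r, (n < p.+2)%N -> (r < n)%N -> forall S' : asp n, bounded r S' -> (\dim S'.2 <= dmax n r)%N) ->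
  bounded p.+1 S -> based p.+1 S -> Wdim S = p.+1 -> (forall a u, bl a u 0 \in S.2 -> a = 0) ->
  (s1 p.+2 p.+1 <= \dim S.2)%N -> \dim S.2 = s1 p.+2 p.+1 /\ ((p = 1%N -> ~ gf2) -> type_A p.+1 S).
Proof.
move=> p0 IH bS bA eW iso dS.
pose T := compr (Dr (1 + p)) S.
have bT : bounded p.+1 T by apply: bounded_comp.
have nE := based_noE bS bA.
have fU u : bl 0 u 0 \in S.2.
  have fU : Usp S = fullv.
    by apply/eqP; rewrite eqEdim subvf dimvf /dim /= mul1n -(Wdim_noE bS nE) eW.
  have /UspP - /(_ _ bS) [a aS] : u \in Usp S by rewrite fU memvf.
  by rewrite -{1}(iso _ _ aS).
have norank A : ain T A -> \rank A != p.
  move=> AS; apply/eqP => rA; suff : (\rank (1%:M : 'M[K]_(1 + p)) <= \rank A)%N by rewrite mxrank1 rA; lia.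
  apply: mxrankS; apply/row_subP => i; apply: border_dir_in bS (fU _) AS _.
  by rewrite rA; lia.
have lift0 A : ain T A -> exists d, ain S (bl d 0 A).
  move=> /(ain_blP bS) [d [c MS]]; exists d.
  by have := ainD MS (fU (- c)); rewrite blD !addr0 subrr.
have invd d A : ain S (bl d 0 A) -> \rank A = p.+1 -> d = 0.
  move=> MS rA; have MS' : ain S (bl d (0 *m A) A) by rewrite mul0mx.
  have := border_corner bS MS'; rewrite rA => -> //; apply: ql0l; exact: mul0mx.
have invalt A : ain T A -> \rank A = p.+1 -> forall v, ql v A v = 0.
  move=> AS rA v; have [d MS] := lift0 _ AS.
  have d0 := invd _ _ MS rA; rewrite d0 in MS.
  by rewrite -(corner_value bS MS rA (fU (v *m A))).
have [A0 A0S rA0] := bA; have A0T := bl_ain A0S.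
have sA0 := bounded_sym bT A0T.
have two : 2%:R = 0 :> K.
  apply: ql_alt_char2 sA0 (invalt _ A0T rA0) _.
  by rewrite -mxrank_eq0 rA0.
have aA0 : alt A0 by apply: ql_alt (invalt _ A0T rA0).
have ev : ~~ odd p.+1 by rewrite -rA0 alt_rank_even.
have eT : \dim S.2 = (p.+1 + \dim T.2)%N by rewrite dim_asp eW.
have Es : s1 p.+2 p.+1 = (s1 p.+1 p + p.+1)%N := s1S _ _ _.
have dT : (s1 p.+1 p <= \dim T.2)%N by lia.
have gap A : ain T A -> (p.-1 < \rank A)%N -> \rank A = p.+1.
  by move=> AS; have := norank _ AS; have := (bT _ AS).2; lia.
have altT A : ain T A -> alt A.
  move=> AS; split; first exact: bounded_sym bT AS.
  move=> i; have E (B : 'M[K]_(1 + p)) : B i i = entry_row (delta_mx 0 i) (delta_mx i 0) B.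
    by rewrite /entry_row -rowE -colE !mxE.
  have [pe1|pn1] := eqVneq p 1%N.
    have [rA|rA] := eqVneq (\rank A) p.+1.
      by rewrite (ql_alt (bounded_sym bT AS) (invalt _ AS rA)).2.
    have : \rank A = 0%N by have := gap _ AS; have := (bT _ AS).2; lia.
    by move/eqP; rewrite mxrank_eq0 => /eqP ->; rewrite mxE.
  rewrite E; apply: (@affine_const _ _ p.-1 (dmax p.+1 p.-1) T) AS => //.
  - by apply: IH; lia.
  - by move=> M MS; apply: bounded_sym bT MS.
  - move=> M MS lt /=; rewrite -E.
    by have [_ ->] := ql_alt (bounded_sym bT MS) (invalt _ MS (gap _ MS lt)).
  apply: leq_trans dT; have := @dmax_gap_corank2 p.+1; rewrite subSS subn1; apply; lia.
have eT2 : \dim T.2 = s1 p.+1 p.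
  apply/eqP; rewrite eqn_leq dT andbT; apply: (@dim_alt _ p.+1).
  apply: (@dir_of_ain _ _ T (@alt _ _)) => //.
  move=> M N [E1 D1] [E2 D2]; split; first by rewrite linearB /= E1 E2.
  by move=> i; rewrite !mxE D1 D2 subr0.
split; first by rewrite eT eT2 Es addnC.
move=> p1; exists 1%:M; rewrite row_free_unit unitmx1; split=> //.
- by move=> v _; rewrite cg1.
- by rewrite eT eT2 Es addnC.
split=> // M MS; rewrite cg1.
have sM := bounded_sym bS MS; rewrite (blE sM) in MS *.
move: (M 0 0) (ursubmx M) (cg _ M) MS => d c A MS {M sM}.
have AS := bl_ain MS; have [sA dA] := altT _ AS.
suff d0 : d = 0.
  by rewrite d0; apply: alt_bl.
have {}MS : ain S (bl d 0 A) by have := ainD MS (fU (- c)); rewrite blD !addr0 subrr.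
have [pe1|pn1] := eqVneq p 1%N.
  have [rA|rA] := eqVneq (\rank A) p.+1; first exact: invd MS rA.
  have A00 : A = 0.
    have : \rank A = 0%N by have := gap _ AS; have := (bT _ AS).2; lia.
    by move/eqP; rewrite mxrank_eq0 => /eqP.
  move/existsNP: (p1 pe1) => [k /not_orP [/eqP k0 /eqP k1]].
  have kS : k *: (bl 0 0 A0 - bl d 0 A) \in S.2 by rewrite memvZ // (ainB A0S MS).
  have HS : ain S (bl ((1 - k) * d) 0 (k *: A0)).
    have := ainD MS kS; rewrite A00 -scaleN1r blZ blD blZ blD !scaler0 !addr0 scaler0 !add0r.
    by congr (ain S (bl _ _ _)); ring.
  have /eqP := invd _ _ HS (etrans (mxrank_scale_nz _ k0) rA0).
  by rewrite mulf_eq0 subr_eq0 eq_sym (negPf k1) /= => /eqP.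
pose S0 : asp (1 + (1 + p)) := (bl d 0 A, S.2 :&: lker (linfun (@urm K (1 + p))))%VS.
have S0S M : ain S0 M -> ain S M /\ M = bl (M 0 0) 0 (cg (Dr (1 + p)) M).
  rewrite {1}/ain /= memv_cap memv_ker lfunE /= => /andP [H /eqP u0].
  have {}MS' : ain S M by rewrite -[M](subrK (bl d 0 A)) addrC ainD.
  split=> //; have := blE (bounded_sym bS MS'); suff -> : ursubmx M = 0 by [].
  have : urm M - urm (bl d 0 A) = 0 by rewrite -linearB.
  by rewrite /urm /bl block_mxKur subr0.
have lamE (M : 'M_(1 + (1 + p))) :
    entry_row (delta_mx 0 0 : 'rV[K]_(1 + (1 + p))) (delta_mx 0 0) M = M 0 0.
  by rewrite /entry_row -rowE -colE !mxE.
rewrite -(bl00 d 0 A) -lamE.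
apply: (@affine_const_cg _ _ _ (Dr (1 + p)) p.-1 (dmax p.+1 p.-1) S0).
- by apply: IH; lia.
- by move=> M /S0S [/(bounded_sym bS)].
- move=> v; rewrite memv_cap memv_ker lfunE /= /urm lamE => /andP [vS /eqP u0] l0 v0 /=.
  by rewrite (blE (bounded_dirT bS vS)) l0 u0 v0 bl0.
- move=> M /S0S [MS' E]; rewrite /= lamE => lt.
  apply: (invd _ (cg (Dr (1 + p)) M)); first by rewrite -E.
  by apply: gap lt; apply: comp_ain.
- have Hd : (\dim S.2 <= \dim S0.2 + p.+1)%N.
    rewrite -(limg_ker_dim (linfun (@urm K (1 + p))) S.2) leq_add2l.
    by apply: leq_trans (dimvS (subvf _)) _; rewrite dimvf /dim /= mul1n.
  apply: (@leq_trans (s1 p.+1 p)).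
    by have := @dmax_gap_corank2 p.+1; rewrite subSS subn1; apply; lia.
  by rewrite -(leq_add2r p.+1) -Es (leq_trans dS).
exact: ain_base.
Qed.
End Types.

(** * The corank one case *)

Section CorankOne.
Variable K : fieldType.
Local Notation asp := (asp K).
Local Notation Dr := (Dr K).
Local Notation gf2 := (two_elements K).

(** Adds multiples of the first basis vector to the others; it preserves every matrix
    whose first row and column vanish. *)
Definition shear m (t : 'rV[K]_m) : 'M[K]_(1 + m) := block_mx 1%:M 0 t^T 1%:M.

Lemma shear_bl m (t : 'rV[K]_m) a w B :
  cg (shear t) (bl a w B) =
  bl a (a *: t + w) (a *: (t^T *m t) + t^T *m w + w^T *m t + B).
Proof.
rewrite /cg /shear /bl tr_block_mx !trmx1 trmx0 trmxK !mulmx_block.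
rewrite !mul1mx !mul0mx !mulmx1 !mulmx0 !addr0 mul_scalar_mx.
congr block_mx; first by rewrite linearD linearZ /= mul_mx_scalar.
by rewrite mulmxDl mul_mx_scalar -scalemxAl -!addrA; congr (_ + _); rewrite addrCA.
Qed.

Lemma shear_mul m (t s : 'rV[K]_m) : shear t *m shear s = shear (t + s).
Proof.
by rewrite /shear mulmx_block !mul1mx !mul0mx !mulmx1 !mulmx0 !addr0 add0r linearD.
Qed.

Lemma shear0 m : shear (0 : 'rV[K]_m) = 1%:M.
Proof. by rewrite /shear trmx0 -scalar_mx_block. Qed.

Lemma shear_unit m (t : 'rV[K]_m) : shear t \in unitmx.
Proof. by have := shear_mul t (- t); rewrite subrr shear0; case/mulmx1_unit. Qed.

Lemma shear_based m r (S : asp (1 + m)) A t : ain S (bl 0 0 A) -> \rank A = r ->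
  ain (compr (shear t) S) (bl 0 0 A).
Proof.
move=> AS rA; have := comp_ain (shear t) AS.
by rewrite shear_bl !scale0r trmx0 mulmx0 mul0mx !add0r.
Qed.

Lemma Usp_full m r (S : asp (1 + m)) : bounded r S -> based r S -> Wdim S = m ->
  forall u, exists a, bl a u 0 \in S.2.
Proof.
move=> bS bA W u; apply/(UspP u bS).
have fU : Usp S = fullv.
  by apply/eqP; rewrite eqEdim subvf dimvf /dim /= mul1n -(Wdim_noE bS (based_noE bS bA)) W.
by rewrite fU memvf.
Qed.

(** Over two elements, comparing border directions before and after the shear by u
    produces the direction bl 1 0 0. *)
Lemma corank1_twist m (S : asp (1 + m)) A u : gf2 -> bounded m S -> ain S (bl 0 0 A) ->
  \rank A = m -> bl 1 u 0 \in S.2 ->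
  (forall P, P \in unitmx -> based m (compr P S) -> Wdim (compr P S) = m) -> False.
Proof.
move=> c2 bS AS rA uS HW; have two := card2_two c2.
have bA : based m S by exists A.
have nE := based_noE bS bA.
pose S' := compr (shear (- u)) S.
have bS' : bounded m S' by apply: bounded_comp.
have bA' : based m S' by exists A => //; apply: shear_based rA.
have [a aS'] := Usp_full bS' bA' (HW _ (shear_unit _) bA') u.
have [v vS Ev] := dir_comp aS'.
have Ev' : v = cg (shear u) (bl a u 0).
  by rewrite Ev cg_cg shear_mul addrN shear0 cg1.
rewrite {}Ev' shear_bl addr0 in vS.
case: (c2 a) vS => ->.
  rewrite !scale0r !add0r => vS.
  have E2 : u^T *m u + u^T *m u = 0 by rewrite -mulr2n -scaler_nat two scale0r.
  rewrite E2 in vS; case/negP: nE.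
  by have := rpredB uS vS; rewrite -scaleN1r blZ blD mulr0 addr0 scaleN1r subrr scaler0 addr0.
rewrite !scale1r => vS.
have Eu : u + u = 0 by rewrite -mulr2n -scaler_nat two scale0r.
have E2 : u^T *m u + u^T *m u + u^T *m u = u^T *m u.
  by rewrite -[RHS]add0r; congr (_ + _); rewrite -mulr2n -scaler_nat two scale0r.
rewrite Eu E2 in vS.
have HA : ain (compr (Dr m) S) (A + u^T *m u).
  by apply: (@bl_ain _ _ _ 1 0); have := ainD AS vS; rewrite blD add0r addr0.
have sA := bounded_sym (bounded_comp bS) (bl_ain AS).
have /submxP [x Ex] : (u <= A)%MS.
  by apply: border_dir_in bS uS (bl_ain AS) _; rewrite rA leq_addr.
have qx : ql x A x = 1.
  by rewrite Ex in uS; rewrite -(corner_value bS AS rA uS).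
have x0 : x *m (A + u^T *m u) = 0.
  rewrite mulmxDr -Ex mulmxA -{1}[x]trmxK -trmx_mul [u *m _]mx11_scalar.
  have -> : (u *m x^T) 0 0 = 1 by rewrite Ex -/(ql x A x) qx.
  by rewrite tr_scalar_mx mul1mx.
have xn : x != 0 by apply: contra_eq_neq qx => ->; rewrite /ql !mul0mx mxE eq_sym oner_neq0.
have rk : (\rank (A + u^T *m u)%R < m)%N.
  rewrite ltn_neqAle rank_leq_row andbT; apply/negP => f.
  case/negP: xn; rewrite -submx0 -(eqP (_ : kermx (A + u^T *m u) == 0)).
    by apply/sub_kermxP.
  by rewrite kermx_eq0.
have rk1 := add_rank_one A u^T u; rewrite rA in rk1.
suff : (\rank (1%:M : 'M[K]_m) <= \rank (A + u^T *m u)%R)%N by rewrite mxrank1; lia.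
have W : Wdim S = m by have := HW 1%:M (unitmx1 _ _); rewrite comp1; apply.
apply: mxrankS; apply/row_subP => i; have [b bS2] := Usp_full bS bA W (row i 1%:M).
by apply: border_dir_in bS bS2 HA _; lia.
Qed.

(** Singularity of all the matrices on the line through a matrix of S in the direction e0. *)
Lemma net_facts (S : asp (1 + (1 + 1))) d c0 c1 al be :
  bounded 2 S -> bl 0 (e0 K 1) 0 \in S.2 ->
  ain S (bl d (row_mx c0%:M c1%:M) (bl al be%:M 0)) ->
  (be != 0 -> c1 * 2%:R = 0 /\ be * be * d = - (al * c1 * c1)) /\
  (be = 0 -> al != 0 -> c1 = 0).
Proof.
move=> bS hS MS; set A := bl al be%:M 0 in MS.
have sA := bl_sym (bounded_sym bS MS).
have solve (v : 'rV_(1 + 1)) x0 x1 : row_mx x0%:M x1%:M = v *m A ->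
    [/\ x0 = v 0 (lshift 1 0) * al + v 0 (rshift 1 0) * be, x1 = v 0 (lshift 1 0) * be
      & ql v A v = x0 * v 0 (lshift 1 0) + x1 * v 0 (rshift 1 0)].
  set v0 := v 0 _; set v1 := v 0 _.
  have Ev : v = row_mx v0%:M v1%:M.
    by rewrite -[v]hsubmxK [lsubmx v]mx11_scalar [rsubmx v]mx11_scalar !mxE.
  move=> E; have E' := E; rewrite {1}Ev /A /bl mul_row_block mulmx0 addr0 tr_scalar_mx in E'.
  rewrite -!scalar_mxM -raddfD /= in E'.
  case/eq_row_mx: E' => /matrixP /(_ 0 0) + /matrixP /(_ 0 0); rewrite !mxE eqxx !mulr1n => E0 E1.
  split=> //; rewrite (ql_mul v (esym E)) {1}Ev tr_row_mx mul_row_col !tr_scalar_mx -!scalar_mxM.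
  by rewrite !mxE eqxx !mulr1n.
split=> [be0|be0 al0].
  have rA : (2 <= \rank A)%N.
    have out : ~~ (be%:M <= (0 : 'M[K]_1))%MS by rewrite submx0 mx11_eq0.
    by have := rank_bl_out al (trmx0 _ _ _) out; rewrite mxrank0.
  have inA (x : 'rV_(1 + 1)) : (x <= A)%MS.
    by apply: submx_full; rewrite /row_full eqn_leq rA rank_leq_row.
  have val x0 : ain S (bl d (row_mx x0%:M c1%:M) A) ->
      be * be * d = x0 * c1 * be * 2%:R - al * c1 * c1.
    move=> XS; have /submxP [v Ev] := inA (row_mx x0%:M c1%:M).
    have [E0 E1 Eq] := solve _ _ _ Ev; rewrite Ev in XS.
    rewrite (border_corner bS XS rA) Eq E0 E1; ring.
  have MS2 : ain S (bl d (row_mx (c0 + 1)%:M c1%:M) A).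
    by have := ainD MS hS; rewrite blD !addr0 /e0 add_row_mx addr0 -raddfD.
  have e1 := val _ MS; have e2 := val _ MS2; rewrite e1 in e2.
  have two : c1 * 2%:R = 0.
    apply: (mulfI be0); rewrite mulr0; move/eqP: e2; rewrite -subr_eq0 => /eqP e2.
    by rewrite -[RHS]oppr0 -e2; ring.
  split=> //; rewrite e1 (_ : c0 * c1 * be * 2%:R = c0 * be * (c1 * 2%:R)); last by ring.
  by rewrite two mulr0 sub0r.
have rA : (1 <= \rank A)%N.
  rewrite lt0n mxrank_eq0; apply: contra al0 => /eqP E0.
  by have := bl00 al be%:M 0; rewrite -/A E0 mxE => <-.
have /submxP [v Ev] : (row_mx c0%:M c1%:M <= A)%MS.
  by apply: border_in bS MS _; rewrite addn1 ltnS.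
by have [_ -> _] := solve _ _ _ Ev; rewrite be0 mulr0.
Qed.

Lemma rows_of_2 (c : 'rV[K]_(1 + 1)) : exists c0 c1, c = row_mx c0%:M c1%:M.
Proof.
exists (lsubmx c 0 0), (rsubmx c 0 0).
by rewrite -!mx11_scalar hsubmxK.
Qed.

(** The case of nets of conics: by net_facts the vector e0 is isotropic for everything
    as soon as there are more than two scalars. *)
Lemma net_type_R (S : asp (1 + (1 + 1))) : ~ gf2 ->
  bounded 2 S -> bl 0 (e0 K 1) 0 \in S.2 ->
  (forall a u, bl a u 0 \in S.2 -> a = 0 /\ exists k, u = k *: e0 K 1) ->
  (forall a b, bl a b 0 \in (compr (Dr (1 + 1)) S).2) ->
  (forall A, ain (compr (Dr (1 + 1)) S) A -> cg (Dr 1) A = 0) ->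
  type_R 2 S.
Proof.
move=> /existsNP [t /not_orP [/eqP t0 /eqP t1]] bS hS kerS fullT zeroT.
have bT : bounded 2 (compr (Dr (1 + 1)) S) by apply: bounded_comp.
have formA A : ain (compr (Dr (1 + 1)) S) A -> exists al be, A = bl al be%:M 0.
  move=> AS; exists (A 0 0), (ursubmx (A : 'M_(1 + 1)) 0 0).
  rewrite -mx11_scalar -(zeroT _ AS); apply: blE; exact: bounded_sym bT AS.
have T0 : ain (compr (Dr (1 + 1)) S) 0.
  have [al [be E]] := formA _ (ain_base _).
  by rewrite /ain sub0r rpredN E; apply: fullT.
have [x0 [y0 M0S]] := ain_blP bS T0.
have [x1 [y1 V1]] := dir_blP bS (fullT 1 0).
have [x2 [y2 V2]] := dir_blP bS (fullT 0 1%:M).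
have [p0 [q0 Ey0]] := rows_of_2 y0; have [p1 [q1 Ey1]] := rows_of_2 y1.
have [p2 [q2 Ey2]] := rows_of_2 y2.
pose dd al be := x0 + al * x1 + be * x2.
pose cc al be := q0 + al * q1 + be * q2.
have el al be : ain S (bl (dd al be) (row_mx (p0 + al * p1 + be * p2)%:M (cc al be)%:M) (bl al be%:M 0)).
  have vS : al *: bl x1 y1 (bl 1 0 0) + be *: bl x2 y2 (bl 0 1%:M 0) \in S.2.
    by rewrite rpredD ?memvZ.
  have := ainD M0S vS; rewrite !blZ !blD Ey0 Ey1 Ey2 !scale_row_mx !add_row_mx !scale_scalar_mx.
  rewrite -!raddfD /= !mulr1 !mulr0 !scaler0 !addr0 !add0r !addrA.
  by rewrite /dd /cc.
have c1 al : al != 0 -> cc al 0 = 0.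
  by move=> al0; apply: (net_facts bS hS (el al 0)).2.
have d1 be al : be != 0 -> cc al be * 2%:R = 0 /\ be * be * dd al be = - (al * cc al be * cc al be).
  by move=> be0; apply: (net_facts bS hS (el al be)).1.
have eq1 := c1 1 (oner_neq0 _); have eqt := c1 t t0.
rewrite /cc !mul0r !addr0 mul1r in eq1 eqt.
have t1' : t - 1 != 0 by rewrite subr_eq0.
have q10 : q1 = 0.
  apply/eqP; have /eqP : (t - 1) * q1 = 0.
    by transitivity ((q0 + t * q1) - (q0 + q1)); [ring | rewrite eqt eq1 subrr].
  by rewrite mulf_eq0 (negPf t1').
have q00 : q0 = 0 by move: eq1; rewrite q10 addr0.
have Ecc al be : cc al be = be * q2 by rewrite /cc q00 q10 mulr0 !add0r.
have [two e10] := d1 1 0 (oner_neq0 _); have [_ et0] := d1 t 0 t0; have [_ e11] := d1 1 1 (oner_neq0 _).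
rewrite !Ecc /dd !mul0r !mul1r oppr0 !addr0 in two e10 et0 e11.
have x20 : x2 = 0.
  move/eqP: et0; rewrite !mulf_eq0 (negPf t0) /= => /eqP et0.
  apply/eqP; have /eqP : (t - 1) * x2 = 0.
    by transitivity ((x0 + t * x2) - (x0 + x2)); [ring | rewrite et0 e10 subrr].
  by rewrite mulf_eq0 (negPf t1').
have x00 : x0 = 0 by move: e10; rewrite x20 addr0.
have Ex1 : x1 = - (q2 * q2) by move: e11; rewrite x00 x20 add0r addr0.
pose r1 : 'rV[K]_(1 + (1 + 1)) := row_mx 1%:M (row_mx (- q2)%:M 0).
pose r2 : 'rV[K]_(1 + (1 + 1)) := row_mx 0 (row_mx 0 1%:M).
exists (1 + 1)%N, (col_mx r1 r2); split=> //.
  apply/row_freeP; exists (row_mx (col_mx 1%:M 0) (col_mx 0 (col_mx 0 1%:M))).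
  rewrite mul_col_row /r1 /r2 !mul_row_col !mulmx0 !mul0mx !mulmx1 !addr0 !add0r.
  by rewrite -scalar_mx_block.
move=> M MS; rewrite /= leqn0 mxrank_eq0; apply/eqP.
have sM := bounded_sym bS MS; rewrite (blE sM) in MS *.
move: (M 0 0) (ursubmx M) (cg _ M) MS => d c A MS {M sM}.
have [al [be EA]] := formA _ (bl_ain MS); subst A.
have := ainB MS (el al be); rewrite -scaleN1r blZ blD [-1 *: bl _ _ _]scaleN1r subrr => /kerS [Ed [k Ec]].
have {}Ed : d = - (al * q2 * q2).
  move/eqP: Ed; rewrite mulN1r subr_eq0 => /eqP ->.
  by rewrite /dd x00 x20 Ex1; ring.
have {}Ec : exists c0, c = row_mx c0%:M (be * q2)%:M.
  move/eqP: Ec; rewrite scaleN1r subr_eq => /eqP ->; rewrite /e0 Ecc scale_row_mx add_row_mx.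
  by rewrite scaler0 add0r scalemx1 -raddfD; eexists.
case: Ec => c0 Ec; subst c d.
have r1M : r1 *m bl (- (al * q2 * q2)) (row_mx c0%:M (be * q2)%:M) (bl al be%:M 0) =
    row_mx (- (al * q2 * q2) - q2 * c0)%:M (row_mx (c0 - q2 * al)%:M 0).
  rewrite /r1 /bl mul_row_block tr_row_mx !tr_scalar_mx !mul1mx mul_row_col mul0mx addr0.
  rewrite mul_row_block !mul0mx !addr0 -!scalar_mxM -!raddfD /= add_row_mx -!raddfD /=.
  by congr row_mx; [congr (_%:M); ring | congr row_mx; [congr (_%:M); ring | rewrite -[RHS](raddf0 (@scalar_mx _ 1)); congr (_%:M); ring]].
have r2M : r2 *m bl (- (al * q2 * q2)) (row_mx c0%:M (be * q2)%:M) (bl al be%:M 0) =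
    row_mx (be * q2)%:M (row_mx be%:M 0).
  rewrite /r2 /bl mul_row_block tr_row_mx !tr_scalar_mx !mul0mx mul_row_col mul0mx !add0r mul1mx.
  by rewrite mul_row_block !mul0mx !mul1mx !add0r.
rewrite /cg mul_col_mx r1M r2M tr_col_mx mul_col_row /r1 /r2 !tr_row_mx !mul_row_col.
rewrite ?trmx1 ?trmx0 ?tr_scalar_mx ?mulmx0 ?mulmx1 ?mul0mx ?addr0 ?add0r -?scalar_mxM -?raddfD /=.
rewrite -[RHS](block_mx0 _ 1 1 1 1); congr block_mx => //; rewrite -[RHS](raddf0 (@scalar_mx _ 1)); congr (_%:M); last by ring.
transitivity (- (c0 * (q2 * 2%:R))); first by ring.
by rewrite two mulr0 oppr0.
Qed.

Lemma coord_e0_based p r (S : asp (1 + (1 + p))) a u : u != 0 -> bl a u 0 \in S.2 -> based r S ->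
  exists2 P : 'M[K]_(1 + p), P \in unitmx &
    bl a (e0 K p) 0 \in (compr (emb P) S).2 /\ based r (compr (emb P) S).
Proof.
move=> u0 uS [A AS rA]; have [P uP eS] := coord_e0 u0 uS.
exists P => //; split=> //; exists (cg P A); last by rewrite rank_unit.
by have := comp_ain (emb P) AS; rewrite emb_bl mul0mx.
Qed.

(** Choose the first basis vector in the radical of a matrix of maximal rank. *)
Lemma full_rank_coord m r (S : asp (1 + m)) : bounded r S -> (r <= m)%N ->
  (exists2 M, ain S M & \rank M = r) -> exists2 P, P \in unitmx & based r (compr P S).
Proof.
move=> bS rm [M MS rM]; have le : (\rank M <= m)%N by rewrite rM.
have [P uP [A E]] := kernel_coord (bounded_sym bS MS) le.
exists P => //; exists A; first by rewrite -E; apply: comp_ain.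
rewrite -rM -(rank_unit M uP) E -[in RHS](mul0mx 1 A) rank_bl.
  by rewrite /ql !mul0mx mxE eqxx.
by apply: (@bl_sym _ _ 0 0); rewrite -E cgT (bounded_sym bS MS).
Qed.

(** The case n = r + 1. Either deleting some radical vector is faithful, and S is of
    type_S, or every radical vector carries border directions. Counting leaves border spaces
    of dimension r only, for which S is alternating, and nets of conics for r = 2. *)
Lemma corank1 p (S : asp (1 + (1 + p))) : (0 < p)%N ->
  (forall n r, (n < p.+2)%N -> (r < n)%N -> forall S' : asp n, bounded r S' -> (\dim S'.2 <= dmax n r)%N) ->
  (forall S' : asp p.+2, bounded p S' -> (\dim S'.2 <= dmax p.+2 p)%N) ->
  bounded p.+1 S -> (s1 p.+2 p.+1 <= \dim S.2)%N ->
  \dim S.2 = s1 p.+2 p.+1 /\ classified p.+1 S.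
Proof.
move=> p0 IH IHr bS dS. 
have dc : dmax p p.-1 = s1 p p.-1 by case: (p) p0 => // k _; exact: dmax_corank1.
have E1 : s1 p.+2 p.+1 = (s1 p p.-1 + p + p.+1)%N.
  rewrite (s1S _ p); congr (_ + _)%N.
  by case: (p) p0 => // k _; rewrite (s1S _ k.+1 k).
have E2 : s1 p p = (s1 p p.-1 + p)%N by case: (p) p0 => // k _; rewrite (s1S _ k.+1 k).
have small (S' : asp p) : bounded p.-1 S' -> (\dim S'.2 <= s1 p p.-1)%N.
  by rewrite -dc; apply: IH; lia.
have [P0 uP0 bP0] : exists2 P, P \in unitmx & based p.+1 (compr P S).
  apply: (full_rank_coord bS) => //; apply/not_exists2P => H.
  have bp : bounded p S.
    move=> M MS; have [sM rM] := bS _ MS; split=> //.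
    by case: (H M) => // /eqP; move: rM; rewrite leq_eqVlt => /orP [->|].
  have := IHr S bp; have := @dmax_lt_rank p.+2 p.+1 isT (ltnSn _).
  rewrite dmax_corank1 /= => l1 l2; by rewrite ltnNge (leq_trans dS l2) in l1.
have [[P [uP bP W0]]|notG] := pselect (exists P, [/\ P \in unitmx, based p.+1 (compr P S) & Wdim (compr P S) = 0%N]).
  have bS' : bounded p.+1 (compr P S) by apply: bounded_comp.
  have dE := dim_asp (compr P S); rewrite W0 add0n dim_unit // in dE.
  have bT : bounded p.+1 (compr (Dr (1 + p)) (compr P S)) by apply: bounded_comp.
  have le := dim_sym bT; rewrite -dE in le.
  have eqd : \dim S.2 = s1 p.+2 p.+1 by apply/eqP; rewrite eqn_leq dS andbT; exact: le.
  split=> //; constructor 2; exists (Dr (1 + p) *m P); split=> //.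
    by apply: row_free_mulmx; rewrite ?Dr_free // row_free_unit.
  move=> v vS; rewrite -cg_cg => E; apply: (cg_unit_inj uP); apply/eqP.
  have : cg P v \in ((compr P S).2 :&: lker (linfun (cg (Dr (1 + p)))))%VS.
    by rewrite memv_cap comp_dir // memv_ker lfunE /= E.
  by move: W0 => /eqP; rewrite dimv_eq0 => /eqP ->; rewrite memv0.
have dimP P : P \in unitmx -> \dim (compr P S).2 = \dim S.2 by apply: dim_unit.
have bC (P : 'M_(1 + (1 + p))) : bounded p.+1 (compr P S) by apply: bounded_comp.
have [exc|nexc] := pselect (\dim S.2 = s1 p.+2 p.+1 /\ exceptional K p.+2 p.+1).
  by case: exc => ? ?; split=> //; constructor 4.
have isoP P : P \in unitmx -> based p.+1 (compr P S) ->
    exists2 u, u != 0 & bl 0 u 0 \in (compr P S).2.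
  move=> uP bP; have W0 : (0 < Wdim (compr P S))%N.
    by rewrite lt0n; apply/eqP => W0; apply: notG; exists P.
  have [//|[c2 W1 [u u0 uS]]] := isotropic_dichotomy (bC P) bP W0.
  have [Q uQ [eS [A AS rA]]] := coord_e0_based u0 uS bP.
  have bS' : bounded p.+1 (compr (emb Q) (compr P S)) by apply: bounded_comp.
  have := @char2_count _ p p.+1 p.+2 _ (s1 p p) (s1 p p.-1) c2 bS' _ eS.
  rewrite Wdim_emb // W1 !subSS subn0 subn1 => H; exfalso.
  have {H} : [\/ (\dim S.2 <= p.+1 + 1 + s1 p p.-1)%N, (\dim S.2 < p.+1 + s1 p p)%N,
      (\dim S.2 < s1 p.+2 p.+1)%N | p.+1 = 2 /\ (\dim S.2 <= s1 p.+2 p.+1)%N].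
    rewrite -(dimP P uP) -(dim_unit (compr P S) (emb_unit uQ)); apply: H => //.
      by exists A => //; apply: bl_ain AS.
    by move=> S' bS''; apply: dim_sym (bounded_full bS'').
  have exc1 : p = 1%N -> (\dim S.2 <= s1 p.+2 p.+1)%N -> False.
    by move=> e1 le; apply: nexc; split; [apply/eqP; rewrite eqn_leq le dS | split; rewrite ?e1].
  case=> [le|lt|lt|[e1 le]]; lia.
have Wlow P : P \in unitmx -> based p.+1 (compr P S) ->
    [/\ (p <= Wdim (compr P S))%N, (Wdim (compr P S) <= p.+1)%N &
        Wdim (compr P S) = p -> \dim S.2 = s1 p.+2 p.+1].
  move=> uP bP; have [u u0 uS] := isoP P uP bP.
  have := @count_hyperbolic _ p p.+1 _ u (s1 p p.-1) (bC P) u0 uS.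
  rewrite dimP // !subSS subn1 => /(_ _ small) H; have {}H := H p0.
  have : (Wdim (compr P S) <= p.+1)%N.
    rewrite (Wdim_noE (bC P) (based_noE (bC P) bP)).
    by apply: leq_trans (dimvS (subvf _)) _; rewrite dimvf /dim /= mul1n.
  by split; lia.
have [[P [uP bP WP]]|notH] := pselect (exists P, [/\ P \in unitmx, based p.+1 (compr P S) & Wdim (compr P S) = p]).
  have [_ _ /(_ WP) eqd] := Wlow P uP bP; split=> //.
  have [u u0 uS] := isoP P uP bP; have [Q uQ [eS bQ]] := coord_e0_based u0 uS bP.
  have bS' : bounded p.+1 (compr (emb Q) (compr P S)) by apply: bounded_comp.
  have dS' : (s1 p.+2 p.+1 <= \dim (compr (emb Q) (compr P S)).2)%N.
    by rewrite dim_unit ?emb_unit // dimP.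
  have WQ : Wdim (compr (emb Q) (compr P S)) = p by rewrite Wdim_emb.
  have [p2|pn] := leqP 2 p; first by case: (corank1_split p2 IH bS' bQ eS WQ dS').
  have e1 : p = 1%N by lia.
  have n2 : ~ gf2 by move=> c2; apply: nexc; split=> //; split=> //; rewrite e1.
  apply: (classified_unit uP); apply: (classified_unit (emb_unit uQ)).
  move: (compr (emb Q) _) bS' bQ eS WQ dS' => S' bS' bQ eS WQ dS'.
  constructor 1; clear -n2 bS' bQ eS WQ dS' e1 small; subst p; apply: (net_type_R n2 bS' eS).
  - have nE := based_noE bS' bQ; have eU : e0 K 1 \in Usp S' by apply/(UspP _ bS'); exists 0.
    move=> a u uS; split; first by case: bQ => A AS rA; apply: corner_zero bS' AS rA n2 uS.
    have : u \in Usp S' by apply/(UspP _ bS'); exists a.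
    have -> : Usp S' = <[e0 K 1]>%VS.
      apply/esym/eqP; rewrite eqEdim -(Wdim_noE bS' nE) WQ dim_vline.
      have -> : e0 K 1 != 0.
        apply/eqP => /matrixP /(_ 0 (lshift 1 0)) /eqP.
        by rewrite /e0 row_mxEl !mxE eqxx oner_eq0.
      by rewrite andbT; apply/subvP => x /vlineP [k ->]; rewrite memvZ.
    by case/vlineP => k ->; exists k.
  - have bT : bounded 2 (compr (Dr (1 + 1)) S') by apply: bounded_comp.
    apply: (Wdim_full bT); have le := Wdim_le bT.
    have dT2 : (\dim (compr (Dr 1) (compr (Dr (1 + 1)) S')).2 <= s1 1 0)%N.
      apply: small => B BS; split; first exact: bounded_sym (bounded_comp bT) BS.
      by have := rank_drop2 bS' eS BS; lia.
    move: dS' dT2; rewrite dim_asp WQ dim_asp (_ : s1 1 0 = 0%N) // (_ : s1 3 2 = 3%N) // => dS' dT2; lia.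
  move=> A AS; have := rank_drop2 bS' eS (comp_ain (Dr 1) AS).
  by move=> le; apply/eqP; rewrite -mxrank_eq0; lia.
have Wall P : P \in unitmx -> based p.+1 (compr P S) -> Wdim (compr P S) = p.+1.
  move=> uP bP; have [l1 l2 _] := Wlow P uP bP.
  by apply/eqP; rewrite eqn_leq l2 ltn_neqAle l1 andbT eq_sym; apply/eqP => E; apply: notH; exists P.
pose S' := compr P0 S; have bS' : bounded p.+1 S' := bC P0.
have dS' : (s1 p.+2 p.+1 <= \dim S'.2)%N by rewrite dimP.
have iso a u : bl a u 0 \in S'.2 -> a = 0.
  move=> uS; case: (bP0) => A AS rA.
  have [c2|n2] := pselect gf2; last exact: corner_zero bS' AS rA n2 uS.
  case: (c2 a) => // a1; rewrite a1 in uS.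
  case: (@corank1_twist (1 + p) S' A u c2 bS' AS rA uS) => P uP.
  rewrite /S' comp_comp => bP; apply: Wall bP.
  by rewrite unitmx_mul uP.
have [eqd tA] := corank1_alt p0 IH bS' bP0 (Wall P0 uP0 bP0) iso dS'.
rewrite dimP // in eqd; split=> //; apply: (classified_unit uP0); constructor 3.
apply: tA => e1 c2; apply: nexc; split=> //; by split; rewrite ?e1.
Qed.
End CorankOne.

(** * Border directions along the radical of a matrix *)

Section Family.
Variable K : fieldType.
Local Notation asp := (asp K).
Local Notation Dr := (Dr K).
Local Notation gf2 := (two_elements K).
Variable p : nat.

Lemma row_mx_assoc2 k (z : 'M[K]_(k, p)) :
  row_mx 0 (row_mx 0 z) = row_mx (0 : 'M_(k, 2)) z :> 'M_(k, 1 + (1 + p)).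
Proof. by rewrite row_mxA castmx_id row_mx0. Qed.

(** A matrix of S with at least two radical vectors. *)
Definition deep (M1 : 'M[K]_p) : 'M[K]_(2 + p) := block_mx 0 0 0 M1.

Lemma deepE (M1 : 'M[K]_p) : bl 0 0 (bl 0 0 M1) = deep M1.
Proof.
rewrite /bl /deep !trmx0 !raddf0 !block_mxEv !row_mx0.
have -> : (0 : 'M[K]_(1 + p, 1)) = col_mx 0 0 by rewrite col_mx0.
rewrite -block_mxEh block_mxEv row_mx0 row_mx_assoc2.
by rewrite col_mxA castmx_id col_mx0.
Qed.

(** The border direction attached to the vector x of the radical of deep M1, in
    coordinates that are independent of x. *)
Definition tau (x : 'cV[K]_(2 + p)) (z : 'rV[K]_p) (q : K) : 'M[K]_(2 + p) :=
  x *m row_mx 0 z + (x *m row_mx 0 z)^T + q *: (x *m x^T).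

(** Changes of coordinates that preserve deep M1; they act transitively on the
    vectors col_mx g t with g nonzero. *)
Definition twist (G : 'M[K]_2) (T : 'M[K]_(p, 2)) : 'M[K]_(2 + p) := block_mx G 0 T 1%:M.

Lemma twist_unit G T : G \in unitmx -> twist G T \in unitmx.
Proof. by move=> uG; rewrite unitmxE det_lblock det1 mulr1 -unitmxE. Qed.

Lemma cg_twist_tau G T x z q : cg (twist G T) (tau x z q) = tau (twist G T *m x) z q.
Proof.
have E : row_mx 0 z *m (twist G T)^T = row_mx 0 z.
  rewrite /twist tr_block_mx mul_row_block !mul0mx trmx0 trmx1 mulmx0 mulmx1 !add0r.
  by [].
have E1 : cg (twist G T) (x *m row_mx 0 z) = twist G T *m x *m row_mx 0 z.
  by rewrite /cg -!mulmxA E.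
have E2 : cg (twist G T) (x *m x^T) = (twist G T *m x) *m (twist G T *m x)^T.
  by rewrite /cg trmx_mul !mulmxA.
by rewrite /tau !linearD linearZ /= -cgT E1 E2.
Qed.

Lemma cg_twist_deep G T M1 : cg (twist G T) (deep M1) = deep M1.
Proof.
rewrite /cg /twist /deep tr_block_mx !mulmx_block !trmx0 !trmx1.
by rewrite !(mulmx0, mul0mx, mul1mx, mulmx1, add0r, addr0).
Qed.

Definition x0 : 'cV[K]_(2 + p) := col_mx (delta_mx 0 0) 0.

Lemma delta2 : delta_mx 0 0 = col_mx 1%:M 0 :> 'cV[K]_(1 + 1).
Proof.
apply/matrixP => i j; rewrite mxE ord1 andbT mxE.
by case: splitP => k Ek; rewrite mxE -val_eqE /= Ek ?(ord1 k).
Qed.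

Lemma bl_col m a (v : 'rV[K]_m) (x : 'cV_(1 + m)) (w : 'rV_(1 + m)) :
  x = col_mx 1%:M 0 -> w = row_mx 0 v -> x *m w + (x *m w)^T + a *: (x *m x^T) = bl a v 0.
Proof.
move=> -> ->; rewrite tr_col_mx trmx1 trmx0 !mul_col_row.
rewrite !(mulmx0, mul0mx, mul1mx, mulmx1) tr_block_mx !trmx0 scale_block_mx !scaler0.
by rewrite !add_block_mx !add0r !addr0 scalemx1.
Qed.

Lemma bl_tau a z : bl a (row_mx 0 z : 'rV_(1 + p)) 0 = tau x0 z a.
Proof.
have Ex : x0 = col_mx 1%:M 0 :> 'cV_(1 + (1 + p)).
  have -> : (0 : 'cV[K]_(1 + p)) = col_mx 0 0 by rewrite col_mx0.
  by rewrite col_mxA castmx_id /x0 delta2.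
symmetry; apply: (@bl_col (1 + p) a (row_mx 0 z) x0 (row_mx (0 : 'M_(1, 2)) z) Ex).
by rewrite -row_mx_assoc2.
Qed.

Lemma diag2_sum (q q' : K) :
  q *: (col_mx 1%:M 0 *m (col_mx 1%:M 0)^T) + q' *: (col_mx 0 1%:M *m (col_mx 0 1%:M)^T)
  = block_mx q%:M 0 0 q'%:M :> 'M_(1 + 1).
Proof.
rewrite !tr_col_mx !trmx1 !trmx0 !mul_col_row !(mulmx0, mul0mx, mulmx1).
by rewrite !scale_block_mx !add_block_mx !scaler0 !(add0r, addr0) !scalemx1.
Qed.

Lemma col2_sum m (z z' : 'rV[K]_m) :
  (col_mx 1%:M 0 : 'cV_(1 + 1)) *m z + col_mx 0 1%:M *m z' = col_mx z z'.
Proof. by rewrite !mul_col_mx !mul1mx !mul0mx add_col_mx add0r addr0. Qed.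

Lemma first_col (g : 'cV[K]_2) : g != 0 -> exists2 G : 'M[K]_2, G \in unitmx & G *m delta_mx 0 0 = g.
Proof.
move=> g0; have gt0 : (g^T : 'rV_(1 + 1)) != 0 by rewrite trmx_eq0.
have [R uR E] := row_to_e0 gt0; exists (invmx R)^T; first by rewrite unitmx_tr unitmx_inv.
apply: trmx_inj; rewrite trmx_mul trmxK trmx_delta.
have -> : delta_mx 0 0 = e0 K 1 :> 'rV_2.
  apply/rowP => j; rewrite /e0 !mxE /=; case: splitP => k Ek; rewrite !mxE -val_eqE /= Ek ?(ord1 k) //.
by rewrite -E mulmxK.
Qed.

Variables (r : nat) (S : asp (1 + (1 + p))) (M1 : 'M[K]_p).
Hypotheses (bS : bounded r S) (MS : ain S (deep M1)) (rM : \rank M1 = r).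

Let sM1 : M1^T = M1.
Proof.
have := bounded_sym bS MS; rewrite -deepE => /(@bl_sym _ _ _ _) /(@bl_sym _ _ _ _).
by [].
Qed.

(** The border directions at x: k independent rows X *m M1, with the corners forced by
    the rank. For k = 1 the row is moreover taken isotropic. *)
Definition zfam k (x : 'cV[K]_(2 + p)) (X : 'M[K]_(k, p)) : Prop :=
  [/\ row_free (X *m M1),
      forall c : 'rV_k, tau x (c *m X *m M1) (ql (c *m X) M1 (c *m X)) \in S.2
    & k = 1%N -> X *m M1 *m X^T = 0].

Lemma ql_deep (v : 'rV[K]_p) : row_mx 0 v *m bl 0 0 M1 = row_mx 0 (v *m M1) /\
  ql (row_mx 0 v) (bl 0 0 M1) (row_mx 0 v) = ql v M1 v.
Proof.
have E : row_mx 0 v *m bl 0 0 M1 = row_mx 0 (v *m M1).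
  by rewrite /bl mul_row_block !mul0mx trmx0 mulmx0 !add0r.
split=> //; rewrite (ql_mul _ E) tr_row_mx mul_row_col mul0mx add0r.
by [].
Qed.

(** Transport x to the first basis vector by a twist; border rows lie in the row space
    of the matrix, and their corner is given by corner_value. *)
Lemma zfam_exists k (g : 'cV[K]_2) (t : 'cV[K]_p) : g != 0 ->
  (forall P, P \in unitmx -> based r (compr P S) ->
      (k <= Wdim (compr P S))%N /\ exists2 u, u != 0 & bl 0 u 0 \in (compr P S).2) ->
  exists X : 'M[K]_(k, p), zfam (col_mx g t) X.
Proof.
move=> g0 H; have [G uG EG] := first_col g0.
pose h := twist G (row_mx t (0 : 'cV_p)).
have uh : h \in unitmx by apply: twist_unit.
have hx : h *m x0 = col_mx g t.
  rewrite /h /twist /x0 mul_block_col EG mul0mx addr0 mulmx0 addr0; congr col_mx.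
  by rewrite delta2 (@mul_row_col K p 1 1 1) mulmx1 mulmx0 addr0.
pose S' : asp (1 + (1 + p)) := compr (invmx h) S.
have bS' : bounded r S' by apply: bounded_comp.
have MS' : ain S' (bl 0 0 (bl 0 0 M1)).
  have := comp_ain (invmx h) MS; rewrite deepE -{1}(cg_twist_deep G (row_mx t (0 : 'cV_p))).
  by rewrite cg_cg mulVmx // cg1.
have rA : \rank (bl 0 0 M1) = r.
  rewrite -(mul0mx 1 M1) rank_bl // /ql !mul0mx mxE eqxx rM.
  by [].
have uh' : invmx h \in unitmx by rewrite unitmx_inv.
have bas : based r S' by exists (bl 0 0 M1).
have [kW [u1 u10 u1S]] := H _ uh' bas.
have dU : (k <= \dim (Usp S'))%N by rewrite -(Wdim_noE bS' (based_noE bS' bas)).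
have inA (u : 'rV_(1 + p)) : u \in Usp S' -> exists v, u = row_mx 0 (v *m M1).
  move=> /(UspP _ bS') [a uS].
  have /submxP [w ->] : (u <= bl 0 0 M1)%MS.
    by apply: border_dir_in bS' uS (bl_ain MS') _; rewrite rA leq_addr.
  exists (rsubmx w); rewrite -{1}[w]hsubmxK /bl mul_row_block raddf0 mulmx0 trmx0 mulmx0 mulmx0 !add0r.
  by [].
have [X0 [fX0 X0U iX0]] : exists X0 : 'M[K]_(k, 1 + p), [/\ row_free X0,
    (forall c : 'rV_k, c *m X0 \in Usp S') & k = 1%N -> forall c : 'rV_k, bl 0 (c *m X0) 0 \in S'.2].
  have [k1|kn1] := eqVneq k 1%N.
    subst k; exists u1; split.
    - by rewrite /row_free rank_rV u10.
    - move=> c; rewrite [c]mx11_scalar mul_scalar_mx memvZ //.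
      by apply/(UspP _ bS'); exists 0.
    move=> _ c; rewrite [c]mx11_scalar mul_scalar_mx.
    by rewrite (_ : bl _ _ _ = c 0 0 *: bl 0 u1 0) ?memvZ // blZ mulr0 scaler0.
  have [X fX UX] := vspace_rows (Usp S').
  have eX : (k <= \rank X)%N by rewrite (eqnP fX).
  exists (pid_mx k *m X); split.
  - rewrite /row_free mxrankMfree // rank_pid_mx //.
  - by move=> c; rewrite UX mulmxA submxMl.
  by move=> e1; case/eqP: kn1.
have [X EX] : exists X : 'M[K]_(k, p), X0 = row_mx 0 (X *m M1).
  have rowsX i : exists v, row i X0 = row_mx 0 (v *m M1).
    by apply: inA; rewrite rowE; apply: X0U.
  have [f Hf] := choice rowsX; exists (\matrix_i f i).
  by apply/row_matrixP => i; rewrite row_row_mx row0 row_mul rowK.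
subst X0; have frX : row_free (X *m M1).
  have E : \rank (row_mx 0 (X *m M1) : 'M_(k, 1 + p)) = \rank (X *m M1).
    by rewrite -(mxrankMfree (X *m M1) (Dr_free K p)) /Dr mul_mx_row mulmx0 mulmx1.
  by move: fX0; rewrite /row_free E.
have tauS c : tau (col_mx g t) (c *m X *m M1) (ql (c *m X) M1 (c *m X)) \in S.2.
  have /(UspP _ bS') [a aS] := X0U c.
  have [E1 E2] := ql_deep (c *m X).
  rewrite mul_mx_row mulmx0 mulmxA -E1 in aS.
  have Ea := corner_value bS' MS' rA aS; rewrite E2 in Ea.
  have [v vS Ev] := dir_comp aS.
  have -> : tau (col_mx g t) (c *m X *m M1) (ql (c *m X) M1 (c *m X)) = v.
    rewrite -hx -cg_twist_tau -Ea -bl_tau -E1 Ev cg_cg mulmxV // cg1.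
    by [].
  exact: vS.
exists X; split=> // k1; subst k.
have uS := iX0 erefl 1%:M; rewrite mul1mx in uS.
have [E1 E2] := ql_deep X; rewrite -E1 in uS.
have := corner_value bS' MS' rA uS; rewrite E2 => q0.
by rewrite qlE -q0 raddf0.
Qed.

(** Add to deep M1 one border direction at each of two independent radical vectors:
    the rank stays r only if the Schur complement vanishes, and its off-diagonal entry is
    the product of the two rows for the form M1. *)
Lemma zfam_orth k l (g g' : 'cV[K]_2) t t' (X : 'M_(k, p)) (X' : 'M_(l, p)) :
  row_mx g g' \in unitmx -> zfam (col_mx g t) X -> zfam (col_mx g' t') X' ->
  X *m M1 *m X'^T = 0.
Proof.
move=> uG [_ HX _] [_ HX' _]; apply/matrixP => i j; rewrite [RHS]mxE.
pose c : 'rV[K]_k := delta_mx 0 i; pose c' : 'rV[K]_l := delta_mx 0 j.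
have -> : (X *m M1 *m X'^T) i j = ql (c *m X) M1 (c' *m X').
  rewrite /ql trmx_mul trmx_delta !mulmxA -colE -!mulmxA -rowE !mxE.
  by apply: eq_bigr => m _; rewrite !mxE.
set v := c *m X; set v' := c' *m X'.
have NS := ainD (ainD MS (HX c)) (HX' c'); rewrite -/v -/v' in NS.
pose h := twist (row_mx g g') (row_mx t t').
have uh : h \in unitmx by apply: twist_unit.
have hE a b : h *m (col_mx (col_mx a b) 0 : 'cV[K]_(1 + 1 + p)) = a 0 0 *: col_mx g t + b 0 0 *: col_mx g' t'.
  rewrite /h /twist mul_block_col (@mul_row_col K 2 1 1 1) (@mul_row_col K p 1 1 1) mul0mx !mulmx0 !addr0.
  rewrite [a]mx11_scalar [b]mx11_scalar !mul_mx_scalar !scale_col_mx add_col_mx.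
  by rewrite -!mx11_scalar.
pose y : 'cV[K]_(1 + 1 + p) := col_mx (col_mx 1%:M 0) 0.
pose y' : 'cV[K]_(1 + 1 + p) := col_mx (col_mx 0 1%:M) 0.
have hy : h *m y = col_mx g t by rewrite hE !mxE scale1r scale0r addr0.
have hy' : h *m y' = col_mx g' t' by rewrite hE !mxE scale1r scale0r add0r.
pose q := ql v M1 v; pose q' := ql v' M1 v'.
have EN : deep M1 + tau (col_mx g t) (v *m M1) q + tau (col_mx g' t') (v' *m M1) q' =
   cg h (block_mx (block_mx q%:M 0 0 q'%:M) (col_mx v v' *m M1) (col_mx v v' *m M1)^T M1).
  rewrite -hy -hy' -!cg_twist_tau -(cg_twist_deep (row_mx g g') (row_mx t t')) -!linearD /=; congr cg.
  have tauE (Y : 'cV[K]_2) z qq : tau (col_mx Y 0) z qq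
      = block_mx (qq *: (Y *m Y^T)) (Y *m z) (Y *m z)^T 0.
    rewrite /tau tr_col_mx !mul_col_row tr_block_mx scale_block_mx !add_block_mx.
    by rewrite !(mulmx0, mul0mx, trmx0, scaler0, add0r, addr0).
  rewrite !tauE /deep !add_block_mx !(add0r, addr0).
  congr block_mx.
    exact: diag2_sum.
  - by rewrite mul_col_mx; apply: col2_sum.
  by rewrite -linearD /=; rewrite mul_col_mx; congr trmx; apply: col2_sum.
have [_ rN] := bS NS; rewrite EN rank_unit // -rM in rN.
have := @rank_block_leP K (1 + 1) p _ _ M1 sM1 rN _ erefl.
rewrite tr_col_mx mul_col_mx mul_col_row => /eq_block_mx [_ E _ _].
by have := congr1 (fun m : 'M_1 => m 0 0) E; rewrite mxE => /esym.
Qed.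
End Family.

(** * A common border direction *)

Section Step.
Variable K : fieldType.
Local Notation asp := (asp K).
Local Notation Dr := (Dr K).
Local Notation gf2 := (two_elements K).

(** Orthogonal subspaces of a form of rank r have dimensions of sum at most r, modulo the radical. *)
Lemma rank_orthogonal p k l (M : 'M[K]_p) (X : 'M_(k, p)) (Y : 'M_(l, p)) : M^T = M ->
  X *m M *m Y^T = 0 -> (\rank (X *m M) + \rank (Y *m M) <= \rank M)%N.
Proof.
move=> sM E; have := mxrank_Frobenius X M Y^T; rewrite E mxrank0 addn0.
by rewrite -(mxrank_tr (Y *m M)) trmx_mul sM.
Qed.

Lemma tau_span p (g g' : 'cV[K]_2) t1 (z : 'rV_p) (V : {vspace 'M[K]_(2 + p)}) :
  row_mx g g' \in unitmx -> tau (col_mx g t1) z 0 \in V ->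
  (forall t, tau (col_mx g' t) z 0 \in V) -> forall x, tau x z 0 \in V.
Proof.
move=> uG V1 V2 x.
have tauD x1 x2 : tau (x1 + x2) z 0 = tau x1 z 0 + tau x2 z 0.
  by rewrite /tau !scale0r !addr0 mulmxDl linearD /= addrACA.
have tauZ a x1 : tau (a *: x1) z 0 = a *: tau x1 z 0.
  by rewrite /tau !scale0r !addr0 -scalemxAl linearZ /= scalerDr.
have [h [t ->]] : exists h t, x = col_mx h t by exists (usubmx x), (dsubmx x); rewrite vsubmxK.
pose ab : 'cV[K]_(1 + 1) := invmx (row_mx g g') *m h.
have Eh : h = usubmx ab 0 0 *: g + dsubmx ab 0 0 *: g'.
  rewrite -[LHS](mulKVmx uG) -/ab -{1}[ab]vsubmxK (@mul_row_col K 2 1 1 1).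
  by rewrite {1}[usubmx ab]mx11_scalar {1}[dsubmx ab]mx11_scalar !mul_mx_scalar.
set a := usubmx ab 0 0 in Eh; set b := dsubmx ab 0 0 in Eh.
have -> : col_mx h t = a *: col_mx g t1 + (b *: col_mx g' 0 + (col_mx g' (t - a *: t1) + (-1) *: col_mx g' 0)).
  rewrite Eh !scale_col_mx !add_col_mx; congr col_mx.
    by rewrite scaleN1r subrr addr0.
  by rewrite !scaler0 addr0 add0r addrC subrK.
rewrite !tauD !tauZ; exact: memvD (memvZ _ V1) (memvD (memvZ _ (V2 _)) (memvD (V2 _) (memvZ _ (V2 _)))).
Qed.

Lemma common_isotropic p k l (M : 'M[K]_p) (X : 'M[K]_(k, p)) (Y : 'M_(l, p)) (c : 'rV_k) (c' : 'rV_l) : M^T = M ->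
  X *m M *m Y^T = 0 -> c *m X *m M = c' *m Y *m M -> ql (c *m X) M (c *m X) = 0 :> K.
Proof.
move=> sM XY E; rewrite /ql E trmx_mul !mulmxA -!(mulmxA c').
have -> : Y *m M *m X^T = 0 by apply: trmx_inj; rewrite !trmx_mul trmxK sM mulmxA XY trmx0.
by rewrite !(mul0mx, mulmx0) mxE.
Qed.
(** Symmetric matrices with zero lower right block. *)
Lemma isotropic_dim s k (V : {vspace 'M[K]_(s + k)}) :
  (forall v, v \in V -> v^T = v /\ drsubmx v = 0) -> (\dim V <= s1 s s + s * k)%N.
Proof.
move=> HV; pose f : 'M[K]_(s + k) -> 'M[K]_(s, k) := ursubmx.
have lf : linear f by move=> a u v; apply/matrixP => i j; rewrite !mxE.
pose F := GRing.isLinear.Build K _ _ _ f lf.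
pose fl : {linear 'M[K]_(s + k) -> 'M[K]_(s, k)} := HB.pack f F.
rewrite -(limg_ker_dim (linfun fl) V); apply: leq_add; last first.
  by apply: leq_trans (dimvS (subvf _)) _; rewrite dimvf /dim /=.
set W := (V :&: _)%VS; pose Q : 'M[K]_(s, s + k) := row_mx 1%:M 0.
have EQ v : v \in W -> v = block_mx (cg Q v) 0 0 0.
  rewrite memv_cap memv_ker lfunE => /andP [/HV [sv d0] /eqP u0].
  have {}u0 : ursubmx v = 0 := u0.
  have Ed : dlsubmx v = 0 by rewrite -sv -trmx_ursub u0 trmx0.
  rewrite -{1}[v]submxK u0 Ed d0; congr block_mx.
  rewrite /cg /Q -{2}[v]submxK mul_row_block tr_row_mx mul_row_col trmx1 trmx0.
  by rewrite !(mulmx0, mul0mx, mul1mx, mulmx1, addr0).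
rewrite -(@dim_comp_inj _ _ _ Q (0, W)); last by move=> v /EQ E E0; rewrite E E0 block_mx0.
apply: (@dim_sym K s) => M; rewrite {1}/ain /= linear0 subr0 => /(@dir_comp _ _ _ _ (0, W)) [v vW ->].
split; last exact: rank_leq_row.
by rewrite cgT; have := vW; rewrite memv_cap => /andP [/HV [-> _] _].
Qed.

Lemma row_free_of_rank m n s (A : 'M[K]_(m, n)) : \rank A = s ->
  exists2 C : 'M[K]_(s, n), row_free C & (C :=: A)%MS.
Proof. by move=> <-; exists (row_base A); [exact: row_base_free | exact: eq_row_base]. Qed.

Lemma row_free_complete s k (Q : 'M[K]_(k, s + k)) : row_free Q ->
  exists C : 'M[K]_(s, s + k), col_mx C Q \in unitmx.
Proof.
move=> fQ; have rQ : \rank Q^C%MS = s by rewrite mxrank_compl (eqnP fQ) addnK.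
have [C fC EC] := row_free_of_rank rQ; exists C.
rewrite -row_full_unit /row_full -addsmxE addsmxC (adds_eqmx (eqmx_refl Q) EC).
exact: addsmx_compl_full.
Qed.

Lemma bounded0_dir n (S : asp n) v : bounded 0 S -> v \in S.2 -> v = 0.
Proof.
move=> bS vS; have z M : ain S M -> M = 0.
  by move=> /bS [_]; rewrite leqn0 mxrank_eq0 => /eqP.
have := z _ (ainD (ain_base S) vS); rewrite (z _ (ain_base S)) add0r.
by [].
Qed.

Lemma dim_bounded01 o n (S : asp n) : (o <= 1)%N -> bounded o S -> (\dim S.2 <= o)%N.
Proof.
case: o => [_ bS|[_ bS|//]].
  rewrite leqn0 dimv_eq0 -subv0; apply/subvP => v /(bounded0_dir bS) ->.
  exact: mem0v.
by have [->//|d0] := posnP (\dim S.2); have [-> _] := rank1_asp bS d0.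
Qed.

Lemma cg_col_dr s k n (C : 'M[K]_(s, n)) (Q : 'M_(k, n)) M :
  drsubmx (cg (col_mx C Q) M) = cg Q M.
Proof. by rewrite /cg mul_col_mx tr_col_mx mul_col_row block_mxKdr. Qed.

Lemma type_R_coords s k r (S : asp (s + k)) : s = r./2 -> type_R r S ->
  exists2 P, P \in unitmx & forall M, ain (compr P S) M -> (\rank (drsubmx M) <= odd r)%N.
Proof.
move=> Es [k' [Q [E fQ HQ]]]; have Ek : k' = k by lia.
subst k'; have [C uP] := row_free_complete fQ; exists (col_mx C Q) => // M /ain_comp [N NS ->].
by rewrite cg_col_dr HQ.
Qed.

Lemma drsubE s k (M : 'M[K]_(s + k)) : cg (row_mx 0 1%:M) M = drsubmx M.
Proof.
rewrite /cg -{1}[M]submxK mul_row_block tr_row_mx trmx0 trmx1 mul_row_col.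
by rewrite !(mulmx0, mul0mx, mul1mx, mulmx1, add0r).
Qed.

Lemma half_bounded_dim s k o r (S : asp (s + k)) : bounded r S -> (o <= 1)%N ->
  (forall M, ain S M -> (\rank (drsubmx M) <= o)%N) -> (\dim S.2 <= s1 s s + s * k + o)%N.
Proof.
move=> bS o1 H; pose Q : 'M[K]_(k, s + k) := row_mx 0 1%:M.
rewrite (dim_comp Q); apply: leq_add.
  apply: isotropic_dim => v; rewrite memv_cap memv_ker lfunE => /andP [vS /eqP E].
  by split; [exact: bounded_dirT bS vS | rewrite -drsubE].
apply: dim_bounded01 => // M /ain_comp [N NS ->]; rewrite cgT (bounded_sym bS NS) drsubE.
by split=> //; apply: H.
Qed.

Lemma type_R_dim n r (S : asp n) : bounded r S -> (r < n)%N -> type_R r S ->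
  (\dim S.2 <= s2 n r)%N.
Proof.
move=> bS rn tR; have [k E] : exists k, n = (r./2 + k)%N by exists (n - r./2)%N; lia.
subst n; have [P uP HP] := type_R_coords erefl tR.
rewrite -(dim_unit S uP); have := half_bounded_dim (bounded_comp bS) (leq_b1 _) HP.
by rewrite /s2 /s1 addKn; case: (odd r); rewrite ?addn0.
Qed.

Lemma rank_lt_out m (A : 'M[K]_m) : (\rank A < m)%N -> exists u : 'rV_m, ~~ (u <= A)%MS.
Proof.
move=> rA; apply/not_existsP => H.
have : (1%:M <= A)%MS by apply/row_subP => i; apply/negPn/negP => /(H _).
by move=> /mxrankS; rewrite mxrank1 leqNgt rA.
Qed.

(** In coordinates where row_mx 0 (row_mx 0 z) is the first basis vector, the
    directions tau x z 0 are all the borders with corner zero. *)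
Lemma tau_border p (S : asp (1 + (1 + p))) (z : 'rV_p) : z != 0 ->
  (forall x, tau x z 0 \in S.2) ->
  exists2 P, P \in unitmx & forall u, bl 0 u 0 \in (compr P S).2.
Proof.
move=> z0 H; pose y : 'rV[K]_(1 + (1 + p)) := row_mx 0 (row_mx 0 z).
have y0 : y != 0.
  apply: contraNneq z0; rewrite /y -(row_mx0 K 1 1 (1 + p)) => /eq_row_mx [_].
  by rewrite -(row_mx0 K 1 1 p) => /eq_row_mx [_ ->].
have [R uR ER] := row_to_e0 y0; exists R^T; first by rewrite unitmx_tr.
move=> u; pose x : 'cV[K]_(1 + (1 + p)) := invmx R^T *m (row_mx 0 u)^T.
have Ex : R^T *m x = (row_mx 0 u)^T by rewrite /x mulKVmx ?unitmx_tr.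
have Et : tau x z 0 = x *m y + (x *m y)^T by rewrite /tau scale0r addr0 /y row_mx_assoc2.
have E1 : cg R^T (x *m y) = (row_mx 0 u)^T *m e0 K (1 + p).
  by rewrite -Ex -ER /cg trmxK !mulmxA.
have <- : cg R^T (tau x z 0) = bl 0 u 0; last by apply: comp_dir.
have E2 : (row_mx (0 : 'M_1) u)^T *m e0 K (1 + p) = ((e0 K (1 + p))^T *m row_mx 0 u)^T.
  by rewrite trmx_mul trmxK.
rewrite Et linearD /= -cgT E1 E2 trmxK addrC.
rewrite -[LHS]addr0 -(scale0r ((e0 K (1 + p))^T *m (e0 K (1 + p))^T^T)).
apply: bl_col; last by [].
by rewrite /e0 tr_row_mx trmx1 trmx0.
Qed.

(** If all borders are available, one of them lies outside the row space of A. *)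
Lemma full_border m r (S : asp (1 + m)) : bounded r S -> (r < m)%N ->
  (forall u, bl 0 u 0 \in S.2) -> bounded (r - 2) (compr (Dr m) S).
Proof.
move=> bS rm H A AS; have [d [c dcS]] := ain_blP bS AS.
have [sA rA] := bounded_comp bS AS; split=> //.
have [u uA] := rank_lt_out (leq_ltn_trans rA rm).
have inS := ainD dcS (H (u - c)); rewrite blD !addr0 addrC subrK in inS.
by have [_ le] := bS _ inS; have := rank_bl_out d sA uA; lia.
Qed.

Lemma zfam_ql p k l (S : asp (1 + (1 + p))) M1 x (X : 'M_(k, p)) (z : 'rV_p) (Y : 'M_(l, p)) :
  M1^T = M1 -> zfam S M1 x X -> (z <= X *m M1)%MS -> (z <= Y *m M1)%MS -> X *m M1 *m Y^T = 0 ->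
  tau x z 0 \in S.2.
Proof.
move=> sM [_ HX _] /submxP [c Ec] /submxP [c' Ec'] XY.
rewrite !mulmxA in Ec Ec'; have := HX c; rewrite -Ec.
by rewrite (common_isotropic sM XY (etrans (esym Ec) Ec')).
Qed.

(** A border row z common to all radical vectors. Border spaces at independent
    radical vectors are orthogonal. If those of the first two classes all agree, any of
    their rows will do. Otherwise r = 2 s + 1 and the orthogonal of their sum is the border
    space at all vectors of the third class; a row in the intersection of the first two is
    then found, unless s = 1, when two isotropic orthogonal lines would not fit in rank three. *)
Lemma common_direction s p r (S : asp (1 + (1 + p))) M1 : bounded r S -> ain S (deep M1) ->
  \rank M1 = r -> (0 < s)%N -> (r <= s.*2.+1)%N ->
  (forall g t, g != 0 -> exists X : 'M_(s, p), zfam S M1 (col_mx g t) X) ->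
  exists2 z, z != 0 & forall x, tau x z 0 \in S.2.
Proof.
move=> bS MS rM s0 rs F; have sM : M1^T = M1.
  by have := bounded_sym bS MS; rewrite -deepE => /(@bl_sym _ _ _ _) /(@bl_sym _ _ _ _).
pose gA : 'cV[K]_(1 + 1) := col_mx 1%:M 0; pose gB : 'cV[K]_(1 + 1) := col_mx 0 1%:M.
pose gC : 'cV[K]_(1 + 1) := col_mx 1%:M 1%:M.
have one0 : (1%:M : 'M[K]_1) != 0 by rewrite mx11_eq0 oner_eq0.
have gA0 : gA != 0 by apply: contraNneq one0; rewrite -(col_mx0 K 1 1 1) => /eq_col_mx [->].
have gB0 : gB != 0 by apply: contraNneq one0; rewrite -(col_mx0 K 1 1 1) => /eq_col_mx [_ ->].
have gC0 : gC != 0 by apply: contraNneq one0; rewrite -(col_mx0 K 1 1 1) => /eq_col_mx [->].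
have uAB : row_mx gA gB \in unitmx.
  by rewrite -block_mxEh unitmxE det_lblock !det1 mulr1 unitr1.
have uAC : row_mx gA gC \in unitmx.
  by rewrite -block_mxEh unitmxE det_ublock !det1 mulr1 unitr1.
have uCB : row_mx gC gB \in unitmx.
  by rewrite -block_mxEh unitmxE det_lblock !det1 mulr1 unitr1.
have orthT k l (X : 'M_(k, p)) (Y : 'M_(l, p)) : X *m M1 *m Y^T = 0 -> Y *m M1 *m X^T = 0.
  by move=> E; apply: trmx_inj; rewrite !trmx_mul trmxK sM mulmxA E trmx0.
have rX x (X : 'M_(s, p)) : zfam S M1 x X -> \rank (X *m M1) = s by case=> /eqnP.
(* Either the border spaces of the first two classes all coincide, or two of them differ. *)
have [same|] := pselect (forall t t' (X Y : 'M_(s, p)), zfam S M1 (col_mx gA t) X ->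
    zfam S M1 (col_mx gB t') Y -> (X *m M1 <= Y *m M1)%MS).
  have [X zX] := F _ 0 gA0.
  have /rowV0Pn [z zX1 z0] : X *m M1 != 0 by rewrite -mxrank_eq0 (rX _ _ zX) -lt0n.
  exists z => //; apply: (@tau_span _ gA gB 0) => // [|t].
    have [Y zY] := F _ 0 gB0.
    apply: (zfam_ql sM zX zX1 (submx_trans zX1 (same _ _ _ _ zX zY))).
    exact (zfam_orth bS MS rM uAB zX zY).
  have [Y zY] := F _ t gB0.
  apply: (zfam_ql sM zY (submx_trans zX1 (same _ _ _ _ zX zY)) zX1); apply: orthT.
  exact (zfam_orth bS MS rM uAB zX zY).
move=> /existsNP [t1] /existsNP [t2] /existsNP [X] /existsNP [Y] /not_implyP [zX] /not_implyP [zY] nXY.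
have XY := zfam_orth bS MS rM uAB zX zY.
have rC : (s < \rank (col_mx X Y *m M1))%N.
  rewrite mul_col_mx -addsmxE ltnNge; apply/negP => le.
  have YC : (Y *m M1 <= X *m M1 + Y *m M1)%MS := addsmxSr _ _.
  apply: nXY; apply: (submx_trans (addsmxSl (X *m M1) (Y *m M1))).
  rewrite -(mxrank_leqif_sup YC) eqn_leq mxrankS //.
  by rewrite (rX _ _ zY).
have third t (W : 'M_(s, p)) : zfam S M1 (col_mx gC t) W -> W *m M1 *m (col_mx X Y)^T = 0.
  move=> zW; rewrite tr_col_mx mul_mx_row (zfam_orth bS MS rM uCB zW zY).
  by rewrite (orthT _ _ _ _ (zfam_orth bS MS rM uAC zX zW)) row_mx0.
have rS : (\rank (col_mx X Y *m M1) = s.+1 /\ r = s.*2.+1)%N.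
  have [W zW] := F _ 0 gC0; have := rank_orthogonal sM (third _ _ zW).
  rewrite (rX _ _ zW) rM; lia.
have [s1|s1] := leqP s 1%N.
  have e1 : s = 1%N by lia.
  have := rank_orthogonal sM (_ : col_mx X Y *m M1 *m (col_mx X Y)^T = 0).
  rewrite rS.1 rM => H; suff : (s.+1 + s.+1 <= r)%N by lia.
  apply: H; case: zX zY => _ _ /(_ e1) XX [_ _ /(_ e1) YY].
  by rewrite tr_col_mx mul_col_mx mul_col_row XX YY XY (orthT _ _ _ _ XY) block_mx0.
have /rowV0Pn [z zXY z0] : (X *m M1 :&: Y *m M1)%MS != 0.
  rewrite -mxrank_eq0 -lt0n; have := mxrank_sum_cap (X *m M1) (Y *m M1).
  rewrite (rX _ _ zX) (rX _ _ zY) addsmxE -mul_col_mx rS.1; lia.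
rewrite sub_capmx in zXY; have /andP [zX1 zY1] := zXY.
have zW1 t (W : 'M_(s, p)) : zfam S M1 (col_mx gC t) W -> (z <= W *m M1)%MS.
  move=> zW; have /submxP [c Ec] := zX1; have /submxP [c' Ec'] := zY1.
  rewrite !mulmxA in Ec Ec'.
  have : col_mx W (c *m X) *m M1 *m (col_mx X Y)^T = 0.
    rewrite !mul_col_mx (third _ _ zW) tr_col_mx mul_mx_row.
    have -> : c *m X *m M1 *m Y^T = 0 by rewrite -!(mulmxA c) XY mulmx0.
    have -> : c *m X *m M1 *m X^T = 0.
      by rewrite -Ec Ec' -!(mulmxA c') (orthT _ _ _ _ XY) mulmx0.
    by rewrite row_mx0 col_mx0.
  move/(rank_orthogonal sM); rewrite rS.1 rM rS.2 mul_col_mx -Ec -addsmxE => le.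
  apply: (submx_trans (addsmxSr (W *m M1) z)).
  rewrite -(mxrank_leqif_sup (addsmxSl _ _)) eqn_leq mxrankS ?addsmxSl //.
  by rewrite (rX _ _ zW); lia.
exists z => //; apply: (@tau_span _ gA gC t1) => // [|t].
  exact: zfam_ql sM zX zX1 zY1 XY.
have [W zW] := F _ t gC0.
apply: (zfam_ql sM zW (zW1 _ _ zW) zX1); apply: orthT.
exact (zfam_orth bS MS rM uAC zX zW).
Qed.
End Step.

(** * The inductive step in corank at least two *)

Section LargeCorank.
Variable K : fieldType.
Local Notation asp := (asp K).
Local Notation Dr := (Dr K).
Local Notation gf2 := (two_elements K).

Section Induction.
Variables (p r : nat).
Hypotheses (r1 : (1 < r)%N) (rp : (r <= p)%N).
Hypothesis IH : forall m q (S : asp m), (q < m)%N -> (m < p.+2)%N -> bounded q S ->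
  (\dim S.2 <= dmax m q)%N /\ (\dim S.2 = dmax m q -> (1 < q)%N -> classified q S).

Let e := (p - r)%N.
Let Ep : (r + e = p)%N. Proof. by rewrite subnKC. Qed.

(** The anisotropic alternative is excluded by char2_count, since dim S is too large. *)
Lemma step_isotropic (S : asp (1 + (1 + p))) : bounded r S -> (dmax p.+2 r <= \dim S.2)%N ->
  based r S -> (0 < Wdim S)%N ->
  (exists2 u, u != 0 & bl 0 u 0 \in S.2) /\ (\dim S.2 <= Wdim S + p.+1 + dmax p (r - 2))%N.
Proof.
move=> bS dS bas W0.
have I1 (S' : asp p) : bounded (r - 1) S' -> (\dim S'.2 <= dmax p (r - 1))%N.
  by move=> b; have [] := IH _ _ b; lia.
have I2 (S' : asp p) : bounded (r - 2) S' -> (\dim S'.2 <= dmax p (r - 2))%N.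
  by move=> b; have [] := IH _ _ b; lia.
have N2 := dmax_step2 e r1; rewrite Ep in N2.
have [[u u0 uS]|[g2 W1 [u u0 uS]]] := isotropic_dichotomy bS bas W0.
  by split; [exists u | exact: count_hyperbolic bS u0 uS r1 I2].
exfalso; have [P uP [eS bas']] := coord_e0_based u0 uS bas.
have uE := emb_unit uP.
have [A AS rA] := bas'.
have := @char2_count K p r p.+2 (compr (emb P) S) _ _ g2 (bounded_comp bS) r1 eS.
rewrite (Wdim_emb _ uP) W1 (dim_unit _ uE) => /(_ _ _ erefl) H.
have {H} := H _ _ _ I1 I2; case.
- by exists A => //; apply: bl_ain AS.
- lia.
- by have := dmax_step1 e r1; rewrite Ep -subn1; lia.
- by have := leq_maxl (s1 p.+2 r) (s2 p.+2 r); rewrite -/(dmax _ _); lia.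
case=> r2 le2; have d3 : dmax p.+2 2 = p.+2 by rewrite dmax_rank2 //; lia.
have p2 : (2 <= p)%N by rewrite -r2.
have e3 : s1 p.+2 2 = 3%N by [].
by have := leq_trans dS le2; rewrite r2 d3 e3; lia.
Qed.

(** Deleting the radical vector is faithful, so the induction hypothesis in size
    n.-1 applies with equality; type_R is excluded because s2 increases with n. *)
Lemma step_faithful (S : asp (1 + (1 + p))) : bounded r S -> (dmax p.+2 r <= \dim S.2)%N ->
  Wdim S = 0%N -> \dim S.2 = dmax p.+2 r /\ classified r S.
Proof.
move=> bS dS W0; pose T := compr (Dr (1 + p)) S.
have dT : \dim T.2 = \dim S.2 by rewrite [RHS]dim_asp W0.
have bT : bounded r T := bounded_comp bS.
have rp1 : (r < 1 + p)%N by lia.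
have [le cl] := IH rp1 (ltnSn _) bT.
have le' : (dmax p.+1 r <= dmax p.+2 r)%N by apply: dmax_leS; lia.
have E1 : \dim T.2 = dmax (1 + p) r.
  by apply/eqP; rewrite eqn_leq le dT (leq_trans le' dS).
have E2 : \dim S.2 = dmax p.+2 r.
  by apply/eqP; rewrite eqn_leq dS -dT E1 le'.
split=> //; have fD := Dr_free K (1 + p).
have inj v : v \in S.2 -> cg (Dr (1 + p)) v = 0 -> v = 0.
  move=> vS E; move/eqP: W0; rewrite /Wdim dimv_eq0 => /eqP W0.
  apply/eqP; rewrite -memv0 -W0 memv_cap vS memv_ker lfunE /= E.
  by [].
have [tR|tS|tA|[]] := cl E1 r1.
- have := type_R_dim bT rp1 tR; have := dmax_pred e r1; rewrite Ep dT E2.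
  by move=> A /(leq_trans A); rewrite ltnn.
- by constructor 2; apply: type_S_pull fD inj tS.
- by constructor 3; apply: type_A_pull fD inj tA.
move=> p3 r2 _; have p2 : p = 2%N by case: p3.
by exfalso; move: E1; rewrite dT E2 r2 p2 !dmax_rank2.
Qed.

(** Every border space has dimension at least s = r./2. Were all of dimension s.+1,
    two orthogonal ones would not fit in rank r; hence the count is tight. A common border row
    then makes the first basis vector totally free, and induction with rank r - 2 ends the proof. *)
Lemma step_deep (S : asp (1 + (1 + p))) M1 : bounded r S -> (dmax p.+2 r <= \dim S.2)%N ->
  ain S (deep M1) -> \rank M1 = r ->
  (forall P, P \in unitmx -> based r (compr P S) -> (0 < Wdim (compr P S))%N) ->
  \dim S.2 = dmax p.+2 r /\ type_R r S.
Proof.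
move=> bS dS MS rM WP; pose s := r./2.
have s0 : (0 < s)%N by rewrite /s; lia.
have iso P : P \in unitmx -> based r (compr P S) ->
   (exists2 u, u != 0 & bl 0 u 0 \in (compr P S).2) /\
   (\dim S.2 <= Wdim (compr P S) + p.+1 + dmax p (r - 2))%N.
  move=> uP bas; rewrite -(dim_unit S uP); apply: step_isotropic (bounded_comp bS) _ bas (WP _ uP bas).
  by rewrite (dim_unit S uP).
have N2 := dmax_step2 e r1; rewrite Ep -/s in N2.
have fam k : (forall P, P \in unitmx -> based r (compr P S) -> k <= Wdim (compr P S))%N ->
    forall g t, g != 0 -> exists X : 'M_(k, p), zfam S M1 (col_mx g t) X.
  move=> H g t g0; apply: (zfam_exists bS MS rM t g0) => P uP bas; split; first exact: H.
  by have [] := iso P uP bas.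
have Ws P : P \in unitmx -> based r (compr P S) -> (s <= Wdim (compr P S))%N.
  by move=> uP bas; have [_] := iso P uP bas; lia.
have dE : \dim S.2 = dmax p.+2 r /\ (s + p.+1 + dmax p (r - 2))%N = dmax p.+2 r.
  have [[P [uP [bas WP']]]|no] := pselect (exists P, P \in unitmx /\ (based r (compr P S) /\ Wdim (compr P S) <= s)%N).
    by have [_] := iso P uP bas; lia.
  exfalso; have famS := fam s.+1 _.
  have H P : P \in unitmx -> based r (compr P S) -> (s.+1 <= Wdim (compr P S))%N.
    by move=> uP bas; rewrite ltnNge; apply/negP => W; apply: no; exists P.
  have {}famS := fam _ H.
  pose gA : 'cV[K]_(1 + 1) := col_mx 1%:M 0; pose gB : 'cV[K]_(1 + 1) := col_mx 0 1%:M.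
  have uAB : row_mx gA gB \in unitmx.
    by rewrite -block_mxEh unitmxE det_lblock !det1 mulr1 unitr1.
  have one0 : (1%:M : 'M[K]_1) != 0 by rewrite mx11_eq0 oner_eq0.
  have gA0 : gA != 0 by apply: contraNneq one0; rewrite -(col_mx0 K 1 1 1) => /eq_col_mx [->].
  have gB0 : gB != 0 by apply: contraNneq one0; rewrite -(col_mx0 K 1 1 1) => /eq_col_mx [_ ->].
  have [X zX] := famS _ 0 gA0; have [Y zY] := famS _ 0 gB0.
  have sM : M1^T = M1.
    by have := bounded_sym bS MS; rewrite -deepE => /(@bl_sym _ _ _ _) /(@bl_sym _ _ _ _).
  have := rank_orthogonal sM (zfam_orth bS MS rM uAB zX zY).
  by case: zX zY => /eqnP -> _ _ [/eqnP -> _ _]; rewrite rM /s; lia.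
split; first by case: dE.
have N3 : (s + p.+1 + dmax p (r - 2))%N = dmax p.+2 r by case: dE.
have [N4 N5] : (dmax p.+1 (r - 2) + p.+2)%N = dmax p.+2 r /\
    (3 < r -> s1 p.+1 (r - 2) < dmax p.+1 (r - 2))%N.
  by have := @dmax_step2_eq e r r1; rewrite Ep; apply.
have rs : (r <= s.*2.+1)%N by rewrite /s; lia.
have [z z0 Hz] := common_direction bS MS rM s0 rs (fam _ Ws).
have [P uP HP] := tau_border z0 Hz.
apply: (type_R_pull uP); set S' := compr P S in HP *.
have bS' : bounded r S' := bounded_comp bS.
have bT := full_border bS' (_ : (r < 1 + p)%N) HP.
have {}bT := bT (leq_ltn_trans rp (ltnSn _)); set T := compr _ S' in bT.
have dT : (dmax p.+1 (r - 2) <= \dim T.2)%N.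
  have := dim_asp S'; rewrite (dim_unit S uP) (proj1 dE) -/T -N4.
  by have := Wdim_le bS'; lia.
have tT : type_R (r - 2) T.
  have [r3|r3] := leqP r 3%N.
    exists (1 + p)%N, 1%:M; split; rewrite ?row_free_unit ?unitmx1 //; first by lia.
    move=> M /bT [_]; rewrite cg1; lia.
  have r2 : (r - 2 < 1 + p)%N by lia.
  have [le cl] := IH r2 (ltnSn _) bT.
  have ET : \dim T.2 = dmax (1 + p) (r - 2) by apply/eqP; rewrite eqn_leq le dT.
  have r21 : (1 < r - 2)%N by lia.
  case: (cl ET r21) => // [[Q [_ _ E]]|[Q [_ _ E _]]|[]]; last by lia.
    by have := N5 r3; rewrite -ET E ltnn.
  by have := N5 r3; rewrite -ET E ltnn.
have [k [Q [Ek fQ HQ]]] := tT; exists k, (Q *m Dr (1 + p)); split.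
- by lia.
- exact: row_free_mulmx fQ (Dr_free K _).
move=> M /(comp_ain (Dr (1 + p))) /HQ; rewrite cg_cg; have -> : odd (r - 2) = odd r by lia.
by [].
Qed.

Theorem step_large (S : asp (1 + (1 + p))) : bounded r S -> (dmax p.+2 r <= \dim S.2)%N ->
  (forall S' : asp p.+2, bounded r.-1 S' -> (\dim S'.2 <= dmax p.+2 r.-1)%N) ->
  \dim S.2 = dmax p.+2 r /\ classified r S.
Proof.
move=> bS dS IHr; have full : exists2 M, ain S M & \rank M = r.
  apply/not_exists2P => H.
  have b1 : bounded r.-1 S.
    move=> M MS; have [sM le] := bS _ MS; split=> //.
    by have := H M; case=> // /eqP ne; lia.
  have := leq_trans dS (IHr _ b1); have : (dmax p.+2 r.-1 < dmax p.+2 r)%N by apply: dmax_lt_rank; lia.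
  by lia.
have [P0 uP0 [A AS rA]] := full_rank_coord bS (leqW rp) full.
pose S0 := compr P0 S; have bS0 : bounded r S0 := bounded_comp bS.
have sA : A^T = A := bl_sym (bounded_sym bS0 AS).
have rAp : (\rank A <= p)%N by rewrite rA.
have [P1 uP1 [M1 EM]] := kernel_coord sA rAp.
pose P := emb P1 *m P0; have uE := emb_unit uP1.
have uP : P \in unitmx by rewrite unitmx_mul uE uP0.
have [MS rM] : ain (compr P S) (deep M1) /\ \rank M1 = r.
  split.
    have E0 : (0 : 'rV[K]_(1 + p)) *m P1^T = 0 by rewrite mul0mx.
    by have := comp_ain (emb P1) AS; rewrite emb_bl E0 EM deepE /S0 comp_comp.
  rewrite -rA -(rank_unit A uP1) EM.
  have sM1 : M1^T = M1 by apply: bl_sym (_ : _ = bl 0 0 M1); rewrite -EM cgT sA.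
  by rewrite -(mul0mx 1 M1) rank_bl // /ql !mul0mx mxE eqxx.
have [W|] := pselect (forall Q, Q \in unitmx -> based r (compr Q S) -> (0 < Wdim (compr Q S))%N);
  last first.
  move=> /existsNP [Q] /not_implyP [uQ] /not_implyP [bQ /negP]; rewrite -eqn0Ngt => /eqP WQ.
  have dQ : (dmax p.+2 r <= \dim (compr Q S).2)%N by rewrite (dim_unit S uQ).
  have [dE cl] := step_faithful (bounded_comp bS) dQ WQ; rewrite (dim_unit S uQ) in dE.
  by split=> //; apply: classified_unit uQ cl.
have dP := dim_unit S uP.
have [||] := @step_deep (compr P S) M1 (bounded_comp bS) _ MS rM; rewrite ?dP //.
  move=> Q uQ; rewrite comp_comp => bQ; apply: W bQ; by rewrite unitmx_mul uQ.
by move=> -> tR; split=> //; constructor 1; apply: type_R_pull uP tR.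
Qed.
End Induction.
End LargeCorank.

(** * The classification *)

Section Main.
Variable K : fieldType.
Local Notation asp := (asp K).

(** Induction on n, and on r for n fixed: the bound for r.-1 provides matrices of rank r. *)
Theorem dim_bound_classified n r (S : asp n) : (r < n)%N -> bounded r S ->
  (\dim S.2 <= dmax n r)%N /\ (\dim S.2 = dmax n r -> (1 < r)%N -> classified r S).
Proof.
have [N] := ubnP n; elim: N n r S => // N IHN n r S; rewrite ltnS => nN.
elim: r S => [|r IHr] S rn bS.
  by rewrite dmax_rank0 dim_bounded01.
have [r0|r0] := posnP r.
  by subst r; rewrite dmax_rank1 // dim_bounded01.
suff H : (dmax n r.+1 <= \dim S.2)%N -> \dim S.2 = dmax n r.+1 /\ classified r.+1 S.
  have [le|lt] := leqP (dmax n r.+1) (\dim S.2).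
    by have [E cl] := H le; rewrite E leqnn.
  by split=> [|E]; [exact: ltnW | move: lt; rewrite E ltnn].
have [p En] : exists p, n = p.+2 by exists n.-2; lia.
subst n.
have IH m q (S' : asp m) : (q < m)%N -> (m < p.+2)%N -> bounded q S' ->
  (\dim S'.2 <= dmax m q)%N /\ (\dim S'.2 = dmax m q -> (1 < q)%N -> classified q S').
  by move=> qm mp; apply: IHN => //; apply: leq_trans mp nN.
have IHr' (S' : asp p.+2) : bounded r S' -> (\dim S'.2 <= dmax p.+2 r)%N.
  by move=> b; have [] := IHr S' (ltnW rn) b.
move=> dS; have [rp|rp] := leqP r.+1 p.
  by apply: step_large => //; rewrite ltnS.
have Er : r = p by move: rn rp; rewrite !ltnS => a b; apply/eqP; rewrite eqn_leq a b.
subst r; rewrite dmax_corank1 in dS *; apply: corank1 => //.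
by move=> m q mp qm S' b; have [] := IH m q S' qm mp b.
Qed.
End Main.

(** * Local maps of symmetric and alternating matrices *)

Section LocalMaps.
Variable K : fieldType.
Local Notation asp := (asp K).
Local Notation Dr := (Dr K).
Local Notation gf2 := (two_elements K).

(** A radical vector of the restricted form that is not radical for the bordered one
    puts the border outside the row space. *)
Lemma kernel_gap n k (Q : 'M[K]_(k, n)) (c : 'rV_n) (u : 'rV_k) M : M^T = M ->
  u *m cg Q M = 0 -> u *m (Q *m M *m c^T) != 0 -> (\rank (cg Q M) + 2 <= \rank M)%N.
Proof.
move=> sM uA ne; have sA : (cg Q M)^T = cg Q M by rewrite cgT sM.
apply: leq_trans (cg_rank (col_mx c Q) M).
have -> : cg (col_mx c Q) M = block_mx (cg c M) (c *m M *m Q^T) (c *m M *m Q^T)^T (cg Q M).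
  by rewrite /cg mul_col_mx tr_col_mx mul_col_row !trmx_mul trmxK sM mulmxA.
apply: rank_border => //; apply: contra ne => /submxP [x Ex].
apply/eqP; apply: trmx_inj; rewrite !trmx_mul trmxK sM mulmxA Ex trmx0.
by rewrite -[_ *m _ *m _]mulmxA -[X in x *m (X *m _)]sA -trmx_mul uA trmx0 mulmx0.
Qed.

(** The directions of the affine space of those M in S for which u is radical in cg Q M. *)
Definition ker_row n k (S : asp n) (Q : 'M_(k, n)) (u : 'rV_k) : {vspace 'M[K]_n} :=
  (S.2 :&: lker (linfun (mulmx u \o cg Q)))%VS.

Lemma ker_rowP n k (S : asp n) (Q : 'M_(k, n)) u v :
  reflect (v \in S.2 /\ u *m cg Q v = 0) (v \in ker_row S Q u).
Proof.
rewrite memv_cap memv_ker lfunE /=; apply: (iffP andP) => [[-> /eqP]|[-> ->]] //.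
Qed.

Lemma ker_row_dim n k (S : asp n) (Q : 'M_(k, n)) u : (\dim S.2 <= \dim (ker_row S Q u) + k)%N.
Proof.
rewrite -(limg_ker_dim (linfun (mulmx u \o cg Q)) S.2) leq_add2l.
by apply: leq_trans (dimvS (subvf _)) _; rewrite dimvf /dim /= mul1n.
Qed.

Lemma e0_bl m a (w : 'rV[K]_m) A : e0 K m *m bl a w A = row_mx a%:M w.
Proof. by rewrite /e0 /bl mul_row_block !mul1mx !mul0mx !addr0. Qed.

Lemma e0_bl_eq0 m (B : 'M[K]_(1 + m)) : B^T = B -> e0 K m *m B = 0 -> cg (Dr m) B = 0 -> B = 0.
Proof.
move=> sB; rewrite [B](blE sB) e0_bl cg_Dr_bl -(row_mx0 K 1 1 m) => /eq_row_mx [E ->] ->.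
by have /eqP := E; rewrite mx11_eq0 => /eqP ->; rewrite bl0.
Qed.

Lemma alt_cg k n (Q : 'M[K]_(k, n)) A : 2%:R = 0 :> K -> alt A -> alt (cg Q A).
Proof.
move=> two aA; apply: ql_alt => [|v]; first by rewrite cgT (proj1 aA).
by rewrite -(alt_ql (v *m Q) aA two) /ql /cg trmx_mul !mulmxA.
Qed.

Lemma ker_row_dim_alt n m (S : asp n) (Q : 'M_(1 + m, n)) u : u != 0 -> 2%:R = 0 :> K ->
  (forall v, v \in S.2 -> alt (cg Q v)) -> (\dim S.2 <= \dim (ker_row S Q u) + m)%N.
Proof.
move=> u0 two aS; have [R uR ER] := row_to_e0 u0.
pose R' := invmx R; have EU : e0 K m *m R' = u by rewrite -ER mulmxK.
pose f := linfun (mulmxr (Dr m)^T \o (mulmxr R'^T \o (mulmx u \o cg Q))).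
have sub : (S.2 :&: lker f <= ker_row S Q u)%VS.
  apply/subvP => v; rewrite memv_cap memv_ker lfunE /= => /andP [vS /eqP E].
  apply/ker_rowP; split=> //; have [sA dA] := aS v vS.
  have [sB dB] := alt_cg R' two (conj sA dA).
  have EB : e0 K m *m cg R' (cg Q v) = u *m cg Q v *m R'^T by rewrite /cg !mulmxA EU.
  have {}E : e0 K m *m cg R' (cg Q v) *m (Dr m)^T = 0 by rewrite EB -[RHS]E.
  have uR' : R'^T \in unitmx by rewrite unitmx_tr unitmx_inv.
  rewrite -[LHS](mulmxK uR') -EB.
  suff -> : e0 K m *m cg R' (cg Q v) = 0 by rewrite mul0mx.
  move: E; rewrite (blE sB) dB e0_bl /Dr tr_row_mx trmx0 trmx1 mul_row_col mulmx0 mulmx1 add0r => ->.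
  by rewrite raddf0 row_mx0.
rewrite -(limg_ker_dim f S.2) leq_add ?dimvS //.
by apply: leq_trans (dimvS (subvf _)) _; rewrite dimvf /dim /= mul1n.
Qed.

(** If cg Q M has a radical vector u, then u is radical for the whole of M. At large
    rank this is kernel_gap, and the hyperplane principle covers the remaining matrices. *)
Lemma radical_border m n r (S : asp n) (Q : 'M_(1 + m, n)) (c : 'rV_n) D u : bounded r S -> (1 < r)%N ->
  (forall v, v \in S.2 -> cg Q v = 0 -> v = 0) ->
  (forall S' : asp m, bounded (r - 2) S' -> (\dim S'.2 <= D)%N) -> u != 0 ->
  (D.+1 < \dim (ker_row S Q u))%N ->
  forall M, ain S M -> u *m cg Q M = 0 -> u *m (Q *m M *m c^T) = 0.
Proof.
move=> bS r1 inj HD u0 lt M MS uM; pose Su : asp n := (M, ker_row S Q u).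
have SuS N : ain Su N -> ain S N /\ u *m cg Q N = 0.
  rewrite {1}/ain /= => /ker_rowP [NM E]; split.
    by rewrite -(subrK M N) addrC ainD.
  by move: E; rewrite linearB mulmxBr uM subr0.
have [R uR ER] := row_to_e0 u0.
pose R' := invmx R; have EU : e0 K m *m R' = u by rewrite -ER mulmxK.
have uR' : R' \in unitmx by rewrite unitmx_inv.
have E1 x : u *m Q *m x *m c^T = u *m (Q *m x *m c^T) by rewrite !mulmxA.
suff E : entry_row (u *m Q) c^T M = 0.
  by rewrite -E1; apply/matrixP => i j; rewrite !ord1 [RHS]mxE; exact: E.
apply: (@affine_const_cg _ _ _ (Dr m *m R' *m Q) (r - 2) D Su) => //.
- by move=> N /SuS [/bS []].
- move=> v /ker_rowP [vS uv] _ E; apply: inj => //.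
  apply: (cg_unit_inj uR'); apply: e0_bl_eq0.
  + by rewrite !cgT (bounded_dirT bS vS).
  + by rewrite /cg !mulmxA EU -/(cg Q v) -(mulmxA u) -(mulmxA u) uv mul0mx.
  by rewrite !cg_cg.
- move=> N /SuS [NS uN] rN; have [sN le] := bS _ NS.
  apply/eqP; apply/negP => ne.
  have ne' : u *m (Q *m N *m c^T) != 0.
    by apply/eqP => E; apply: ne; apply/eqP; rewrite -E1 in E; have := congr1 (fun B : 'M_1 => B 0 0) E; rewrite [X in _ = X]mxE.
  have := kernel_gap sN uN ne'; rewrite -cg_cg in rN.
  by have := leq_trans rN (cg_rank _ _); lia.
exact: ain_base.
Qed.

Lemma linear_section m n (f : {linear 'M[K]_n -> 'M[K]_m}) (V : {vspace 'M[K]_n}) :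
  exists h : {linear 'M[K]_m -> 'M[K]_n}, forall A, A \in (linfun f @: V)%VS -> h A \in V /\ f (h A) = A.
Proof.
pose i := linfun (vsval : subvs_of V -> _); pose g := (linfun f \o i)%VF.
exists (i \o g^-1)%VF => A AV.
have gL : A \in limg g.
  have /memv_imgP [v vV ->] := AV; apply/memv_imgP; exists (vsproj V v); first exact: memvf.
  by rewrite /g comp_lfunE /=; congr (linfun f _); rewrite lfunE /= vsprojK.
have E : (i \o g^-1)%VF A = i ((g^-1)%VF A) := comp_lfunE _ _ _.
split; first by move: (i \o g^-1)%VF E => h /= ->; rewrite lfunE /= subvsP.
have := limg_lfunVK gL; rewrite {1}/g comp_lfunE lfunE => {2}<-.
by rewrite -E.
Qed.

Definition Fij m (i j : 'I_m) : 'M[K]_m := delta_mx i j + delta_mx j i.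

Lemma row_rowFij m (i j l : 'I_m) : delta_mx 0 l *m Fij i j =
  (if l == i then delta_mx 0 j else 0) + (if l == j then delta_mx 0 i else 0) :> 'rV[K]_m.
Proof. by rewrite mulmxDr !mul_delta_mx_cond; do 2!case: eqP. Qed.

Lemma alt_Fij m (i j : 'I_m) : i != j -> alt (Fij i j).
Proof.
move=> ij; split; first by rewrite linearD /= !trmx_delta addrC.
move=> l; rewrite !mxE; case: (eqVneq l i) => [->|_]; rewrite ?andbF ?addr0 //=.
by rewrite (negPf ij) addr0.
Qed.

Lemma altD m (A B : 'M[K]_m) : alt A -> alt B -> alt (A + B).
Proof.
by move=> [sA dA] [sB dB]; split=> [|i]; rewrite ?linearD /= ?sA ?sB // mxE dA dB addr0.
Qed.

Lemma hollow_sum m (A : 'M[K]_m) : alt A ->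
  A = \sum_(i < m) \sum_(j < m | (i < j)%N) A i j *: Fij i j.
Proof.
move=> [sA dA]; apply/matrixP => k l; rewrite summxE.
under eq_bigr => i _ do rewrite summxE.
have E (i j : 'I_m) : (A i j *: Fij i j) k l = A i j *+ ((k == i) && (l == j)) + A i j *+ ((k == j) && (l == i)).
  by rewrite !mxE mulrDr !mulr_natr.
have swap (i j : 'I_m) : A i j = A j i by rewrite -{1}sA mxE.
under eq_bigr => i _ do under eq_bigr => j _ do rewrite E.
under eq_bigr => i _ do rewrite big_split /=.
rewrite big_split /=.
have one (a b : 'I_m) : \sum_(i < m) \sum_(j < m | (i < j)%N) A i j *+ ((a == i) && (b == j)) = A a b *+ (a < b)%N.
  rewrite (bigD1 a) //= [X in _ + X]big1 ?addr0; last first.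
    by move=> i ia; apply: big1 => j _; rewrite eq_sym (negPf ia).
  rewrite big_mkcond (bigD1 b) //= big1 ?addr0; last first.
    by move=> j jb; case: ifP; rewrite // (eq_sym b) (negPf jb) andbF.
  by rewrite !eqxx; case: ltnP.
rewrite one; have -> : \sum_(i < m) \sum_(j < m | (i < j)%N) A i j *+ ((k == j) && (l == i)) = A l k *+ (l < k)%N.
  by rewrite -one; do 2![apply: eq_bigr => ? _]; rewrite andbC.
rewrite (swap l k); case: ltngtP => //= [_|_|/val_inj ->]; rewrite ?addr0 ?add0r //.
Qed.

(** A local map is multiplication by a matrix. By locality G (Fij i j) is supported on
    the rows i and j, and locality at Fij i j + Fij k j shows that its row i depends on j only. *)
Lemma hollow_local m q (G : {linear 'M[K]_m -> 'M[K]_(m, q)}) : (1 < m)%N ->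
  (forall A (u : 'rV_m), alt A -> u *m A = 0 -> u *m G A = 0) ->
  exists L : 'M[K]_(m, q), forall A, alt A -> G A = A *m L.
Proof.
move=> m1 H.
have other (j : 'I_m) : exists i, i != j.
  have [E|ne] := eqVneq j (Ordinal (ltnW m1)); last by exists (Ordinal (ltnW m1)); rewrite eq_sym.
  by exists (Ordinal m1); rewrite E -val_eqE.
have [o oP] := choice other.
have row0 (i j l : 'I_m) : i != j -> l != i -> l != j -> row l (G (Fij i j)) = 0.
  move=> ij li lj; rewrite rowE; apply: H; first exact: alt_Fij.
  by rewrite row_rowFij (negPf li) (negPf lj) addr0.
have indep (i k j : 'I_m) : i != j -> k != j -> row i (G (Fij i j)) = row k (G (Fij k j)).
  move=> ij kj; have [->//|ik] := eqVneq i k.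
  have := H (Fij i j + Fij k j) (delta_mx 0 i - delta_mx 0 k) (altD (alt_Fij ij) (alt_Fij kj)).
  rewrite mulmxBl !(mulmxDr _ (Fij i j) (Fij k j)) !row_rowFij !eqxx (negPf ij) (negPf kj) (negPf ik) eq_sym (negPf ik).
  rewrite !(addr0, add0r) subrr => /(_ erefl).
  rewrite linearD /= mulmxBl !(mulmxDr _ (G (Fij i j)) (G (Fij k j))) -!rowE (row0 k j i kj) ?(row0 i j k ij) // 1?eq_sym //.
  by rewrite addr0 add0r => /eqP; rewrite subr_eq0 => /eqP.
exists (\matrix_j row (o j) (G (Fij (o j) j))).
set L := \matrix_j _.
have FL i j : i != j -> G (Fij i j) = Fij i j *m L.
  move=> ij; apply/row_matrixP => l; rewrite [RHS]row_mul rowE row_rowFij mulmxDl.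
  have [->|li] := eqVneq l i.
    by rewrite (negPf ij) mul0mx addr0 -rowE rowK; apply: indep.
  have [->|lj] := eqVneq l j.
    rewrite mul0mx add0r -rowE rowK (_ : Fij i j = Fij j i); last by rewrite /Fij addrC.
    by apply: indep => //; rewrite eq_sym.
  by rewrite !mul0mx addr0 row0.
move=> A aA; rewrite {1 2}(hollow_sum aA) linear_sum mulmx_suml; apply: eq_bigr => i _.
rewrite linear_sum mulmx_suml; apply: eq_bigr => j ij.
by rewrite linearZ /= -scalemxAl FL // -val_eqE neq_ltn ij.
Qed.

(** After subtracting the multiplication of hollow_local, G is supported on the diagonal:
    it maps delta_mx i i to its row i, equal to some c_i. Locality at the square of e_i + t e_j
    gives t c_i = t^2 c_j, so that c_i does not depend on i and vanishes if t^2 differs from t. *)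
Lemma sym_local m q (G : {linear 'M[K]_m -> 'M[K]_(m, q)}) : (1 < m)%N ->
  (forall A (u : 'rV_m), A^T = A -> u *m A = 0 -> u *m G A = 0) ->
  exists (L : 'M[K]_(m, q)) (mu : 'rV_q), (mu = 0 \/ gf2) /\
    forall A, A^T = A -> G A = A *m L + diag_col A *m mu.
Proof.
move=> m1 H; have [L HL] := hollow_local m1 (fun A u (aA : alt A) => H A u (proj1 aA)).
pose D A : 'M_(m, q) := G A - A *m L.
have DD A B : D (A + B) = D A + D B by rewrite /D linearD mulmxDl opprD addrACA.
have DZ t A : D (t *: A) = t *: D A by rewrite /D linearZ -scalemxAl scalerBr.
have D0 A : alt A -> D A = 0 by move=> /HL E; rewrite /D E subrr.
have HD A (u : 'rV_m) : A^T = A -> u *m A = 0 -> u *m D A = 0.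
  by move=> sA uA; rewrite /D mulmxBr mulmxA uA mul0mx subr0 (H A u sA uA).
pose G' (i : 'I_m) : 'M_(m, q) := D (delta_mx i i).
have rowG' (i l : 'I_m) : l != i -> row l (G' i) = 0.
  move=> li; have E : delta_mx 0 l *m delta_mx i i = 0 :> 'rV[K]_m by rewrite mul_delta_mx_0.
  rewrite rowE; apply: HD => //; exact: trmx_delta.
have cc (t : K) (i j : 'I_m) : i != j -> t *: row i (G' i) = (t * t) *: row j (G' j).
  move=> ij; pose A := delta_mx i i + t *: Fij i j + (t * t) *: delta_mx j j.
  pose u : 'rV[K]_m := t *: delta_mx 0 i - delta_mx 0 j.
  have sA : A^T = A.
    rewrite /A; have Ft := proj1 (alt_Fij ij); move: (Fij i j) Ft => F Ft.
    by rewrite !linearD !linearZ /= !trmx_delta Ft.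
  have uA : u *m A = 0.
    have EF x := row_rowFij i j x; move: (Fij i j) EF @A {sA} => F EF A.
    rewrite /u /A mulmxBl -scalemxAl !mulmxDr -!scalemxAr !EF !mul_delta_mx_cond !eqxx (negPf ij) eq_sym (negPf ij) /=.
    rewrite !(mulr1n, mulr0n, scaler0, addr0, add0r) scalerDr scalerA.
    by rewrite subrr.
  have := HD A u sA uA.
  rewrite /A !DD !DZ (D0 _ (alt_Fij ij)) scaler0 addr0 -/(G' i) -/(G' j).
  rewrite mulmxDr -scalemxAr /u !mulmxBl -!scalemxAl -!rowE (rowG' i j) 1?eq_sym // (rowG' j i) //.
  by rewrite subr0 scaler0 sub0r scalerN => /eqP; rewrite subr_eq0 => /eqP.
pose o : 'I_m := Ordinal (ltnW m1); pose mu := row o (G' o).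
have Emu i : row i (G' i) = mu.
  have [->//|io] := eqVneq i o.
  by have := cc 1 i o io; rewrite mulr1 !scale1r.
have EG' i : G' i = delta_mx i 0 *m mu.
  apply/row_matrixP => l; have [->|li] := eqVneq l i.
    by rewrite Emu rowE mulmxA mul_delta_mx [delta_mx 0 0]mx11_scalar mxE mul1mx.
  by rewrite rowG' // rowE mulmxA mul_delta_mx_0 // mul0mx.
exists L, mu; split.
  have [->|mu0] := eqVneq mu 0; [by left | right=> t].
  have io : Ordinal m1 != o by rewrite -val_eqE.
  have /eqP := cc t _ _ io; rewrite !Emu -subr_eq0 -scalerBl scaler_eq0 (negPf mu0) orbF.
  rewrite -{1}[t]mulr1 -mulrBr mulf_eq0 subr_eq0 => /orP [/eqP ->|/eqP <-]; [by left | by right].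
move=> A sA; pose d := \sum_i A i i *: (delta_mx i i : 'M[K]_m).
have dE i j : d i j = A i i *+ (i == j).
  rewrite /d summxE (bigD1 i) //= big1 ?addr0; last first.
    by move=> k ki; rewrite !mxE eq_sym (negPf ki) mulr0.
  by rewrite !mxE eqxx /= eq_sym mulr_natr.
have aA : alt (A - d).
  split=> [|i]; last by rewrite [LHS]mxE [X in _ + X]mxE dE eqxx subrr.
  rewrite linearB /= sA; congr (_ - _); apply/matrixP => i j; rewrite mxE !dE eq_sym.
  by case: eqP => [->|].
have -> : G A = A *m L + D A by rewrite /D addrC subrK.
congr (_ + _); rewrite -{1}(subrK d A) DD (D0 _ aA) add0r.
have -> : D d = \sum_i A i i *: G' i.
  rewrite /d; elim/big_rec2: _ => [|i x y _ E]; last by rewrite DD DZ E.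
  by rewrite -(scale0r (0 : 'M_m)) DZ scale0r.
have -> : diag_col A = \sum_i A i i *: (delta_mx i 0 : 'cV[K]_m).
  by rewrite [LHS]matrix_sum_delta; apply: eq_bigr => i _; rewrite big_ord1 mxE.
by rewrite mulmx_suml; apply: eq_bigr => i _; rewrite EG' -scalemxAl.
Qed.
End LocalMaps.

(** * Reconstruction of a space from a faithful restriction *)

Section Reconstruction.
Variable K : fieldType.
Local Notation asp := (asp K).
Local Notation Dr := (Dr K).
Local Notation gf2 := (two_elements K).

Lemma natr_odd m : 2%:R = 0 :> K -> m%:R = (odd m)%:R :> K.
Proof. by move=> two; rewrite -{1}(odd_double_half m) natrD -muln2 natrM two mulr0 addr0. Qed.

(** Compute the parity of the rank of the matrix A bordered by its diagonal c and the
    corner 1 in two ways: from A, and from the corner, whose complement A - c^T c is alternating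
    over two elements and thus has even rank. *)
Lemma diag_form m (A : 'M[K]_m) (x : 'rV_m) : gf2 -> A^T = A -> A \in unitmx ->
  x *m A = (diag_col A)^T -> ql x A x = m%:R.
Proof.
move=> g2 sA uA Ex; have two := card2_two g2; set c := (diag_col A)^T in Ex.
have E1 := rank_bl 1 x sA; rewrite Ex (mxrank_unit uA) in E1.
have E2 := shear_bl (- c) 1 c A.
rewrite !scale1r addNr in E2; have Nc : (- c)^T = - c^T by rewrite linearN.
rewrite Nc !(mulNmx, mulmxN) opprK subrr add0r in E2.
set B := _ + A in E2.
have aB : alt B.
  split=> [|i]; first by rewrite /B linearD linearN /= trmx_mul trmxK sA.
  rewrite /B [LHS]mxE [X in X + _]mxE [X in - X + _]mxE big_ord1 trmxK /c !mxE.
  by case: (g2 (A i i)) => ->; rewrite ?mulr0 ?mulr1 ?oppr0 ?addr0 // addNr.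
have E3 := rank_bl 1 0 (proj1 aB).
rewrite mul0mx ql0l ?mul0mx // -E2 (rank_unit _ (shear_unit _)) E1 oner_eq0 in E3.
have oE : odd ((1 != ql x A x) + m) by rewrite E3 oddD /= alt_rank_even.
rewrite (natr_odd _ two); move: oE; rewrite oddD oddb.
case: (g2 (ql x A x)) => ->; first by rewrite oner_eq0 /=; case: (odd m).
by rewrite eqxx /= => ->.
Qed.

(** The analogue of radical_border for r = 2, where the gap is too small for the hyperplane
    principle; a third scalar replaces it. *)
Lemma radical_border_rank2 n k (S : asp n) (Q : 'M_(k, n)) (c : 'rV_n) u : bounded 2 S -> ~ gf2 ->
  (forall v, v \in S.2 -> cg Q v = 0 -> v = 0) -> (0 < \dim (ker_row S Q u))%N ->
  forall M, ain S M -> u *m cg Q M = 0 -> u *m (Q *m M *m c^T) = 0.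
Proof.
move=> bS /existsNP [t /not_orP [t0 t1]] inj d0 M MS uM.
have H N : ain S N -> u *m cg Q N = 0 -> cg Q N != 0 -> u *m (Q *m N *m c^T) = 0.
  move=> NS uN N0; apply/eqP/negPn/negP => ne; have [sN le] := bS _ NS.
  by have := leq_trans (kernel_gap sN uN ne) le; rewrite -mxrank_eq0 in N0; lia.
have [M0|] := eqVneq (cg Q M) 0; last exact: H.
pose v := vpick (ker_row S Q u).
have v0 : v != 0 by rewrite vpick0 -dimv_eq0 -lt0n.
have [vS uv] := ker_rowP _ _ _ _ (memv_pick (ker_row S Q u)).
have Hs s : s <> 0 -> u *m (Q *m M *m c^T) + s *: (u *m (Q *m v *m c^T)) = 0.
  move=> s0; have := H (M + s *: v) (ainD MS (memvZ s vS)).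
  rewrite linearD linearZ /= mulmxDr -scalemxAr uM uv scaler0 addr0 M0 add0r => /(_ erefl).
  rewrite !(mulmxDr, mulmxDl) -!(scalemxAl, scalemxAr); apply.
  rewrite scaler_eq0; apply/norP; split; first exact/eqP.
  by apply: contra v0 => /eqP E; apply/eqP; apply: inj.
move: Hs; set a := u *m (Q *m M *m _); set b := u *m _ => Hs.
have E s : s <> 0 -> s *: b = - a by move=> /Hs /eqP; rewrite addrC addr_eq0 => /eqP.
have E1 := E 1 (elimN eqP (oner_neq0 K)).
have /eqP : (t - 1) *: b = 0 by rewrite scalerBl E1 (E t t0) subrr.
rewrite scaler_eq0 subr_eq0 => /orP [/eqP //|/eqP b0].
by move/eqP: E1; rewrite b0 scaler0 eq_sym oppr_eq0 => /eqP.
Qed.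

Lemma radical_border_cols n k q (Q : 'M[K]_(k, n)) (C : 'M[K]_(q, n)) u M :
  (forall c : 'rV_n, u *m (Q *m M *m c^T) = 0) -> u *m (Q *m M *m C^T) = 0 :> 'rV_q.
Proof.
move=> H; apply/rowP => j.
have := congr1 (fun B : 'M_1 => B 0 0) (H (row j C)); rewrite tr_row colE !mulmxA -colE mxE => ->.
by rewrite !mxE.
Qed.

(** S is the graph of an affine map above the space of its restrictions. *)
Lemma frame n k (S : asp n) (Q : 'M[K]_(k, n)) (P : 'M[K]_k -> Prop) :
  (forall v, v \in S.2 -> cg Q v = 0 -> v = 0) ->
  (forall M, ain S M -> P (cg Q M)) -> (forall A, P A -> A \in (compr Q S).2) ->
  exists M0 (h : {linear 'M[K]_k -> 'M[K]_n}),
    [/\ ain S M0, cg Q M0 = 0,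
        forall A, P A -> h A \in S.2 /\ cg Q (h A) = A
      & forall M, ain S M -> M = M0 + h (cg Q M)].
Proof.
move=> inj HP fP; have [h Hh] := linear_section (cg Q) S.2.
have P1 := HP _ (ain_base S); have [h1 h2] := Hh _ (fP _ P1).
exists (S.1 - h (cg Q S.1)), h.
have MS : ain S (S.1 - h (cg Q S.1)) by apply: ainD (ain_base S) _; rewrite rpredN.
have M0 : cg Q (S.1 - h (cg Q S.1)) = 0 by rewrite linearB /= h2 subrr.
split=> // [A /fP/Hh //|M NS]; have [h3 h4] := Hh _ (fP _ (HP _ NS)).
apply/eqP; rewrite -subr_eq0; apply/eqP; apply: inj; last by rewrite linearB linearD /= M0 add0r h4 subrr.
by apply: ainB => //; apply: ainD.
Qed.
Lemma col_mx_shear q k n (Q : 'M[K]_(k, n)) (C : 'M[K]_(q, n)) (L : 'M[K]_(k, q)) :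
  col_mx (C - L^T *m Q) Q = block_mx 1%:M (- L^T) 0 1%:M *m col_mx C Q.
Proof. by rewrite mul_block_col !mul1mx mul0mx add0r mulNmx. Qed.

Lemma col_mx_shear_unit q k (Q : 'M[K]_(k, q + k)) (C : 'M[K]_(q, q + k)) (L : 'M[K]_(k, q)) :
  col_mx C Q \in unitmx -> col_mx (C - L^T *m Q) Q \in unitmx.
Proof.
by move=> u; rewrite col_mx_shear unitmx_mul u andbT unitmxE det_ublock !det1 mulr1 unitr1.
Qed.

Lemma cg_col_mx q k n (Q : 'M[K]_(k, n)) (C : 'M[K]_(q, n)) M : M^T = M ->
  cg (col_mx C Q) M = block_mx (cg C M) (Q *m M *m C^T)^T (Q *m M *m C^T) (cg Q M).
Proof.
by move=> sM; rewrite /cg mul_col_mx tr_col_mx mul_col_row !trmx_mul trmxK sM mulmxA.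
Qed.

(** The off-diagonal block is a local function of A, so sym_local brings it to
    diag_col A *m mu; the remaining block is then forced by the rank at invertible A,
    by diag_form, and everywhere by the hyperplane principle. *)
Lemma shape_S q m (S : asp (q + (1 + m))) (Q : 'M[K]_(1 + m, q + (1 + m))) :
  bounded m.+1 S -> (0 < m)%N -> row_free Q ->
  (forall v, v \in S.2 -> cg Q v = 0 -> v = 0) -> \dim S.2 = s1 m.+1 m.+1 -> (m = 1%N -> ~ gf2) ->
  exists (mu : 'rV[K]_q) (P : 'M[K]_(q + (1 + m))), [/\ P \in unitmx, mu = 0 \/ gf2 &
    forall M, ain S M <-> exists2 A, A^T = A & cg P M =
      block_mx (m.+1%:R *: (mu^T *m mu)) (diag_col A *m mu)^T (diag_col A *m mu) A].
Proof.
move=> bS m0 fQ inj dS nF; have [C uC] := row_free_complete fQ.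
have sT A : A^T = A -> A \in (compr Q S).2.
  apply: sym_full; last by rewrite dim_comp_inj.
  by move=> v /dir_comp [w wS ->]; rewrite cgT (bounded_dirT bS wS).
have [M0 [h [M0S QM0 hP hS]]] := frame inj (fun M MS => bounded_sym (bounded_comp bS) (comp_ain Q MS)) sT.
have dk u : (s1 m m <= \dim (ker_row S Q u))%N.
  by have := ker_row_dim S Q u; rewrite dS (s1S _ m m); lia.
have starS M (u : 'rV_(1 + m)) : ain S M -> u *m cg Q M = 0 -> u *m (Q *m M *m C^T) = 0.
  move=> MS uM; apply: radical_border_cols => c; have [->|u0] := eqVneq u 0; first by rewrite mul0mx.
  have [m1|m1] := eqVneq m 1%N.
    subst m; apply: (radical_border_rank2 c bS (nF erefl) inj _ MS uM).
    by apply: leq_trans (dk u).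
  have HD (S' : asp m) : bounded (m.+1 - 2) S' -> (\dim S'.2 <= dmax m (m.+1 - 2))%N.
    by move=> b; have [] := dim_bound_classified _ b; lia.
  apply: (@radical_border K m _ m.+1 S Q c (dmax m (m.+1 - 2)) u bS _ inj HD u0 _ M MS uM) => //.
  apply: leq_trans (dk u); case: (m) m0 m1 => [|[|k]] // _ _.
  by rewrite (_ : k.+3 - 2 = k.+1)%N // dmax_corank1 (s1S _ k.+2 k.+1); lia.
pose G A := Q *m h A *m C^T.
have lG : linear G by move=> a A B; rewrite /G linearP mulmxDr mulmxDl -scalemxAr -scalemxAl.
pose GL : {linear 'M[K]_(1 + m) -> 'M[K]_(1 + m, q)} := HB.pack G (GRing.isLinear.Build K _ _ _ G lG).
have GM0 : Q *m M0 *m C^T = 0.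
  by rewrite -[LHS]mul1mx; apply/row_matrixP => i; rewrite row_mul starS ?row0 // QM0 mulmx0.
have [L [mu [mu0 HG]]] : exists (L : 'M[K]_(1 + m, q)) (mu : 'rV_q), (mu = 0 \/ gf2) /\
    forall A, A^T = A -> GL A = A *m L + diag_col A *m mu.
  apply: sym_local => // A u sA uA; have [hA1 hA2] := hP _ sA.
  have := starS (M0 + h A) u (ainD M0S hA1); rewrite linearD /= QM0 hA2 add0r => /(_ uA).
  by rewrite mulmxDr mulmxDl GM0 add0r.
pose P := col_mx (C - L^T *m Q) Q; have uP : P \in unitmx by apply: col_mx_shear_unit.
exists mu, P; split=> //.
have EM M : ain S M -> Q *m M *m (C - L^T *m Q)^T = diag_col (cg Q M) *m mu.
  move=> MS; have sA := bounded_sym (bounded_comp bS) (comp_ain Q MS).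
  rewrite linearB /= mulmxBr trmx_mul trmxK {1}(hS _ MS) mulmxDr mulmxDl GM0 add0r.
  have := HG _ sA; rewrite /= /G => ->; rewrite mulmxA -/(cg Q M) addrAC subrr add0r.
  by [].
(* At invertible A the corner is the Schur term mu^T d^T A^-1 d mu, with d the diagonal of A. *)
have ED M : ain S M -> cg (C - L^T *m Q) M = m.+1%:R *: (mu^T *m mu).
  move=> MS; apply/matrixP => i j.
  pose phi := entry_row (row i (C - L^T *m Q)) (row j (C - L^T *m Q))^T.
  have Ephi N : cg (C - L^T *m Q) N i j = phi N.
    by rewrite /phi /entry_row /cg tr_row -!row_mul colE mulmxA -colE !mxE.
  rewrite Ephi; apply: (@affine_const_cg _ _ _ Q m (dmax m.+1 m) S) MS => //.
  - by move=> S' b; have [] := dim_bound_classified (ltnSn m) b.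
  - by move=> N /bS [].
  - by move=> v vS _; apply: inj.
  - move=> N NS rN; apply: etrans (esym (Ephi N)) _; have [sN le] := bS _ NS.
    have sA : (cg Q N)^T = cg Q N by rewrite cgT sN.
    have rA : \rank (cg Q N) = m.+1 by apply/eqP; rewrite eqn_leq rN rank_leq_row.
    have uA : cg Q N \in unitmx by rewrite -row_full_unit /row_full rA.
    have : (\rank N <= \rank (cg Q N))%N by rewrite rA.
    rewrite -(rank_unit N uP) cg_col_mx // EM // -[X in block_mx _ _ X _]trmxK => le'.
    have := rank_block_leP sA le'; set d := diag_col _ => /(_ (mu^T *m d^T *m invmx (cg Q N))).
    rewrite mulmxKV // trmx_mul => /(_ erefl) ->.
    have [mz|g2] := mu0; first by rewrite mz !(trmx0, mul0mx, mulmx0, scaler0).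
    rewrite !trmx_mul !trmxK trmx_inv sA.
    have -> : mu^T *m d^T *m (invmx (cg Q N) *m (d *m mu)) =
       mu^T *m (ql (d^T *m invmx (cg Q N)) (cg Q N) (d^T *m invmx (cg Q N)))%:M *m mu.
      by rewrite -qlE trmx_mul trmx_inv sA trmxK mulmxKV // !mulmxA.
    by rewrite diag_form // ?mulmxKV // mul_mx_scalar -scalemxAl.
  by rewrite dmax_corank1 dS (s1S _ m.+1 m); lia.
move=> M; split=> [MS|[A sA EP]].
  have [sM _] := bS _ MS; exists (cg Q M); first by rewrite cgT sM.
  by rewrite /P cg_col_mx // EM // ED.
have [hA1 hA2] := hP _ sA; have NS : ain S (M0 + h A) by apply: ainD.
suff -> : M = M0 + h A by [].
apply: (can_inj (cgK (mulVmx uP))); rewrite EP /P cg_col_mx ?(bounded_sym bS NS) // EM // ED //.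
by rewrite linearD /= QM0 hA2 add0r.
Qed.

(** The same argument as for shape_S. The rank of an alternating matrix
    drops by two at a time, which makes up for the smaller dimension. *)
Lemma shape_A q m (S : asp (q + (1 + m))) (Q : 'M[K]_(1 + m, q + (1 + m))) :
  bounded m S -> (1 < m)%N -> row_free Q ->
  (forall v, v \in S.2 -> cg Q v = 0 -> v = 0) -> \dim S.2 = s1 m.+1 m ->
  (forall M, ain S M -> alt (cg Q M)) -> 2%:R = 0 :> K -> ~~ odd m -> q = 0%N \/ (3 < m)%N ->
  exists2 P : 'M[K]_(q + (1 + m)), P \in unitmx &
    forall M, ain S M <-> exists2 A, alt A & cg P M = block_mx 0 0 0 A.
Proof.
move=> bS m1 fQ inj dS aS two em q0; have [C uC] := row_free_complete fQ.
have altN (A : 'M[K]_(1 + m)) : alt A -> alt (- A).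
  by move=> [sA dA]; split=> [|i]; rewrite ?linearN /= ?sA // mxE dA oppr0.
have aS2 v : v \in S.2 -> alt (cg Q v).
  apply: (dir_of_ain aS) => M N aM aN; rewrite linearB /=; exact: altD aM (altN _ aN).
have sT A : alt A -> A \in (compr Q S).2.
  apply: alt_full; last by rewrite dim_comp_inj.
  by move=> v /dir_comp [w wS ->]; apply: aS2.
have [M0 [h [M0S QM0 hP hS]]] := frame inj aS sT.
have starS M (u : 'rV_(1 + m)) : ain S M -> u *m cg Q M = 0 -> u *m (Q *m M *m C^T) = 0.
  case: q0 => [q0 _ _|m3 MS uM]; first by subst q; rewrite [LHS]thinmx0.
  apply: radical_border_cols => c; have [->|u0] := eqVneq u 0; first by rewrite mul0mx.
  have HD (S' : asp m) : bounded (m - 2) S' -> (\dim S'.2 <= dmax m (m - 2))%N.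
    by move=> b; have [] := dim_bound_classified _ b; lia.
  apply: (@radical_border K m _ m S Q c (dmax m (m - 2)) u bS _ inj HD u0 _ M MS uM) => //.
  have E : s1 m.+1 m = (s1 m m.-1 + m)%N by case: (m) m1 => // k _; rewrite (s1S _ k.+1 k).
  have := ker_row_dim_alt u0 two aS2; rewrite dS E leq_add2r => /(leq_trans _); apply.
  exact: dmax_gap_corank2 (ltnW m3).
pose G A := Q *m h A *m C^T.
have lG : linear G by move=> a A B; rewrite /G linearP mulmxDr mulmxDl -scalemxAr -scalemxAl.
pose GL : {linear 'M[K]_(1 + m) -> 'M[K]_(1 + m, q)} := HB.pack G (GRing.isLinear.Build K _ _ _ G lG).
have GM0 : Q *m M0 *m C^T = 0.
  by rewrite -[LHS]mul1mx; apply/row_matrixP => i; rewrite row_mul starS ?row0 // QM0 mulmx0.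
have [L HG] : exists L : 'M[K]_(1 + m, q), forall A, alt A -> GL A = A *m L.
  apply: hollow_local => [|A u aA uA]; first exact: ltnW.
  have [hA1 hA2] := hP _ aA.
  have := starS (M0 + h A) u (ainD M0S hA1); rewrite linearD /= QM0 hA2 add0r => /(_ uA).
  by rewrite mulmxDr mulmxDl GM0 add0r.
pose P := col_mx (C - L^T *m Q) Q; have uP : P \in unitmx by apply: col_mx_shear_unit.
exists P => //.
have EM M : ain S M -> Q *m M *m (C - L^T *m Q)^T = 0.
  move=> MS; have aA := aS _ MS.
  rewrite linearB /= mulmxBr trmx_mul trmxK {1}(hS _ MS) mulmxDr mulmxDl GM0 add0r.
  by have := HG _ aA; rewrite /= /G => ->; rewrite mulmxA -/(cg Q M) subrr.
have ED M : ain S M -> cg (C - L^T *m Q) M = 0.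
  case: q0 => [q0 _|m3 MS]; first by subst q; rewrite [LHS]flatmx0.
  apply/matrixP => i j; rewrite [RHS]mxE.
  pose phi := entry_row (row i (C - L^T *m Q)) (row j (C - L^T *m Q))^T.
  have Ephi N : cg (C - L^T *m Q) N i j = phi N.
    by rewrite /phi /entry_row /cg tr_row -!row_mul colE mulmxA -colE !mxE.
  rewrite Ephi; apply: (@affine_const_cg _ _ _ Q (m - 2) (dmax m.+1 (m - 2)) S) MS => //.
  - have m2 : (m - 2 < 1 + m)%N by lia.
    by move=> S' b; have [] := dim_bound_classified m2 b.
  - by move=> N /bS [].
  - by move=> v vS _; apply: inj.
  - move=> N NS rN; apply: etrans (esym (Ephi N)) _; have [sN le] := bS _ NS.
    have sA : (cg Q N)^T = cg Q N by rewrite cgT sN.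
    have rA : \rank (cg Q N) = m.
      have le1 := leq_trans (cg_rank Q N) le.
      by have := alt_rank_even (aS _ NS) two; move: rN le1; move: (\rank _); lia.
    have : (\rank N <= \rank (cg Q N))%N by rewrite rA.
    rewrite -(rank_unit N uP) cg_col_mx // EM // trmx0 => le'.
    have := @rank_block_leP _ _ _ _ (0 : 'M_(q, 1 + m)) _ sA; rewrite trmx0 => /(_ _ le' 0).
    by rewrite mul0mx => /(_ erefl) ->; rewrite !mul0mx mxE.
  - by have := dmax_gap_alt m3; rewrite dS.
move=> M; split=> [MS|[A aA EP]].
  have [sM _] := bS _ MS; exists (cg Q M); first exact: aS.
  by rewrite /P cg_col_mx // EM // ED // trmx0.
have [hA1 hA2] := hP _ aA; have NS : ain S (M0 + h A) by apply: ainD.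
suff -> : M = M0 + h A by [].
apply: (can_inj (cgK (mulVmx uP))); rewrite EP /P cg_col_mx ?(bounded_sym bS NS) // EM // ED // trmx0.
by rewrite linearD /= QM0 hA2 add0r.
Qed.
End Reconstruction.

(** * Congruence with block spaces *)

Section BlockSpaces.
Variable K : fieldType.
Local Notation asp := (asp K).
Local Notation Dr := (Dr K).
Local Notation gf2 := (two_elements K).

(** The equation m = n is kept apart because the block decompositions live in a size
    that is only propositionally equal to n. *)
Lemma congr_of m n (e : m = n) (S : asp n) (V W : set 'M[K]_n) (P : 'M[K]_(m, n)) : row_free P ->
  (forall M, V M <-> ain S M) ->
  (forall M, ain (compr P S) M <-> W (castmx (e, e) M)) -> congruent V W.
Proof.
case: n / e S V W P => S V W P fP HV HW; have uP : P \in unitmx by rewrite -row_free_unit.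
exists (invmx P); first by rewrite unitmx_inv.
have PK M : cg (invmx P) (cg P M) = M by rewrite cg_cg mulVmx // cg1.
apply/seteqP; split=> M.
  move=> /HV/(comp_ain P)/HW; rewrite castmx_id => WM; exists (cg P M) => //.
  exact: PK.
move=> [N WN <-]; apply/HV.
have /HW : W (castmx (erefl m, erefl m) N) by rewrite castmx_id.
by move=> /ain_comp [M' MS ->]; rewrite -/(cg _ _) PK.
Qed.

Lemma cg_cast j j' n (e : j = j') (X : 'M[K]_(j, n)) A :
  cg (castmx (e, erefl n) X)^T (castmx (e, e) A) = cg X^T A.
Proof. by case: j' / e; rewrite !castmx_id. Qed.

Lemma cg_cast_out k m n (e : m = n) (F : 'M[K]_(k, m)) A :
  castmx (e, e) (cg F^T A) = cg (castmx (erefl k, e) F)^T A.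
Proof. by case: n / e; rewrite !castmx_id. Qed.

Definition Fext j n (le : (j <= n)%N) : 'M[K]_(j, n) :=
  castmx (erefl j, subnKC le) (row_mx 1%:M 0).

Lemma block_castE j n (le : (j <= n)%N) (A : 'M[K]_j) :
  block_cast le (block_mx A 0 0 0) = cg (Fext le)^T A.
Proof.
rewrite /block_cast /Fext -cg_cast_out; congr castmx; rewrite /cg trmxK tr_row_mx trmx1 trmx0.
by rewrite mul_col_mx mul_col_row !(mul1mx, mul0mx, mulmx1, mulmx0).
Qed.

Lemma row_free_cast k m n (e : m = n) (F : 'M[K]_(k, m)) :
  row_free F -> row_free (castmx (erefl k, e) F).
Proof. by case: n / e; rewrite castmx_id. Qed.

Lemma Fext_free j n (le : (j <= n)%N) : row_free (Fext le).
Proof.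
apply: row_free_cast; apply/row_freeP; exists (col_mx 1%:M 0).
by rewrite mul_row_col mulmx1 mulmx0 addr0.
Qed.

Lemma row_free_transitive k n (X Y : 'M[K]_(k, n)) : row_free X -> row_free Y ->
  exists2 g, g \in unitmx & X *m g = Y.
Proof.
move=> fX fY; have E : X *m (pinvmx X *m Y) = Y by rewrite mulmxA mulmxVp ?mul1mx.
have [|g ug Eg] := @complete_unitmx _ _ _ X (pinvmx X *m Y).
  by rewrite E (eqnP fX) (eqnP fY).
by exists g; rewrite -?Eg.
Qed.

(** Two independent families of j rows are related by an invertible matrix. *)
Lemma congr_ext j n (le : (j <= n)%N) (V : set 'M[K]_j) (W : set 'M[K]_n) (X : 'M[K]_(j, n)) :
  row_free X -> (forall M, W M <-> exists2 A, V A & M = cg X^T A) ->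
  congruent W (zero_extension le V).
Proof.
move=> fX HW; have [g ug Eg] := row_free_transitive (Fext_free le) fX.
exists g^T; first by rewrite unitmx_tr.
have E A : g^T *m block_cast le (block_mx A 0 0 0) *m (g^T)^T = cg X^T A.
  by rewrite block_castE -/(cg g^T _) cg_cg -trmx_mul Eg.
apply/seteqP; split=> M.
  move=> /HW [A VA ->]; exists (block_cast le (block_mx A 0 0 0)); last exact: E.
  by exists A.
by move=> [_ [A VA <-] <-]; apply/HW; exists A.
Qed.

Lemma zero_extensionP j n (le : (j <= n)%N) (V : set 'M[K]_j) N :
  zero_extension le V N <-> exists2 A, V A & N = cg (Fext le)^T A.
Proof.
split; first by case=> A VA <-; exists A; rewrite ?block_castE.
by case=> A VA ->; exists A; rewrite ?block_castE.
Qed.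

Lemma cast_inj m n (e : m = n) (A B : 'M[K]_m) : castmx (e, e) A = castmx (e, e) B -> A = B.
Proof. by case: n / e; rewrite !castmx_id. Qed.

Lemma borderedP s n (le : (s <= n)%N) (D : set 'M[K]_(n - s)) (M : 'M[K]_(s + (n - s))) :
  bordered le D (castmx (subnKC le, subnKC le) M) <-> M^T = M /\ D (drsubmx M).
Proof.
split.
  move=> [sM [A [B [C [N DN EM]]]]]; move/cast_inj: EM => EM; split; last by rewrite EM block_mxKdr.
  by by apply: (@cast_inj _ _ (subnKC le)); move: sM; rewrite trmx_cast.
move=> [sM DM]; split; first by rewrite trmx_cast /= sM.
exists (ulsubmx M), (ursubmx M), (dlsubmx M), (drsubmx M) => //.
by rewrite submxK.
Qed.

(** Both dimension bounds of half_bounded_dim are attained, so that all matrices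
    with zero lower right block are directions of S. *)
Lemma shape_R s k n (e : (s + k)%N = n) (S : asp n) (Q : 'M[K]_(k, n)) o r :
  bounded r S -> row_free Q -> (o <= 1)%N -> (forall M, ain S M -> (\rank (cg Q M) <= o)%N) ->
  \dim S.2 = (s1 s s + s * k + o)%N ->
  \dim (compr Q S).2 = o /\ exists2 P : 'M[K]_(s + k, n), row_free P &
    forall M, ain (compr P S) M <-> M^T = M /\ ain (compr Q S) (drsubmx M).
Proof.
case: n / e S Q => S Q bS fQ o1 HQ dS; have [C uP] := row_free_complete fQ.
set P := col_mx C Q in uP; pose S1 := compr P S; pose Q0 : 'M[K]_(k, s + k) := row_mx 0 1%:M.
have bS1 : bounded r S1 := bounded_comp bS.
have EQ : Q0 *m P = Q by rewrite /Q0 /P mul_row_col mul0mx mul1mx add0r.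
have ET : compr Q0 S1 = compr Q S by rewrite /S1 comp_comp EQ.
have dS1 : \dim S1.2 = (s1 s s + s * k + o)%N by rewrite (dim_unit S uP).
have bT : bounded o (compr Q S).
  by move=> A /[dup] /(bounded_sym (bounded_comp bS)) sA /ain_comp [M MS EM]; rewrite EM; split; [rewrite -EM | apply: HQ].
pose U := (S1.2 :&: lker (linfun (cg Q0)))%VS.
have UP v : v \in U -> v^T = v /\ drsubmx v = 0.
  rewrite memv_cap memv_ker lfunE => /andP [vS /eqP E].
  by split; [exact: bounded_dirT bS1 vS | rewrite -drsubE].
have dT := dim_bounded01 o1 bT; have dU := isotropic_dim UP.
have dd : \dim S1.2 = (\dim U + \dim (compr Q S).2)%N by rewrite -ET; exact: dim_comp.
have [dU' dT'] : \dim U = (s1 s s + s * k)%N /\ \dim (compr Q S).2 = o by lia.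
split=> //; exists P; first by rewrite row_free_unit.
have fU (v : 'M_(s + k)) : v^T = v /\ drsubmx v = 0 -> v \in U.
  apply: vspace_add_full UP _ _ dU' v => [W|v w t [sv dv] [sw dw]]; first exact: isotropic_dim.
  split; first by rewrite linearD linearZ /= sv sw.
  by rewrite -drsubE linearD linearZ /= !drsubE dv dw scaler0 addr0.
move=> M; split=> [MS|[sM DM]].
  split; first exact: bounded_sym bS1 MS.
  by rewrite -ET -drsubE; apply: comp_ain.
move: DM; rewrite -ET => /ain_comp [N NS EN]; rewrite drsubE in EN.
have : M - N \in U.
  apply: fU; split; first by rewrite linearB /= sM (bounded_sym bS1 NS).
  by rewrite -drsubE linearB /= !drsubE EN subrr.
by rewrite memv_cap => /andP [d _]; rewrite -(subrK N M) addrC ainD.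
Qed.

Lemma gf2_card : gf2 -> ([set: K]%classic #= `I_2)%card.
Proof.
move=> g2; apply/card_set_bijP; exists (fun x : K => if x == 0 then 0%N else 1%N); split.
- by move=> x _ /=; case: eqP.
- move=> x y _ _; case: (g2 x) (g2 y) => -> [] ->; rewrite ?eqxx ?oner_eq0 //.
case=> [|[|//]] _; [exists 0 | exists 1] => //; by rewrite ?eqxx ?oner_eq0.
Qed.
End BlockSpaces.

(** * Affine spaces of singular forms in three variables over two elements *)

Notation b3 := (bool * bool * bool)%type.
Notation b6 := (b3 * b3)%type.

Definition dot3 (u v : b3) : bool :=
  let: (a, b, c) := u in let: (x, y, z) := v in (a && x) (+) (b && y) (+) (c && z).
(** Symmetric matrices of size three over two elements, as six bits. *)
Definition sym3 (t : b6) : b3 * b3 * b3 :=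
  let: ((a, b, c), (d, e, f)) := t in ((a, b, c), (b, d, e), (c, e, f)).
Definition mul3 (u : b3) (M : b3 * b3 * b3) : b3 :=
  let: (p, q, r) := M in (dot3 u p, dot3 u q, dot3 u r).
Definition act3 (P : b3 * b3 * b3) (t : b6) : b6 :=
  let: (p, q, r) := P in
  let u := mul3 p (sym3 t) in let v := mul3 q (sym3 t) in let w := mul3 r (sym3 t) in
  ((dot3 u p, dot3 u q, dot3 u r), (dot3 v q, dot3 v r, dot3 w r)).
Definition add3 (u v : b3) : b3 :=
  let: (a, b, c) := u in let: (x, y, z) := v in (a (+) x, b (+) y, c (+) z).
Definition add6 (s t : b6) : b6 := (add3 s.1 t.1, add3 s.2 t.2).

Definition bools := [:: false; true].
Definition all3 : seq b3 := [seq (p, c) | p <- [seq (a, b) | a <- bools, b <- bools], c <- bools].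
Definition nz3 : seq b3 := behead all3.
Definition all6 : seq b6 := [seq (u, v) | u <- all3, v <- all3].
Definition det3 (M : b3 * b3 * b3) : bool :=
  let: ((a, b, c), (d, e, f), (g, h, i)) := M in
  (a && ((e && i) (+) (f && h))) (+) (b && ((d && i) (+) (f && g))) (+)
  (c && ((d && h) (+) (e && g))).
Definition sing6 t := ~~ det3 (sym3 t).

(** The 168 invertible matrices. *)
Definition gl3 : seq (b3 * b3 * b3) :=
  [seq P <- [seq (p, r) | p <- [seq (p, q) | p <- nz3, q <- nz3], r <- nz3] | det3 P].

(** The seven normal forms: the extension of all forms of size two, WS, the
    alternating matrices, Z and the three exceptional spaces. *)
Definition target (k : nat) (a b c : bool) : b6 :=
  match k with
  | 0 => ((a, b, false), (c, false, false))
  | 1 => ((a, b, c), (false, false, false))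
  | 2 => ((false, a, b), (false, c, false))
  | 3 => ((a, b, a), (c, c, false))
  | 4 => ((a, b, ~~ c), (c, false, false))
  | 5 => ((a, b, ~~ (a (+) b (+) c)), (c, false, c))
  | _ => ((a, b, c), (false, ~~ a, false))
  end.
Definition targets (k : nat) : seq b6 := [seq target k u.1.1 u.1.2 u.2 | u <- all3].
Definition in_target (k : nat) (t : b6) : bool :=
  let: ((a, b, c), (d, e, f)) := t in
  match k with
  | 0 => ~~ (c || e || f)
  | 1 => ~~ (d || e || f)
  | 2 => ~~ (a || d || f)
  | 3 => ~~ ((c (+) a) || (e (+) d) || f)
  | 4 => ~~ (~~ (c (+) d) || e || f)
  | 5 => ~~ (~~ (c (+) (a (+) b (+) d)) || e || (f (+) d))
  | _ => ~~ (d || f || ~~ (e (+) a))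
  end.
Definition eq6 (s t : b6) : bool :=
  let: ((a, b, c), (d, e, f)) := add6 s t in ~~ (a || b || c || d || e || f).

(** Unlike has and all, these stop early under every reduction strategy. *)
Fixpoint hasb T (p : T -> bool) s := if s is x :: s' then if p x then true else hasb p s' else false.
Fixpoint allb T (p : T -> bool) s := if s is x :: s' then if p x then allb p s' else false else true.

Definition span6 (s : seq b6) (v : b6) := s ++ [seq add6 v t | t <- s].

Definition bit (b : bool) p := if b then xI p else xO p.
(** An injective numbering, used to choose minimal basis vectors. *)
Definition pos6 (t : b6) : positive :=
  let: ((a, b, c), (d, e, f)) := t in bit f (bit e (bit d (bit c (bit b (bit a xH))))).
Definition below (x y : b6) : bool := Pos.leb (pos6 x) (pos6 y).

Definition leaf (s : seq b6) : bool :=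
  hasb (fun P => hasb (fun k =>
    if allb (fun t => in_target k (act3 P t)) s then
      allb (fun t => hasb (fun x => eq6 t (act3 P x)) s) (targets k) else false)
        (iota 0 7)) gl3.

(** v extends the list d of directions: it is minimal in its class modulo d, and the
    new matrices are singular. *)
Definition extend (t0 : b6) (d : seq b6) (v : b6) : bool :=
  if allb (fun x => below v (add6 v x)) d then
    if hasb (eq6 v) d then false else allb (fun x => sing6 (add6 t0 (add6 v x))) d
  else false.

Definition e00 : b6 := ((true, false, false), (false, false, false)).
Definition zero6 : b6 := ((false, false, false), (false, false, false)).
(** The matrices of rank two with the first basis vector as radical. *)
Definition base3 : seq b6 :=
  [seq t <- all6 | [&& ~~ t.1.1.1, ~~ t.1.1.2, ~~ t.1.2 & det3 (sym3 (add6 t e00))]].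

(** All affine spaces of dimension three through a base matrix, listed by a basis that is
    minimal at each stage, so that each space occurs once. *)
Definition check3 := allb (fun t0 =>
  let d0 := [:: zero6] in
  allb (fun v1 => if extend t0 d0 v1 then
    let d1 := span6 d0 v1 in
    allb (fun v2 => if extend t0 d1 v2 then
      let d2 := span6 d1 v2 in
      allb (fun v3 => if extend t0 d2 v3 then leaf [seq add6 t0 x | x <- span6 d2 v3] else true) all6
    else true) all6 else true) all6) base3.

Lemma check3_true : check3 = true. Proof. by vm_compute. Qed.

Lemma allbE T (p : T -> bool) s : allb p s = all p s.
Proof. by elim: s => //= x s ->; case: (p x). Qed.
Lemma hasbE T (p : T -> bool) s : hasb p s = has p s.
Proof. by elim: s => //= x s ->; case: (p x). Qed.
Lemma mem_all6 t : t \in all6.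
Proof. by case: t => [[[[] []] []] [[[] []] []]]. Qed.
Lemma in_targetP k t : in_target k t -> exists a b c, t = target k a b c.
Proof.
case: t => [[[a b] c] [[d e] f]]; case: k => [|[|[|[|[|[|k]]]]]] /=.
- by case: c e f => [] [] [] // _; exists a, b, d.
- by case: d e f => [] [] [] // _; exists a, b, c.
- by case: a d f => [] [] [] // _; exists b, c, e.
- by case: f; rewrite ?orbT // orbF => H; exists a, b, d; move: H; case: a c d e => [] [] [] [].
- by case: e f => [] []; rewrite ?orbT // => H; exists a, b, d; move: H; case: c d => [] [].
- by case: e; rewrite ?orbT //= => H; exists a, b, d; move: H; case: a b c d f => [] [] [] [] [].
by case: d f => [] [] //= H; exists a, b, c; move: H; case: a e => [] [].
Qed.
Lemma mem_targets k a b c : target k a b c \in targets k.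
Proof. by apply/mapP; exists (a, b, c) => //; case: a b c => [] [] []. Qed.
Lemma eq6P s t : eq6 s t -> s = t.
Proof.
case: s t => [[[a b] c] [[d e] f]] [[[a' b'] c'] [[d' e'] f']]; rewrite /eq6 /=.
rewrite !negb_or -!andbA => /and5P [+ + + + /andP[]].
by do 6![rewrite negb_add => /eqP ->].
Qed.

Section Singular3.
Variable K : fieldType.
Local Notation asp := (asp K).
Hypothesis g2 : two_elements K.
Let two : 2%:R = 0 :> K := card2_two g2.

Let natrA (a b : bool) : (a (+) b)%:R = a%:R + b%:R :> K.
Proof. by case: a b => [] []; rewrite ?addr0 ?add0r // -natrD two. Qed.
Let natrI (a b : bool) : (a && b)%:R = a%:R * b%:R :> K.
Proof. by case: a b => [] []; rewrite ?mulr1 ?mulr0 ?mul0r. Qed.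

Definition mxb (M : b3 * b3 * b3) : 'M[K]_3 :=
  let: ((a, b, c), (d, e, f), (g, h, i)) := M in
  mx3 [:: [:: a%:R; b%:R; c%:R]; [:: d%:R; e%:R; f%:R]; [:: g%:R; h%:R; i%:R]].
Definition bmx (t : b6) := mxb (sym3 t).

Definition o0 : 'I_3 := @Ordinal 3 0 isT.
Definition o1 : 'I_3 := @Ordinal 3 1 isT.
Definition o2 : 'I_3 := @Ordinal 3 2 isT.

Lemma ord3_ind (P : 'I_3 -> Prop) : P o0 -> P o1 -> P o2 -> forall i, P i.
Proof.
move=> P0 P1 P2 [[|[|[|//]]] H].
- by have -> : Ordinal H = o0 by apply: val_inj.
- by have -> : Ordinal H = o1 by apply: val_inj.
by have -> : Ordinal H = o2 by apply: val_inj.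
Qed.

Lemma mx3_eq (M N : 'M[K]_3) : M o0 o0 = N o0 o0 -> M o0 o1 = N o0 o1 -> M o0 o2 = N o0 o2 ->
  M o1 o0 = N o1 o0 -> M o1 o1 = N o1 o1 -> M o1 o2 = N o1 o2 ->
  M o2 o0 = N o2 o0 -> M o2 o1 = N o2 o1 -> M o2 o2 = N o2 o2 -> M = N.
Proof. by move=> *; apply/matrixP; elim/ord3_ind; elim/ord3_ind. Qed.

Lemma sum3 (F : 'I_3 -> K) : \sum_i F i = F o0 + F o1 + F o2.
Proof.
rewrite !big_ord_recl big_ord0 addr0 addrA; congr (F _ + F _ + F _); exact: val_inj.
Qed.

Lemma mx3E (s : seq (seq K)) (i j : 'I_3) : mx3 s i j = nth 0 (nth [::] s i) j.
Proof. by rewrite mxE. Qed.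

Definition code (M : 'M[K]_3) : b6 :=
  ((M o0 o0 != 0, M o0 o1 != 0, M o0 o2 != 0), (M o1 o1 != 0, M o1 o2 != 0, M o2 o2 != 0)).

Let bit_natr (x : K) : (x != 0)%:R = x.
Proof. by case: (g2 x) => ->; rewrite ?eqxx ?oner_eq0. Qed.

Lemma codeK M : M^T = M -> bmx (code M) = M.
Proof.
move=> sM; have sw k l : M k l = M l k by rewrite -{1}sM mxE.
by apply: mx3_eq; rewrite mx3E /= bit_natr // sw.
Qed.

Lemma bmxD s t : bmx (add6 s t) = bmx s + bmx t.
Proof.
case: s t => [[[a b] c] [[d e] f]] [[[a' b'] c'] [[d' e'] f']].
by apply: mx3_eq; rewrite [RHS]mxE !mx3E /= natrA.
Qed.

Lemma cg3E (P M : 'M[K]_3) i j : cg P M i j =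
  (P i o0 * M o0 o0 + P i o1 * M o1 o0 + P i o2 * M o2 o0) * P j o0 +
  (P i o0 * M o0 o1 + P i o1 * M o1 o1 + P i o2 * M o2 o1) * P j o1 +
  (P i o0 * M o0 o2 + P i o1 * M o1 o2 + P i o2 * M o2 o2) * P j o2.
Proof.
have E k : (P *m M) i k = P i o0 * M o0 k + P i o1 * M o1 k + P i o2 * M o2 k by rewrite mxE sum3.
by rewrite /cg mxE sum3 !E; congr (_ * _ + _ * _ + _ * _); rewrite mxE.
Qed.

Lemma cg_mxb P t : cg (mxb P) (bmx t) = bmx (act3 P t).
Proof.
case: P t => [[[[p1 p2] p3] [[p4 p5] p6]] [[p7 p8] p9]] [[[a b] c] [[d e] f]].
by apply: mx3_eq; rewrite cg3E !mx3E /= !(natrA, natrI); ring.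
Qed.

Lemma det2 (M : 'M[K]_2) : \det M = M 0 0 * M 1 1 - M 0 1 * M 1 0.
Proof.
rewrite (expand_det_row _ 0) !big_ord_recl big_ord0 /cofactor !det_mx11 !mxE /= expr0 expr1 addr0 mul1r mulN1r mulrN.
by congr (_ * M _ _ - M _ _ * M _ _); apply: val_inj.
Qed.

Lemma det_mxb P : \det (mxb P) = (det3 P)%:R.
Proof.
case: P => [[[[a b] c] [[d e] f]] [[g h] i]].
rewrite (expand_det_row _ o0) sum3 /cofactor !det2 !mxE /= expr0 expr1 sqrrN expr1n !(natrA, natrI).
have N (x : K) : - x = x by apply/eqP; rewrite eq_sym -subr_eq0 opprK -mulr2n -mulr_natl two mul0r.
by rewrite !mul1r !mulN1r !N !mulrDr !mulrA.
Qed.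
End Singular3.

(** * Correctness of the enumeration *)

Section Exceptional.
Variable K : fieldType.
Local Notation asp := (asp K).
Local Notation Dr := (Dr K).
Hypothesis g2 : two_elements K.
Local Notation bmx := (bmx K).
Local Notation mxb := (mxb K).
Let two : 2%:R = 0 :> K := card2_two g2.

Lemma bmxK t : code (bmx t) = t.
Proof.
have E (b : bool) : (b%:R != 0 :> K) = b by case: b; rewrite ?oner_eq0 ?eqxx.
by case: t => [[[a b] c] [[d e] f]]; rewrite /code !mx3E /= !E.
Qed.

Lemma bmx_zero : bmx zero6 = 0.
Proof. by apply: mx3_eq; rewrite mx3E mxE. Qed.

Lemma add6K v x : add6 v (add6 v x) = x.
Proof.
case: v x => [[[a b] c] [[d e] f]] [[[a' b'] c'] [[d' e'] f']].
by rewrite /add6 /= !addKb.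
Qed.

Lemma unit_mxb P : (mxb P \in unitmx) = det3 P.
Proof. by rewrite unitmxE (det_mxb g2) unitfE; case: det3; rewrite ?oner_eq0 ?eqxx. Qed.

Section Fixed.
Variables (S : asp (1 + 2)) (t0 : b6).
Hypotheses (bS : bounded 2 S) (t0S : ain S (bmx t0)) (dS : \dim S.2 = 3%N).

Definition lists (U : {vspace 'M[K]_3}) (d : seq b6) := forall x, (bmx x \in U) = (x \in d).

Lemma sing_bmx t : ain S (bmx t) -> sing6 t.
Proof.
move=> tS; have [_ r2] := bS tS; rewrite /sing6; apply/negP => d.
have u : bmx t \in unitmx by rewrite unit_mxb.
by move: r2; rewrite (mxrank_unit u).
Qed.

(** Choose the minimal vector outside U. *)
Lemma extend_step (U : {vspace 'M[K]_3}) d : (U <= S.2)%VS -> (\dim U < 3)%N -> lists U d ->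
  exists v, extend t0 d v /\
    exists U' : {vspace 'M[K]_3}, [/\ (U' <= S.2)%VS, \dim U' = (\dim U).+1 & lists U' (span6 d v)].
Proof.
move=> US dU Ud.
have [w wS wU] : exists2 w, w \in S.2 & w \notin U.
  by apply/subvPn; apply/negP => /dimvS; rewrite dS leqNgt dU.
pose C v := (bmx v \in S.2) && (bmx v \notin U).
have Cw : C (code w) by rewrite /C (codeK g2) ?wS ?wU // (bounded_dirT bS wS).
have [v /andP [vS vU] vmin] := arg_minnP (fun v => Pos.to_nat (pos6 v)) Cw.
exists v; split.
  rewrite /extend !allbE hasbE.
  have -> : all (fun x => below v (add6 v x)) d.
    apply/allP => x; rewrite -Ud => xU; apply/Pos.leb_le/Pos2Nat.inj_le/leP; apply: vmin.
    rewrite /C (bmxD g2); apply/andP; split; last by rewrite rpredDr.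
    by apply: rpredD => //; apply: (subvP US).
  have -> : has (eq6 v) d = false.
    by apply/negP => /hasP [x xd /eq6P E]; move: vU; rewrite Ud E xd.
  apply/allP => x; rewrite -Ud => xU; apply: sing_bmx; rewrite !(bmxD g2).
  by apply: ainD => //; apply: rpredD => //; apply: (subvP US).
exists (U + <[bmx v]>)%VS; split.
- by rewrite subv_add US -memvE.
- have v0 : bmx v != 0 by apply: contraNneq vU => ->; exact: mem0v.
  apply/eqP; rewrite eqn_leq; apply/andP; split.
    by have := dimv_sum_cap U <[bmx v]>%VS; rewrite dim_vline v0; lia.
  have sub : (U <= U + <[bmx v]>)%VS := addvSl _ _.
  rewrite ltn_neqAle dimvS // andbT (dimv_leqif_eq sub).
  by apply: contra vU => /eqP ->; apply: subvP (addvSr _ _) _ (memv_line _).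
move=> x; rewrite mem_cat; apply/idP/orP.
  case/memv_addP => u uU [_ /vlineP [k ->] E].
  case: (g2 k) E => ->; rewrite ?scale0r ?scale1r ?addr0 => E; first by left; rewrite -Ud E.
  right; apply/mapP; exists (add6 v x); last by rewrite add6K.
  rewrite -Ud (bmxD g2) E addrCA -mulr2n -scaler_nat two scale0r addr0.
  exact: uU.
case=> [xd|/mapP [y yd ->]].
  by apply: subvP (addvSl _ _) _ _; rewrite Ud.
by rewrite (bmxD g2) rpredD // ?(subvP (addvSr _ _) _ (memv_line _)) // (subvP (addvSl _ _)) // Ud.
Qed.

Lemma exceptional_leaf : t0 \in base3 -> exists2 d, lists S.2 d & leaf [seq add6 t0 x | x <- d].
Proof.
move=> tb; have := check3_true; rewrite /check3 allbE => /allP /(_ _ tb).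
have L0 : lists 0%VS [:: zero6].
  move=> x; rewrite memv0 inE -bmx_zero; apply/eqP/eqP => [E|-> //].
  by rewrite -(bmxK x) E bmxK.
have d0 : (\dim (0%VS : {vspace 'M[K]_3}) < 3)%N by rewrite dimv0.
have [v1 [e1 [U1 [U1S dU1 L1]]]] := extend_step (sub0v _) d0 L0.
rewrite dimv0 in dU1.
have [|v2 [e2 [U2 [U2S dU2 L2]]]] := extend_step U1S _ L1; first by rewrite dU1.
have [|v3 [e3 [U3 [U3S dU3 L3]]]] := extend_step U2S _ L2; first by rewrite dU2 dU1.
rewrite allbE => /allP /(_ v1 (mem_all6 _)); rewrite e1 allbE => /allP /(_ v2 (mem_all6 _)).
rewrite e2 allbE => /allP /(_ v3 (mem_all6 _)); rewrite e3 => lf.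
have E : U3 = S.2 by apply/eqP; rewrite eqEdim U3S dU3 dU2 dU1 dS.
by exists (span6 (span6 (span6 [:: zero6] v1) v2) v3) => //; rewrite -E.
Qed.

Lemma exceptional_targets : t0 \in base3 -> exists2 P : 'M[K]_3, P \in unitmx &
  exists k, forall M, ain (compr P S) M <-> exists a b c, M = bmx (target k a b c).
Proof.
move=> tb; have [d Ld] := exceptional_leaf tb; rewrite /leaf hasbE => /hasP [P].
rewrite mem_filter => /andP [dP _]; rewrite hasbE => /hasP [k _]; rewrite !allbE.
case: ifP => // /allP H1 /allP H2.
exists (mxb P); first by rewrite unit_mxb.
exists k => M; split=> [/ain_comp [N NS ->]|[a [b [c ->]]]].
  have sv := bounded_dirT bS (ainB NS t0S).
  pose x := code (N - bmx t0); have Ex : bmx x = N - bmx t0 by apply: (codeK g2).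
  have xd : x \in d by rewrite -Ld Ex ainB.
  have [a [b [c Et]]] := in_targetP (H1 _ (map_f (add6 t0) xd)).
  exists a, b, c; rewrite -Et -(cg_mxb g2) (bmxD g2) Ex addrC subrK.
  by [].
have := H2 _ (mem_targets k a b c); rewrite hasbE => /hasP [_ /mapP [x xd ->] /eq6P ->].
rewrite -(cg_mxb g2) (bmxD g2); apply: comp_ain; apply: ainD => //.
by rewrite Ld.
Qed.
End Fixed.

Lemma based_base3 (S : asp (1 + 2)) : bounded 2 S -> based 2 S ->
  exists2 t0, ain S (bmx t0) & t0 \in base3.
Proof.
move=> bS [A AS rA]; have sM := bounded_sym bS AS; exists (code (bl 0 0 A)); first by rewrite (codeK g2).
have e0' : o0 = @lshift 1 2 ord0 by apply: val_inj.
have row0 j : bl 0 0 A o0 j = 0.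
  rewrite e0'; case: (@split_ordP 1 2 j) => k ->; first by rewrite block_mxEul mxE mul0rn.
  by rewrite block_mxEur mxE.
rewrite mem_filter mem_all6 andbT; apply/and4P.
split; [by rewrite /= row0 eqxx | by rewrite /= row0 eqxx | by rewrite /= row0 eqxx | ].
rewrite -unit_mxb -[mxb _]/(bmx _) (bmxD g2) (codeK g2) //.
have -> : bmx e00 = bl 1 (0 : 'rV_2) 0.
  have -> : bmx e00 = delta_mx o0 o0 by apply: mx3_eq; rewrite mx3E mxE.
  rewrite -[delta_mx o0 o0]/(delta_mx o0 o0 : 'M_(1 + 2)) e0' (@delta_mx_lshift _ _ 1 2).
  rewrite (@delta_mx_ushift _ 1 2) -[X in row_mx _ X](col_mx0 K 1 2 2) -(@block_mxEh K 1 2 1 2).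
  by rewrite [delta_mx _ _]mx11_scalar mxE /bl trmx0.
rewrite blD add0r !addr0 unitmxE /bl trmx0 (@det_ublock _ 1 2) det1 mul1r -unitmxE -row_free_unit /row_free.
by rewrite rA.
Qed.

(** There are finitely many affine spaces to consider; check3 enumerates them. *)
Lemma exceptional_shape (S : asp (1 + 2)) : bounded 2 S -> \dim S.2 = 3%N -> based 2 S ->
  exists2 P : 'M[K]_3, P \in unitmx &
  exists k, forall M, ain (compr P S) M <-> exists a b c, M = bmx (target k a b c).
Proof.
by move=> bS dS /(based_base3 bS) [t0 t0S tb]; apply: exceptional_targets tb.
Qed.
End Exceptional.

(** * Congruence of each type with a model *)

Section Congruence.
Variable K : fieldType.
Local Notation asp := (asp K).
Local Notation Dr := (Dr K).
Local Notation gf2 := (two_elements K).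

Lemma cg_invP n (P : 'M[K]_n) M B : P \in unitmx -> cg P M = B <-> M = cg (invmx P) B.
Proof.
by move=> uP; split=> [<-|->]; rewrite cg_cg ?mulVmx ?mulmxV // cg1.
Qed.

Lemma ain_unit n (P : 'M[K]_n) (S : asp n) N : P \in unitmx ->
  ain (compr P S) N <-> ain S (cg (invmx P) N).
Proof.
move=> uP; split=> [/ain_comp [M MS ->]|/(comp_ain P)].
  by rewrite cg_cg mulVmx // cg1.
by rewrite cg_cg mulmxV // cg1.
Qed.

Lemma WS_evenP n r (lt_rn : (r < n)%N) (M : 'M[K]_(r./2 + (n - r./2))) : ~~ odd r ->
  WS K lt_rn (castmx (subnKC (half_le lt_rn), subnKC (half_le lt_rn)) M) <->
  M^T = M /\ drsubmx M = 0.
Proof.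
move=> /negPf ev; rewrite /WS ev; split.
  move=> [A sA [B _ /cast_inj <-]]; rewrite tr_block_mx trmx0 trmxK sA block_mxKdr.
  by [].
move=> [sM dM]; exists (ulsubmx M); first by rewrite /symmetric_mxs /= trmx_ulsub sM.
exists (ursubmx M) => //; congr castmx.
by rewrite trmx_ursub sM -dM submxK.
Qed.

(** The restriction to the common subspace is an affine space of forms of rank at most
    odd r, classified by rank1_asp. *)
Lemma congruent_type_R n r (lt_rn : (r < n)%N) (S : asp n) (V : set 'M[K]_n) : bounded r S ->
  (forall M, V M <-> ain S M) -> type_R r S -> \dim S.2 = s2 n r ->
  congruent V (WS K lt_rn) \/ (gf2 /\ exists odd_r : odd r, congruent V (Zprime K lt_rn odd_r)).
Proof.
move=> bS HV [k [Q [Ek fQ HQ]]] dS; have Ek' : k = (n - r./2)%N by lia.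
subst k; have dS' : \dim S.2 = (s1 r./2 r./2 + r./2 * (n - r./2) + odd r)%N.
  by rewrite dS /s2 /s1; case: (odd r); rewrite ?addn0.
have e := subnKC (half_le lt_rn).
pose T := compr Q S; have bT : bounded r T := bounded_comp bS.
have shape g : g \in unitmx -> exists2 P : 'M[K]_(r./2 + (n - r./2), n), row_free P &
    forall M, ain (compr P S) M <-> M^T = M /\ ain T (cg (invmx g) (drsubmx M)).
  move=> ug; have fgQ : row_free (g *m Q) by rewrite /row_free mxrankMfree // -/(row_free g) row_free_unit.
  have [|_ [P fP HP]] := shape_R (subnKC (half_le lt_rn)) bS fgQ (leq_b1 (odd r)) _ dS'.
    by move=> M /HQ; rewrite -cg_cg; apply: leq_trans; apply: cg_rank.
  by exists P => // M; rewrite HP -comp_comp ain_unit.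
have [dT _] := shape_R e bS fQ (leq_b1 _) HQ dS'; rewrite -/T in dT.
have [od|ev] : odd r \/ ~~ odd r by case: (odd r); [left | right].
  2: {
  left; have [P fP HP] := shape _ (unitmx1 _ _).
  apply: (congr_of (e := subnKC (half_le lt_rn)) fP HV) => M; rewrite WS_evenP // HP invmx1 cg1.
  have T0 N : ain T N -> N = 0.
    by move=> /ain_comp [M' /HQ + ->]; rewrite (negPf ev) leqn0 mxrank_eq0 => /eqP.
  split=> -[sM]; first by move/T0.
  by move=> ->; split=> //; rewrite -(T0 _ (ain_base T)); exact: ain_base. }
have b1 : bounded 1 T.
  move=> N NT; split; first exact: bounded_sym bT NT.
  by have [M /HQ + ->] := ain_comp NT; rewrite od.
have d1 : (0 < \dim T.2)%N by rewrite dT od.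
have inv_cg k (g : 'M[K]_k) (X N : 'M_k) : g \in unitmx -> cg (invmx g^T) N = X <-> N = cg g^T X.
  move=> ug; rewrite cg_invP ?invmxK // unitmx_inv unitmx_tr //.
have [_ [[z z0 HT]|[g2 [z1 [z2 [fz HT]]]]]] := rank1_asp b1 d1.
  left; pose F := Fext K (half_lt_sub lt_rn).
  have fz : row_free z by rewrite /row_free rank_rV z0.
  have [g ug Eg] := row_free_transitive fz (Fext_free K (half_lt_sub lt_rn)).
  have ug' : g^T \in unitmx by rewrite unitmx_tr.
  have [P fP HP] := shape _ ug'.
  apply: (congr_of (e := subnKC (half_le lt_rn)) fP HV) => M.
  rewrite HP /WS od borderedP zero_extensionP HT.
  have EF t : cg g^T (t *: (z^T *m z)) = cg F^T t%:M.
    have EgF : z *m g = F := Eg.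
    rewrite /cg !trmxK mul_mx_scalar -EgF trmx_mul -scalemxAl -scalemxAr -scalemxAl; congr (_ *: _).
    by rewrite !mulmxA.
  split=> -[sM] [t]; last first.
    move=> _ ->; split=> //; exists (t 0 0); apply/inv_cg => //.
    by rewrite EF -mx11_scalar.
  by move=> /inv_cg -> //; split=> //; exists t%:M; rewrite ?EF.
right; split=> //; exists od; pose F := Fext K (odd_half_lt_sub lt_rn od).
pose y1 : 'rV[K]_(1 + 1) := row_mx 0 1%:M; pose y2 : 'rV[K]_(1 + 1) := row_mx 1%:M 1%:M.
have uY : col_mx y1 y2 \in unitmx.
  rewrite -block_mxEv; suff /mulmx1_unit [] :
    block_mx 0 1%:M 1%:M 1%:M *m block_mx (- 1%:M) 1%:M 1%:M 0 = 1%:M :> 'M[K]_(1 + 1) by [].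
  by rewrite mulmx_block !(mul0mx, mulmx0, mul1mx, add0r, addr0) addNr -scalar_mx_block.
have fYF : row_free (col_mx y1 y2 *m F).
  by rewrite /row_free mxrankMfree ?Fext_free // -/(row_free _) row_free_unit.
have [g ug Eg] := row_free_transitive fz fYF.
have ug' : g^T \in unitmx by rewrite unitmx_tr.
have [E1 E2] : z1 *m g = y1 *m F /\ z2 *m g = y2 *m F.
  by move: Eg; rewrite !mul_col_mx => /eq_col_mx.
have [P fP HP] := shape _ ug'.
have EF (z : 'rV_(n - r./2)) y : z *m g = y *m F -> cg g^T (z^T *m z) = cg F^T (y^T *m y).
  move=> E; have -> : cg g^T (z^T *m z) = (z *m g)^T *m (z *m g) by rewrite /cg trmxK trmx_mul !mulmxA.
  by rewrite E /cg trmxK trmx_mul !mulmxA.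
have ZE B : Z K 1 B <-> B = y1^T *m y1 \/ B = y2^T *m y2.
  have y11 : y1^T *m y1 = block_mx 0 0 0 1%:M.
    by rewrite tr_row_mx mul_col_row !trmx0 trmx1 !(mul0mx, mulmx0, mul1mx).
  have y22 : y2^T *m y2 = block_mx 1%:M 1%:M 1%:M 1%:M.
    by rewrite tr_row_mx mul_col_row !trmx1 !mul1mx.
  have dc (t : K) : diag_col (t%:M : 'M_1) = t%:M.
    by apply/matrixP => i j; rewrite !ord1 !mxE.
  have ZS (t : K) : castmx (addn1 1, addn1 1)
      (block_mx t%:M (diag_col t%:M) (diag_col t%:M)^T 1%:R%:M) =
      block_mx t%:M t%:M t%:M 1%:M :> 'M_(1 + 1).
    by rewrite castmx_id !dc tr_scalar_mx.
  rewrite y11 y22; split.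
    move=> [A _ <-]; rewrite [A]mx11_scalar ZS.
    by case: (g2 (A 0 0)) => ->; [left; rewrite raddf0 | right].
  have sc (t : K) : (t%:M : 'M_1)^T = t%:M by rewrite tr_scalar_mx.
  case=> ->; [exists 0%:M | exists 1%:M]; [exact: sc | by rewrite ZS raddf0 | exact: sc | exact: ZS].
apply: (congr_of (e := subnKC (half_le lt_rn)) fP HV) => M.
rewrite HP /Zprime borderedP zero_extensionP HT !inv_cg // (EF _ _ E1) (EF _ _ E2).
split=> -[sM].
  by case=> ->; split=> //; [exists (y1^T *m y1) | exists (y2^T *m y2)] => //; apply/ZE; [left | right].
by case=> B /ZE [->|->] ->; split=> //; [left | right].
Qed.

Lemma congruent_type_S n r (lt_rn : (r < n)%N) (S : asp n) (V : set 'M[K]_n) : bounded r S ->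
  (forall M, V M <-> ain S M) -> (1 < r)%N -> type_S r S -> (r = 2%N -> ~ gf2) ->
  congruent V (zero_extension (ltnW lt_rn) (symmetric_mxs K r)) \/
  (gf2 /\ congruent V (zero_extension lt_rn (Z K r))).
Proof.
move=> bS HV r1 [Q [fQ inj dS]] nF.
have [m Er] : exists m, r = m.+1 by exists r.-1; lia.
have [q En] : exists q, n = (q + (1 + m))%N by exists (n - r)%N; lia.
subst r n; have m0 : (0 < m)%N by [].
have nF' : m = 1%N -> ~ gf2 by move=> E; apply: nF; rewrite E.
have [mu [P [uP mu0 HP]]] := shape_S bS m0 fQ inj dS nF'.
have [z|muN] := eqVneq mu 0.
  left; pose X := row_mx 0 1%:M *m (invmx P)^T : 'M[K]_(1 + m, q + (1 + m)).
  apply: (@congr_ext _ m.+1 _ _ _ _ X).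
    apply: row_free_mulmx; last by rewrite row_free_unit unitmx_tr unitmx_inv.
    by apply/row_freeP; exists (col_mx 0 1%:M); rewrite mul_row_col mul0mx mulmx1 add0r.
  have EX (A : 'M_(1 + m)) : cg X^T A = cg (invmx P) (block_mx 0 0 0 A).
    rewrite /X trmx_mul trmxK -cg_cg; congr cg; rewrite /cg trmxK tr_row_mx trmx0 trmx1.
    by rewrite mul_col_mx mul_col_row !(mul0mx, mulmx0, mul1mx, mulmx1).
  move=> M; rewrite HV HP; split=> -[A sA E]; exists A => //.
    by rewrite EX; apply/cg_invP; rewrite // E z !(mulmx0, trmx0, scaler0).
  by rewrite z !(mulmx0, trmx0, scaler0); apply/cg_invP; rewrite // -EX.
have g2 : gf2 by case: mu0 => // E; case/eqP: muN.
right; split=> //; pose X1 : 'M[K]_((1 + m) + 1, q + (1 + m)) := block_mx 0 1%:M mu 0.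
pose X : 'M[K]_(m.+2, q + (1 + m)) := castmx (addn1 m.+1, erefl) (X1 *m (invmx P)^T).
have fX1 : row_free X1.
  have /row_freeP [nu Enu] : row_free mu by rewrite /row_free rank_rV muN.
  apply/row_freeP; exists (block_mx 0 nu 1%:M 0).
  by rewrite mulmx_block !(mul0mx, mulmx0, mul1mx, add0r, addr0) Enu -scalar_mx_block.
apply: (@congr_ext _ m.+2 _ _ _ _ X).
  rewrite /X; case: _ / (addn1 m.+1); rewrite castmx_id.
  by apply: row_free_mulmx fX1 _; rewrite row_free_unit unitmx_tr unitmx_inv.
have EX (A : 'M_(1 + m)) : cg X^T (castmx (addn1 m.+1, addn1 m.+1)
      (block_mx A (diag_col A) (diag_col A)^T m.+1%:R%:M)) =
    cg (invmx P) (block_mx (m.+1%:R *: (mu^T *m mu)) (diag_col A *m mu)^T (diag_col A *m mu) A).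
  rewrite /X cg_cast trmx_mul trmxK -cg_cg; congr cg.
  rewrite /cg trmxK /X1 tr_block_mx !trmx0 trmx1 !mulmx_block.
  rewrite !(mul0mx, mulmx0, mul1mx, mulmx1, add0r, addr0) trmx_mul.
  by rewrite mul_mx_scalar -scalemxAl.
move=> M; rewrite HV HP; split.
  move=> [A sA E]; exists (castmx (addn1 m.+1, addn1 m.+1)
      (block_mx A (diag_col A) (diag_col A)^T m.+1%:R%:M)); first by exists A.
  by rewrite EX; apply/cg_invP.
move=> [_ [A sA <-]]; rewrite [cg _ _]EX => E; exists A => //.
by apply/cg_invP.
Qed.

Lemma congruent_type_A n r (lt_rn : (r < n)%N) (S : asp n) (V : set 'M[K]_n) : bounded r S ->
  (forall M, V M <-> ain S M) -> (1 < r)%N -> type_A r S -> n = r.+1 \/ (3 < r)%N ->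
  [/\ 2%N \in [pchar K], ~~ odd r & congruent V (zero_extension lt_rn (alternating_mxs K r.+1))].
Proof.
move=> bS HV r1 [Q [fQ inj dS [aS two er]]] nr.
have [q En] : exists q, n = (q + (1 + r))%N by exists (n - r.+1)%N; lia.
subst n; have nr' : q = 0%N \/ (3 < r)%N by case: nr => [E|]; [left; lia | right].
have [P uP HP] := shape_A bS r1 fQ inj dS aS two er nr'.
split=> //; first by rewrite inE /= two eqxx.
pose X := row_mx 0 1%:M *m (invmx P)^T : 'M[K]_(1 + r, q + (1 + r)).
apply: (@congr_ext _ r.+1 _ _ _ _ X).
  apply: row_free_mulmx; last by rewrite row_free_unit unitmx_tr unitmx_inv.
  by apply/row_freeP; exists (col_mx 0 1%:M); rewrite mul_row_col mul0mx mulmx1 add0r.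
have EX (A : 'M_(1 + r)) : cg X^T A = cg (invmx P) (block_mx 0 0 0 A).
  rewrite /X trmx_mul trmxK -cg_cg; congr cg; rewrite /cg trmxK tr_row_mx trmx0 trmx1.
  by rewrite mul_col_mx mul_col_row !(mul0mx, mulmx0, mul1mx, mulmx1).
have N (A : 'M[K]_(1 + r)) : - A = A.
  by apply/eqP; rewrite eq_sym -subr_eq0 opprK -mulr2n -scaler_nat two scale0r.
move=> M; rewrite HV HP; split=> -[A [sA dA] E]; exists A.
- by split; rewrite ?N.
- by rewrite EX; apply/cg_invP.
- by split; rewrite // sA N.
by apply/cg_invP; rewrite // -EX.
Qed.

Lemma cast_mxs_id n (W : set 'M[K]_n) : cast_mxs (erefl n) W = W.
Proof.
apply/seteqP; split=> [_ [M WM <-]|M WM]; first by rewrite castmx_id.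
by exists M; rewrite ?castmx_id.
Qed.

Lemma cg_ul m k (A : 'M[K]_m) :
  cg (row_mx 1%:M 0 : 'M_(m, m + k))^T A = block_mx A 0 0 0.
Proof.
rewrite /cg trmxK tr_row_mx trmx0 trmx1.
by rewrite mul_col_mx mul_col_row !(mul0mx, mulmx0, mul1mx, mulmx1).
Qed.

Section Three.
Hypothesis g2 : gf2.
Local Notation bmx := (bmx K).
Let two : 2%:R = 0 :> K := card2_two g2.

Let natrN (b : bool) : (~~ b)%:R = b%:R + 1 :> K.
Proof. by case: b; rewrite ?add0r // -mulr2n two. Qed.
Let natrA (a b : bool) : (a (+) b)%:R = a%:R + b%:R :> K.
Proof. by case: a b => [] []; rewrite ?addr0 ?add0r // -natrD two. Qed.
Let bit (x : K) : exists b : bool, x = b%:R.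
Proof. by case: (g2 x) => ->; [exists false | exists true]. Qed.

Lemma bmx_block t (A : 'M[K]_2) (u : 'cV_2) (d : K) : A^T = A ->
  bmx t = block_mx A u u^T d%:M :> 'M_(2 + 1) <->
  t = ((A 0 0 != 0, A 0 1 != 0, u 0 0 != 0), (A 1 1 != 0, u 1 0 != 0, d != 0)).
Proof.
move=> sA; have swA : A 1 0 = A 0 1 by rewrite -{1}sA mxE.
have e0' : o0 = lshift 1 (0 : 'I_2) by apply: val_inj.
have e1' : o1 = lshift 1 (1 : 'I_2) by apply: val_inj.
have e2' : o2 = rshift 2 (0 : 'I_1) by apply: val_inj.
pose B : 'M[K]_(2 + 1) := block_mx A u u^T d%:M.
have sB : B^T = B by rewrite /B tr_block_mx trmxK tr_scalar_mx sA.
have Bs i j : B (lshift 1 i) (lshift 1 j) = A i j by rewrite /B block_mxEul.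
have Bu i : B (lshift 1 i) (rshift 2 0) = u i 0 by rewrite /B block_mxEur.
have Bd : B (rshift 2 0) (rshift 2 0) = d by rewrite /B block_mxEdr mxE.
have cB : code B = ((A 0 0 != 0, A 0 1 != 0, u 0 0 != 0), (A 1 1 != 0, u 1 0 != 0, d != 0)).
  by rewrite /code e0' e1' e2' !Bs !Bu Bd.
rewrite -cB; split=> [E|->]; last exact: (codeK g2 sB).
by rewrite -(bmxK K t) (E : bmx t = B).
Qed.

Lemma sym2_bits (a b c : bool) : exists A : 'M[K]_2, A^T = A /\
  [/\ (A 0 0 != 0) = a, (A 0 1 != 0) = b & (A 1 1 != 0) = c].
Proof.
have E (x : bool) : (x%:R != 0 :> K) = x by case: x; rewrite ?oner_eq0 ?eqxx.
exists (\matrix_(i, j) if i == j then (if i == 0 then a else c)%:R else b%:R).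
split; last by rewrite !mxE /= !E.
by apply/matrixP => i j; rewrite !mxE eq_sym; case: eqP => [->|].
Qed.

Lemma target0P (M : 'M[K]_3) : (exists a b c, M = bmx (target 0 a b c)) <->
  exists2 A : 'M_2, A^T = A & M = block_mx A 0 0 0 :> 'M_(2 + 1).
Proof.
have z0 : (0 : K) != 0 = false by rewrite eqxx.
split=> [[a [b [c ->]]]|[A sA EM]].
  have [A [sA [E1 E2 E3]]] := sym2_bits a b c; exists A => //.
  have [_] := bmx_block (target 0 a b c) 0 0 sA; rewrite !mxE z0 E1 E2 E3 trmx0 raddf0.
  exact.
exists (A 0 0 != 0), (A 0 1 != 0), (A 1 1 != 0).
have [_] := bmx_block (target 0 (A 0 0 != 0) (A 0 1 != 0) (A 1 1 != 0)) 0 0 sA.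
by rewrite !mxE z0 trmx0 raddf0 EM => ->.
Qed.

Lemma target3P (M : 'M[K]_3) : (exists a b c, M = bmx (target 3 a b c)) <-> Z K 2 M.
Proof.
have z0 : (2%:R : K) != 0 = false by rewrite two eqxx.
split=> [[a [b [c ->]]]|[A sA <-]].
  have [A [sA [E1 E2 E3]]] := sym2_bits a b c; exists A => //.
  have [_] := bmx_block (target 3 a b c) (diag_col A) 2%:R sA.
  by rewrite !mxE z0 E1 E2 E3 castmx_id => ->.
exists (A 0 0 != 0), (A 0 1 != 0), (A 1 1 != 0); rewrite castmx_id.
have [_] := bmx_block (target 3 (A 0 0 != 0) (A 0 1 != 0) (A 1 1 != 0)) (diag_col A) 2%:R sA.
by rewrite !mxE z0 => ->.
Qed.

Lemma target4P (M : 'M[K]_3) : (exists a b c, M = bmx (target 4 a b c)) <-> Y1 K M.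
Proof.
have E (a b c : bool) : bmx (target 4 a b c) =
    mx3 [:: [:: a%:R; b%:R; c%:R + 1]; [:: b%:R; c%:R; 0]; [:: c%:R + 1; 0; 0]].
  by rewrite /bmx /= natrN.
split=> [[a [b [c ->]]]|[x [y [z ->]]]]; first by exists a%:R, b%:R, c%:R; rewrite E.
by have [a ->] := bit x; have [b ->] := bit y; have [c ->] := bit z; exists a, b, c; rewrite E.
Qed.

Lemma target5P (M : 'M[K]_3) : (exists a b c, M = bmx (target 5 a b c)) <-> Y2 K M.
Proof.
have E (a b c : bool) : bmx (target 5 a b c) =
    mx3 [:: [:: a%:R; b%:R; a%:R + b%:R + c%:R + 1]; [:: b%:R; c%:R; 0];
            [:: a%:R + b%:R + c%:R + 1; 0; c%:R]].
  by rewrite /bmx /= natrN !natrA.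
split=> [[a [b [c ->]]]|[x [y [z ->]]]]; first by exists a%:R, b%:R, c%:R; rewrite E.
by have [a ->] := bit x; have [b ->] := bit y; have [c ->] := bit z; exists a, b, c; rewrite E.
Qed.

Lemma target6P k (M : 'M[K]_3) : (exists a b c, M = bmx (target k.+4.+2 a b c)) <-> Y3 K M.
Proof.
have E (a b c : bool) : bmx (target k.+4.+2 a b c) =
    mx3 [:: [:: a%:R; b%:R; c%:R]; [:: b%:R; 0; a%:R + 1]; [:: c%:R; a%:R + 1; 0]].
  by rewrite /bmx /= natrN.
split=> [[a [b [c ->]]]|[x [y [z ->]]]]; first by exists a%:R, b%:R, c%:R; rewrite E.
by have [a ->] := bit x; have [b ->] := bit y; have [c ->] := bit z; exists a, b, c; rewrite E.
Qed.

Lemma congruent_exceptional (lt_rn : (2 < 3)%N) (S : asp 3) (V : set 'M[K]_3) : bounded 2 S ->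
  (forall M, V M <-> ain S M) -> \dim S.2 = 3%N ->
  [\/ congruent V (zero_extension (ltnW lt_rn) (symmetric_mxs K 2)),
      type_R 2 S, type_A 2 S
    | congruent V (zero_extension lt_rn (Z K 2))
      \/ [\/ congruent V (Y1 K), congruent V (Y2 K) | congruent V (Y3 K)]].
Proof.
move=> bS HV dS.
have [P0 uP0 bas] : exists2 P, P \in unitmx & based 2 (compr P S).
  apply: (@full_rank_coord K 2 2 S bS) => //; apply/not_exists2P => H.
  have b1 : bounded 1 S.
    move=> M MS; have [sM le] := bS _ MS; split=> //.
    by have := H M; case=> // /eqP; move: le; case: (\rank M) => [|[|[|]]].
  by have := dim_bounded01 (leqnn 1) b1; rewrite dS.
have [P1 uP1 [k HP1]] := exceptional_shape g2 (bounded_comp bS) (etrans (dim_unit S uP0) dS) bas.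
pose P := P1 *m P0; have uP : P \in unitmx by rewrite unitmx_mul uP1 uP0.
have HP M : ain (compr P S) M <-> exists a b c, M = bmx (target k a b c).
  by rewrite -HP1 comp_comp.
have fP : row_free P by rewrite row_free_unit.
have cong (W : set 'M_3) : (forall M, (exists a b c, M = bmx (target k a b c)) <-> W M) -> congruent V W.
  move=> HW; apply: (congr_of (e := erefl 3%N) fP HV) => M.
  by rewrite castmx_id HP HW.
have fX : row_free (invmx P)^T by rewrite row_free_unit unitmx_tr unitmx_inv.
case: k HP cong {HP1} => [|[|[|[|[|[|k]]]]]] HP cong.
- constructor 1; pose X0 : 'M[K]_(2, 3) := row_mx (1%:M : 'M_2) (0 : 'cV_2).
  pose X : 'M[K]_(2, 3) := X0 *m (invmx P)^T.
  apply: (@congr_ext _ 2 3 _ _ _ X).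
    apply: row_free_mulmx => //; apply/row_freeP.
    exists (col_mx (1%:M : 'M_2) (0 : 'M_(1, 2)) : 'M_(2 + 1, 2)).
    by rewrite /X0 (@mul_row_col K 2 2 1 2) mulmx0 mulmx1 addr0.
  have EX (A : 'M_2) : cg X^T A = cg (invmx P) (block_mx A 0 0 0 : 'M_(2 + 1)).
    rewrite /X trmx_mul trmxK -cg_cg; congr cg; exact: (@cg_ul 2 1 A).
  move=> M; rewrite HV; split=> [MS|[A sA EM]].
    have /HP/target0P [A sA EA] := comp_ain P MS; exists A => //.
    by rewrite EX -EA cg_cg mulVmx // cg1.
  have /HP : exists a b c, block_mx A 0 0 0 = bmx (target 0 a b c) by apply/target0P; exists A.
  by rewrite ain_unit // -EX -EM.
- constructor 2; exists 2%N, (Dr 2 *m P); split=> //.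
    by rewrite /row_free mxrankMfree // -/(row_free _) Dr_free.
  move=> M /(comp_ain P)/HP [a [b [c E]]]; rewrite -cg_cg E leqn0 mxrank_eq0.
  apply/eqP; rewrite -[bmx _]/(bmx (target 1 a b c) : 'M_(1 + 2)) cg_Dr.
  apply/matrixP => i j; rewrite [RHS]mxE 2!mxE /= [LHS]mxE.
  by case: i j => [[|[|//]] ?] [[|[|//]] ?].
- constructor 3; exists P; split=> //; first by move=> v vS; apply: cg_unit_inj.
  split=> // M /(comp_ain P)/HP [a [b [c ->]]]; split.
    by apply: mx3_eq; rewrite mxE !mx3E.
  by apply: ord3_ind; rewrite mx3E.
- constructor 4; left; apply: (@congr_ext K 3 3 lt_rn (Z K 2) V (invmx P)^T fX) => M; rewrite trmxK HV; split=> [MS|[A ZA EM]].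
    have /HP/target3P ZA := comp_ain P MS; exists (cg P M) => //.
    by rewrite cg_cg mulVmx // cg1.
  have /target3P/HP := ZA; rewrite ain_unit //.
  by rewrite EM.
- by constructor 4; right; constructor 1; apply: cong => M; exact: target4P.
- by constructor 4; right; constructor 2; apply: cong => M; exact: target5P.
by constructor 4; right; constructor 3; apply: cong => M; exact: target6P.
Qed.
End Three.
End Congruence.

(** * The main result *)

Local Open Scope classical_set_scope.
Local Open Scope ring_scope.

Theorem theorem1p4 (K : fieldType) (n r : nat) (lt_rn : (r < n)%N)
    (S : set 'M[K]_n) (V : {vspace 'M[K]_n})
    (S_affine : affine_subspace S V)
    (S_sym : S `<=` symmetric_mxs K n)
    (S_rank : forall M : 'M[K]_n, S M -> (\rank M <= r)%N) :
  (\dim V <= maxn (s1 n r) (s2 n r))%N /\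
  (\dim V = maxn (s1 n r) (s2 n r) ->
      congruent S (zero_extension (ltnW lt_rn) (symmetric_mxs K r))
   \/ congruent S (WS K lt_rn)
   \/ [/\ 2%N \in [pchar K], ~~ odd r
        & congruent S (zero_extension lt_rn (alternating_mxs K r.+1))]
   \/ (([set: K] #= `I_2)%card /\ congruent S (zero_extension lt_rn (Z K r)))
   \/ (([set: K] #= `I_2)%card /\
       exists odd_r : odd r, congruent S (Zprime K lt_rn odd_r))
   \/ [/\ ([set: K] #= `I_2)%card, r = 2%N
        & exists eq_3n : 3%N = n,
            [\/ congruent S (cast_mxs eq_3n (Y1 K)),
                congruent S (cast_mxs eq_3n (Y2 K))
              | congruent S (cast_mxs eq_3n (Y3 K))]]).
Proof.
have [P ES] := S_affine; pose T : asp K n := (P, V).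
have HS M : S M <-> ain T M.
  rewrite ES /ain /=; split=> [[v vV <-]|MV]; first by rewrite addrC addKr.
  by exists (M - P) => //; rewrite addrC subrK.
have bT : bounded r T by move=> M /HS MS; split; [exact: S_sym | exact: S_rank].
have [le cl] := dim_bound_classified lt_rn bT; split=> // dV.
have dT : \dim T.2 = dmax n r by [].
have [tR|nR] := pselect (type_R r T).
  have dE : \dim T.2 = s2 n r.
    by apply/eqP; rewrite eqn_leq (type_R_dim bT lt_rn tR) dT leq_maxr.
  have [cW|[g2 cZ]] := congruent_type_R lt_rn bT HS tR dE; first by right; left.
  by do 4!right; left; split=> //; apply: gf2_card.
(* For r at most 1 the bound on the ranks is the condition of type_R, on the whole space. *)
have [r1|r1] := leqP r 1%N.
  case: nR; exists n, 1%:M; split; rewrite ?row_free_unit ?unitmx1 //; first by lia.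
  move=> M /bT [_ rM]; rewrite cg1; lia.
have [[n3 [r2 g2]]|nexc] := pselect (n = 3%N /\ (r = 2%N /\ two_elements K)).
  subst n r; have d3 : \dim T.2 = 3%N by rewrite dT dmax_rank2.
  have [cS|tR|tA|[cZ|Ys]] := congruent_exceptional g2 lt_rn bT HS d3.
  - by left.
  - by case: nR.
  - by right; right; left; apply: (congruent_type_A lt_rn bT HS r1 tA); left.
  - by do 3!right; left; split=> //; apply: gf2_card.
  do 5!right; split; [exact: gf2_card | by [] | exists erefl].
  by rewrite !cast_mxs_id.
(* The bound is n for r = 2 and s1 is 3, so the faithful types need n = 3 there. *)
have r2 : r = 2%N -> \dim T.2 = s1 n r -> n = 3%N.
  by move=> r2; rewrite dT r2 dmax_rank2 //; rewrite -r2.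
have [tR|tS|tA|[n3 r2' g2]] := cl dT r1; first by case: nR.
- have nF : r = 2%N -> ~ two_elements K.
    move=> e2 g2; apply: nexc; split; last by [].
    by apply: r2 => //; case: tS => Q [].
  have [cS|[g2 cZ]] := congruent_type_S lt_rn bT HS r1 tS nF; first by left.
  by do 3!right; left; split=> //; apply: gf2_card.
- right; right; left; apply: (congruent_type_A lt_rn bT HS r1 tA).
  have [Q [_ _ d [_ _ er]]] := tA.
  have [e2|ne] := eqVneq r 2%N; first by left; rewrite (r2 e2 d) e2.
  by right; move: r1 er ne; case: (r) => [|[|[|[|k]]]].
by case: nexc.
Qed.
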